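(* Let $\mathcal{P}$ be a unitary set-operad and let $M=(M_*,M^* )$ be a Janus functor $\Omega(\mathcal{P})_2\to Ab$. Then $M$ is a pseudo-Mackey functor if and only if the following relations are satisfied: (1) $T_i^n=(M^*(\tau_i^n,1_{\mathcal{P}}^{\times n}))^{-1}$ for $1\le i\le n-1$; (2) $I_{n-1}^{\alpha_1,\dots,\alpha_{n-1}}P_i^n=P_i^nI_n^{\alpha_1,\dots,\alpha_{i-1},\alpha_i,\alpha_i,\alpha_{i+1},\dots,\alpha_{n-1}}$ for $1\le i<n$ and $\alpha_1,\dots,\alpha_{n-1}\in\mathcal{P}(1)$; (3) $H_j^{(n+k-1,n-1)\,\alpha}P_i^n=P_i^{n+k}H_{j+1}^{(n+k,n)\,\alpha}$ for $1\le i<j<n$, $1\le k<n$ and $\alpha\in\mathcal{P}(k+1)$; (4) $H_j^{(n+k-1,n-1)\,\alpha}P_i^n=P_{k+i}^{n+k}H_j^{(n+k,n)\,\alpha}$ for $1\le j<i<n$, $1\le k<n$ and $\alpha\in\mathcal{P}(k+1)$; (5) for $1\le i<n$, $1\le k\le n$ and $\alpha\in\mathcal{P}(k+1)$: $$H_i^{(n+k-1,n-1)\,\alpha}P_i^n=P_{i+k}^{n+k}P_{i+k-1}^{n+k+1}\cdots P_i^{n+2k}\,M_*(\sigma)\,H_i^{(n+2k,n+k)\,\alpha}H_{i+1}^{(n+k,n)\,\alpha}$$ $$+\sum_{\beta=1}^{k+1}\ \sum_{i\le u_1<\cdots<u_\beta\le i+k}P_{v_r}^{n+k}\cdots P_{v_2}^{n+2k-\beta-1}P_{v_1}^{n+2k-\beta}\sum_{(\epsilon_1,\dots,\epsilon_\beta)\in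 J}M_*(\sigma_{u_1+\epsilon_1(k+1),\dots,u_\beta+\epsilon_\beta(k+1)})$$ $$\circ\ H_i^{(n+2k-\beta,\ n+k-\epsilon_1-\cdots-\epsilon_\beta)\ \gamma(\alpha;\omega_1,\dots,\omega_{k+1})}\ H_{i+1}^{(n+k-\epsilon_1-\cdots-\epsilon_\beta,\ n)\ \gamma(\alpha;\omega'_1,\dots,\omega'_{k+1})},$$ where: - $\{v_1<\cdots<v_r\}=\{i,\dots,i+k\}\setminus\{u_1,\dots,u_\beta\}$, $r=k+1-\beta$ (so the product of the $P$'s is obtained by omitting the lower indices $u_1,\dots,u_\beta$, with consecutive upper indices from $n+2k-\beta$ down to $n+k$; it is the identity if $r=0$); - $J=\{(\epsilon_1,\dots,\epsilon_\beta)\in\{0,1\}^\beta\mid\beta-k\le\epsilon_1+\cdots+\epsilon_\beta\le k\}$; - for $l\in\{1,\dots,k+1\}$, $\omega_l=0_{\mathcal{P}}$ if $l=u_j-i+1$ for some $j$ with $\epsilon_j=0$, and $\omega_l=1_{\mathcal{P}}$ otherwise; $\omega'_l=0_{\mathcal{P}}$ if $l=u_j-i+1$ for some $j$ with $\epsilon_j=1$, and $\omega'_l=1_{\mathcal{P}}$ otherwise; - $\sigma$ is the permutation of $\underline{n+2k}$ with $\sigma(i+j)=i+2j$ and $\sigma(i+k+1+j)=i+2j+1$ for $0\le j\le k$, and $\sigma(x)=x$ for all other $x$; - $\sigma_{u_1+\epsilon_1(k+1),\dots,u_\beta+\epsilon_\beta(k+1)}$ is the permutation of $\underline{n+2k-\beta}$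 obtained from the two-line notation of $\sigma$ by removing the columns whose top entries are $u_1+\epsilon_1(k+1),\dots,u_\beta+\epsilon_\beta(k+1)$ and reindexing. In (5) one uses the convention $H_p^{(m,m)\,\omega}=I_m^{1_{\mathcal{P}}^{\times(p-1)},\,\omega,\,1_{\mathcal{P}}^{\times(m-p)}}$ for $1\le p\le m$ and $\omega\in\mathcal{P}(1)$.
   Context: Operads. A set-operad $\mathcal{P}$ consists of sets $\mathcal{P}(j)$, $j\ge 0$, with right actions of the symmetric groups $\mathfrak{S}_j$, a unit $1_{\mathcal{P}}\in\mathcal{P}(1)$ and composition maps $\gamma:\mathcal{P}(n)\times\mathcal{P}(m_1)\times\cdots\times\mathcal{P}(m_n)\to\mathcal{P}(m_1+\cdots+m_n)$ that are associative, unital and equivariant in the usual sense. It is unitary if $\mathcal{P}(0)=\{0_{\mathcal{P}}\}$. The categories $\mathcal{S}(\mathcal{P})$ and $\Omega(\mathcal{P})$. The objects of $\mathcal{S}(\mathcal{P})$ are the sets $\underline{n}=\{1,\dots,n\}$, $n\ge 0$; a morphism $\underline{n}\to\underline{m}$ is a pair $(f,\omega^f)$ with $f:\underline{n}\to\underline{m}$ a map and $\omega^f\in\prod_{y\in\underline{m}}\mathcal{P}(|f^{-1}(y)|)$. The composite of $(f,\omega^f):\underline n\to\underline m$ and $(g,\omega^g):\underline m\to\underline l$ is $(g\circ f,\omega^{g\circ f})$ with $\omega^{g\circ f}_i=\gamma(\omega^g_i;\omega^f_{j_1},\dots,\omega^f_{j_s}).\sigma_i$, where $g^{-1}(i)=\{j_1<\dots<j_s\}$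 and, if $(x_1,x_2,\dots)$ is the natural ordering of $(g\circ f)^{-1}(i)$ and $(y_1,y_2,\dots)$ is its ordering listing first $f^{-1}(j_1)$ in natural order, then $f^{-1}(j_2)$, etc., then $\sigma_i(k)=l$ where $y_l=x_k$. $\Omega(\mathcal{P})$ is the subcategory with all objects and the morphisms $(f,\omega^f)$ with $f$ surjective. $\Omega$ is the category of the sets $\underline{n}$ and surjective maps. The double category $\Omega(\mathcal{P})_2$. Horizontal arrows: morphisms of $\Omega$; vertical arrows: morphisms of $\Omega(\mathcal{P})$. A square $\mathcal{D}$ consists of horizontal $f:A\to B$, $g:C\to D$ and vertical $(\phi,\omega^\phi):A\to C$, $(\psi,\omega^\psi):B\to D$ such that $\psi f=g\phi$ is a pullback diagram of sets and, for all $c\in C$, $g_*(\omega^\phi_c)=\omega^\psi_{g(c)}$. Here $g_*:\mathcal{P}(|\phi^{-1}(c)|)\to\mathcal{P}(|\psi^{-1}(g(c))|)$ is induced by the bijection $\phi^{-1}(c)\to\psi^{-1}(g(c))$ given by $f$: identifying both fibres with some $\underline{r}$ by their natural orders, this is a permutation $h$ of $\underline{r}$, and $g_*(\omega)=\omega.h^{-1}$. Given $g$ and $(\psi,\omega^\psi)$ with common target there is such a square, unique up to isomorphism. Double isomorphisms are the pairs $(f,u)$ with $f:A\to A$ a bijection and $u=(f,(1_{\mathcal{P}},\dots,1_{\mathcal{P}}))$. For $A'\subset A$ with inclusion $i$ ($A'$ identified with $\underline{|A'|}$ by the order-preserving bijection), let $f_{A'}=f\circ i$ and $(\phi,\omega^\phi)_{A'}=(\phi,\omega^\phi)\circ(i,\omega^i)$,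 where $\omega^i_y=1_{\mathcal{P}}$ for $y\in A'$ and $\omega^i_y=0_{\mathcal{P}}$ otherwise. $A'$ is $\mathcal{D}$-admissible if $f\circ i$ and $\phi\circ i$ are surjective; $Adm(\mathcal{D})$ is the set of these. Functors. A Janus functor $M:\Omega(\mathcal{P})_2\to Ab$ ($Ab$ the category of abelian groups) is a pair of functors $M_*:\Omega\to Ab$ and $M^*:\Omega(\mathcal{P})^{op}\to Ab$ agreeing on objects (common value $M(A)$). It is a pseudo-Mackey functor if (a) $M_*(f)M^*(u)=\mathrm{Id}$ for every double isomorphism $(f,u)$; (b) for every square $\mathcal{D}$ in $\Omega(\mathcal{P})_2$ with horizontal arrows $f:A\to B$, $g:C\to D$ and vertical arrows $(\phi,\omega^\phi):A\to C$, $(\psi,\omega^\psi):B\to D$, $M^*(\psi,\omega^\psi)\circ M_*(g)=\sum_{A'\in Adm(\mathcal{D})}M_*(f_{A'})\circ M^*((\phi,\omega^\phi)_{A'})$. Generators. For $1\le i<n$: $s_i^n:\underline{n}\to\underline{n-1}$ is the order-preserving surjection with $s_i^n(i)=s_i^n(i+1)=i$, and $\tau_i^n$ is the transposition of $\underline n$ exchanging $i$ and $i+1$. For $1\le k<n$ and $1\le i\le n-k$: $s_i^{n,n-k}:\underline{n}\to\underline{n-k}$ is the order-preserving surjection with $s_i^{n,n-k}(i)=\cdots=s_i^{n,n-k}(i+k)=i$; for $\omega\in\mathcal{P}(k+1)$, $(s_i^{n,n-k},\omega)$ denotes the morphism $(s_i^{n,n-k},(1_{\mathcal{P}}^{\times(i-1)},\omega,1_{\mathcal{P}}^{\times(n-k-i)}))$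 of $\Omega(\mathcal{P})$. For a Janus functor $M$ put $I_n^{\alpha_1,\dots,\alpha_n}=M^*(\mathrm{Id}_n,(\alpha_1,\dots,\alpha_n)):M(\underline n)\to M(\underline n)$ for $\alpha_i\in\mathcal{P}(1)$; $T_k^n=M_*(\tau_k^n):M(\underline n)\to M(\underline n)$; $P_i^n=M_*(s_i^n):M(\underline n)\to M(\underline{n-1})$; $H_i^{(n,n-p)\,\omega}=M^*(s_i^{n,n-p},\omega):M(\underline{n-p})\to M(\underline n)$ for $\omega\in\mathcal{P}(p+1)$. Here $1_{\mathcal{P}}^{\times m}$ is the sequence $1_{\mathcal{P}},\dots,1_{\mathcal{P}}$ of length $m$.
   Formalization: Relations (3), (4), (5) are required for all k ≥ 1: the upper bounds k < n (in (3), (4)) and k ≤ n (in (5)) are dropped, because with them the ''if'' direction fails, e.g. (5) at n = 2, k = 3 for an operad with an indecomposable operation of arity 4. *)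

(* Defs.v *)
From HB Require Import structures.
From mathcomp Require Import all_boot all_order all_fingroup all_algebra.

Set Implicit Arguments.
Unset Strict Implicit.
Unset Printing Implicit Defensive.

Import GRing.Theory.

(* The set {1, ..., n} is represented by 'I_n, the ordinal x standing for the
   element x.+1.  Functions nat -> nat such as [smap], [tau] or [shuffle]
   below use the 1-based numbering. *)

Section Listings.
Variables (T : eqType) (p q : nat) (y : 'I_p -> T) (x : 'I_q -> T).

(* y and x enumerate the same elements, without repetition *)
Definition listings : bool := uniq (codom y) && perm_eq (codom y) (codom x).

Hypothesis yx : listings.

Lemma listings_size : p = q.
Proof.
by case/andP: yx => _ /perm_size; rewrite !size_codom !card_ord.
Qed.

Lemma listings_index k : index (x k) (codom y) < q.
Proof.
case/andP: yx => _ yxE; rewrite -[q]card_ord -(size_codom x) -(perm_size yxE).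
by rewrite index_mem (perm_mem yxE) codom_f.
Qed.

Lemma listings_inj : injective (fun k => Ordinal (listings_index k)).
Proof.
case/andP: yx => yU yxE.
have xi : injective x.
  by apply/injectiveP; rewrite /injectiveb /dinjectiveb -/(codom x)
     -(perm_uniq yxE).
move=> k l [] /(congr1 (nth (x k) (codom y))).
by rewrite !nth_index ?(perm_mem yxE) ?codom_f // => /xi.
Qed.

(* the permutation s such that y_(s k) = x_k *)
Definition listing_perm : 'S_q := perm listings_inj.

End Listings.

Lemma listingsI (T : eqType) p q (y : 'I_p -> T) (x : 'I_q -> T) :
  injective y -> injective x -> (forall t, (t \in codom y) = (t \in codom x)) ->
  listings y x.
Proof.
move=> yi xi E; rewrite /listings.
have yU : uniq (codom y) by apply/injectiveP.
by rewrite yU uniq_perm //; apply/injectiveP.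
Qed.

(* For w in P p and listings y, x of the same elements, the element w.s of P q
   where s is the permutation such that y_(s k) = x_k. *)
Definition reorder (P : nat -> Type) (act : forall n, P n -> 'S_n -> P n)
    (T : eqType) p q (y : 'I_p -> T) (x : 'I_q -> T)
    (yx : listings y x) (w : P p) : P q :=
  act q (ecast r (P r) (listings_size yx) w) (listing_perm yx).

Section OperadListings.
Variables (n : nat) (m : 'I_n -> nat).

Definition block_listing (s : 'S_n) (k : 'I_(\sum_i m (s i))) :
    {i : 'I_n & 'I_(m i)} :=
  let t := tagnat.sig k in existT (fun i => 'I_(m i)) (s (tag t)) (tagged t).

Definition sum_listing (t : forall i, 'S_(m i)) (k : 'I_(\sum_i m i)) :
    {i : 'I_n & 'I_(m i)} :=
  let u := tagnat.sig k in
  existT (fun i => 'I_(m i)) (tag u) (t (tag u) (tagged u)).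

Lemma block_listingP (s : 'S_n) : listings tagnat.sig (block_listing (s := s)).
Proof.
apply: listingsI => [||t]; first exact: tagnat.sig_inj.
  move=> k l; rewrite /block_listing => E; apply: tagnat.sig_inj.
  case: (tagnat.sig k) (tagnat.sig l) E => [i a] [j b] /= E.
  have /perm_inj ij : s i = s j := congr1 tag E.
  by move: b E; rewrite -ij => b /eqP; rewrite eq_Tagged => /eqP <-.
have [u <-] : exists u, tagnat.sig u = t.
  by exists (tagnat.rank t); rewrite tagnat.rankK.
rewrite codom_f; apply/esym/codomP.
case: (tagnat.sig u) => i; rewrite -(permKV s i) => j.
exists (tagnat.rank (existT (fun i => 'I_(m (s i))) _ j)).
by rewrite /block_listing tagnat.rankK.
Qed.

Lemma sum_listingP (t : forall i, 'S_(m i)) :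
  listings tagnat.sig (sum_listing t).
Proof.
apply: listingsI => [||v]; first exact: tagnat.sig_inj.
  move=> k l; rewrite /sum_listing => E; apply: tagnat.sig_inj.
  case: (tagnat.sig k) (tagnat.sig l) E => [i a] [j b] /= E.
  have ij : i = j := congr1 tag E.
  by move: b E; rewrite -ij => b /eqP; rewrite eq_Tagged => /eqP /perm_inj <-.
have [u <-] : exists u, tagnat.sig u = v.
  by exists (tagnat.rank v); rewrite tagnat.rankK.
rewrite codom_f; apply/esym/codomP.
case: (tagnat.sig u) => i j.
exists (tagnat.rank (existT (fun i => 'I_(m i)) i ((t i)^-1%g j))).
by rewrite /sum_listing tagnat.rankK /= permKV.
Qed.

End OperadListings.

(* Products of permutations in mathcomp are read from left to right, whence
   the order in [op_actM].  Equalities between operations whose arities are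
   equal but not convertible are stated in {n & P n}.  For operations b i of
   arity m i, ['I_(\sum_i m i)] lists the inputs in lexicographic order. *)
Record operad := Operad {
  op_sort :> nat -> Type;
  op_act : forall n, op_sort n -> 'S_n -> op_sort n;
  op_one : op_sort 1;
  op_comp : forall n (m : 'I_n -> nat),
    op_sort n -> (forall i, op_sort (m i)) -> op_sort (\sum_i m i);
  op_act1 : forall n (a : op_sort n), op_act a 1%g = a;
  op_actM : forall n (a : op_sort n) (s t : 'S_n),
    op_act (op_act a s) t = op_act a (t * s)%g;
  op_comp1l : forall n (a : op_sort n),
    Tagged op_sort (op_comp op_one (fun _ : 'I_1 => a)) = Tagged op_sort a;
  op_comp1r : forall n (a : op_sort n),
    Tagged op_sort (op_comp a (fun _ : 'I_n => op_one)) = Tagged op_sort a;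
  op_compA : forall n (m : 'I_n -> nat) (l : 'I_(\sum_i m i) -> nat)
      (a : op_sort n) (b : forall i, op_sort (m i))
      (c : forall k, op_sort (l k)),
    Tagged op_sort (op_comp (op_comp a b) c) =
    Tagged op_sort
      (op_comp a (fun i => op_comp (b i) (fun j => c (tagnat.Rank i j))));
  op_comp_actl : forall n (m : 'I_n -> nat) (a : op_sort n)
      (b : forall i, op_sort (m i)) (s : 'S_n),
    op_comp (op_act a s) (fun i => b (s i)) =
    reorder op_act (block_listingP m s) (op_comp a b);
  op_comp_actr : forall n (m : 'I_n -> nat) (a : op_sort n)
      (b : forall i, op_sort (m i)) (t : forall i, 'S_(m i)),
    op_comp a (fun i => op_act (b i) (t i)) =
    reorder op_act (sum_listingP t) (op_comp a b)
}.

Record unitary_operad := UnitaryOperad {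
  uop :> operad;
  op_zero : uop 0;
  op_zero_uniq : forall a : uop 0, a = op_zero
}.

Definition fibre n m (f : 'I_n -> 'I_m) (y : 'I_m) : {set 'I_n} :=
  [set x | f x == y].

Record smor (P : operad) n m := SMor {
  smor_fun :> 'I_n -> 'I_m;
  smor_op : forall y, P #|fibre smor_fun y|
}.
Arguments SMor {P n m}.

Section Comp.
Variables (n m l : nat) (g : 'I_m -> 'I_l) (f : 'I_n -> 'I_m).

(* the elements of the fibre of g \o f at i, listing first the fibre of f at
   the first element of the fibre of g at i, then at the second one, etc *)
Definition comp_listing (i : 'I_l)
    (k : 'I_(\sum_(j < #|fibre g i|) #|fibre f (enum_val j)|)) : 'I_n :=
  let t := tagnat.sig k in
  enum_val (A := fibre f (enum_val (tag t))) (tagged t).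

Lemma comp_listingP i :
  listings (comp_listing (i := i))
    (fun k : 'I_#|fibre (fun x => g (f x)) i| => enum_val k).
Proof.
apply: listingsI => [k k'||x]; last 1 first.
- apply/codomP/codomP => [[k ->]|[k ->]].
    set z := comp_listing k.
    have zP : z \in fibre (fun x => g (f x)) i.
      have := enum_valP (tagnat.sig2 k); rewrite -/(comp_listing k) -/z inE.
      move=> /eqP fz; rewrite inE fz.
      by have := enum_valP (tagnat.sig1 k); rewrite inE.
    by exists (enum_rank_in zP z); rewrite enum_rankK_in.
  set z := enum_val k.
  have gz : f z \in fibre g i by have := enum_valP k; rewrite !inE.
  have fz : z \in fibre f (enum_val (enum_rank_in gz (f z))).
    by rewrite enum_rankK_in // inE.
  exists (tagnat.rank (existT (fun j => 'I_#|fibre f (enum_val j)|) _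
                         (enum_rank_in fz z))).
  by rewrite /comp_listing tagnat.rankK; exact/esym/enum_rankK_in.
- rewrite /comp_listing => E; apply: tagnat.sig_inj; move: E.
  case: (tagnat.sig k) (tagnat.sig k') => [j a] [j' b] /= E.
  have jj : j = j'.
    have fP (h : 'I_#|fibre g i|) (c : 'I_#|fibre f (enum_val h)|) :
        f (enum_val c) = enum_val h by have := enum_valP c; rewrite inE => /eqP.
    by apply: enum_val_inj; rewrite -(fP _ a) -(fP _ b) E.
  by move: b E; rewrite -jj => b /enum_val_inj ->.
- exact: enum_val_inj.
Qed.

End Comp.

Definition scomp (P : operad) n m l (G : smor P m l) (F : smor P n m) :
    smor P n l :=
  SMor (fun x => G (F x)) (fun i =>
    reorder (@op_act P) (comp_listingP G F i)
      (op_comp (smor_op G i) (fun k => smor_op F (enum_val k)))).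

Lemma fibre_inj n m (f : 'I_n -> 'I_m) : injective f ->
  forall y, #|fibre f y| <= 1.
Proof.
move=> fi y; apply/card_le1_eqP => a b; rewrite !inE => /eqP <- /eqP /fi; exact.
Qed.

Definition one_or_zero (P : unitary_operad) (c : nat) : c <= 1 -> P c :=
  match c with
  | 0 => fun _ => op_zero P
  | 1 => fun _ => op_one P
  | c'.+2 => fun h : c'.+2 <= 1 => False_rect _ (notF h)
  end.

(* An injective map with 1 on its image and 0 elsewhere: the identities, the
   pairs (f, (1, ..., 1)) with f bijective, and the inclusions (i, w^i). *)
Definition smor_inj (P : unitary_operad) n m (f : 'I_n -> 'I_m)
    (fi : injective f) : smor P n m :=
  SMor f (fun y => one_or_zero P (fibre_inj fi y)).

Definition is_surj n m (f : 'I_n -> 'I_m) : bool :=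
  [forall y, y \in codom f].

Lemma is_surj_comp n m l (g : 'I_m -> 'I_l) (f : 'I_n -> 'I_m) :
  is_surj g -> is_surj f -> is_surj (fun x => g (f x)).
Proof.
move=> /forallP gs /forallP fs; apply/forallP => z.
have /codomP[y ->] := gs z; have /codomP[x ->] := fs y.
exact: (codom_f (fun x => g (f x))).
Qed.

Lemma is_surj_perm n (s : 'S_n) : is_surj s.
Proof. by apply/forallP => y; rewrite -(permKV s y) codom_f. Qed.

Lemma is_surj_id n : is_surj (@id 'I_n).
Proof. by apply/forallP => y; apply/codomP; exists y. Qed.

Record surj n m := Surj {
  surj_fun :> 'I_n -> 'I_m;
  surjP : is_surj surj_fun
}.
HB.instance Definition _ n m := [isSub for @surj_fun n m].

Definition surj_comp n m l (g : surj m l) (f : surj n m) : surj n l :=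
  Surj (is_surj_comp (surjP g) (surjP f)).

Definition surj_id n : surj n n := Surj (is_surj_id n).
Definition surj_perm n (s : 'S_n) : surj n n := Surj (is_surj_perm s).

Record omor (P : operad) n m := OMor {
  omor_smor :> smor P n m;
  omorP : is_surj omor_smor
}.

Definition ocomp (P : operad) n m l (G : omor P m l) (F : omor P n m) :
    omor P n l :=
  OMor (omor_smor := scomp G F) (is_surj_comp (omorP G) (omorP F)).

Definition omor_id (P : unitary_operad) n : omor P n n :=
  OMor (omor_smor := smor_inj P (@inj_id 'I_n)) (is_surj_id n).

Definition omor_perm (P : unitary_operad) n (s : 'S_n) : omor P n n :=
  OMor (omor_smor := smor_inj P (@perm_inj _ s)) (is_surj_perm s).

Section Squares.
Variables (P : unitary_operad) (A B C D : nat).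

Definition is_pullback (f : 'I_A -> 'I_B) (g : 'I_C -> 'I_D)
    (phi : 'I_A -> 'I_C) (psi : 'I_B -> 'I_D) : Prop :=
  (forall a, psi (f a) = g (phi a)) /\
  (forall b c, psi b = g c -> exists! a, f a = b /\ phi a = c).

Lemma pullback_listing f g phi psi : is_pullback f g phi psi -> forall c,
  listings (fun k : 'I_#|fibre phi c| => f (enum_val k))
           (fun k : 'I_#|fibre psi (g c)| => enum_val k).
Proof.
move=> [comm pb] c; apply: listingsI => [k k' E||b].
- have := enum_valP k; have := enum_valP k'; rewrite !inE => /eqP p' /eqP p.
  have [|a [_ U]] := pb (f (enum_val k)) c; first by rewrite comm p.
  by apply: enum_val_inj; rewrite -(U (enum_val k)) // -(U (enum_val k')).
- exact: enum_val_inj.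
- apply/codomP/codomP => [[k ->]|[k ->]].
    have := enum_valP k; rewrite inE => /eqP p.
    have bP : f (enum_val k) \in fibre psi (g c) by rewrite inE comm p.
    by exists (enum_rank_in bP (f (enum_val k))); rewrite enum_rankK_in.
  have := enum_valP k; rewrite inE => /eqP p.
  have [a [[<- ac] _]] := pb _ _ p.
  have aP : a \in fibre phi c by rewrite inE ac.
  by exists (enum_rank_in aP a); rewrite enum_rankK_in.
Qed.

(* g_* : w |-> w.h^-1, where f maps the l-th element of the fibre of phi at c
   to the h(l)-th element of the fibre of psi at g c *)
Definition push_op f g phi psi (pb : is_pullback f g phi psi) (c : 'I_C) :
    P #|fibre phi c| -> P #|fibre psi (g c)| :=
  reorder (@op_act P) (pullback_listing pb c).

Definition is_square (f : surj A B) (g : surj C D)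
    (phi : omor P A C) (psi : omor P B D) : Prop :=
  exists pb : is_pullback f g phi psi,
    forall c, push_op pb (smor_op phi c) = smor_op psi (g c).

Definition incl (A' : {set 'I_A}) (k : 'I_#|A'|) : 'I_A := enum_val k.

Definition admissible (f : 'I_A -> 'I_B) (phi : 'I_A -> 'I_C)
    (A' : {set 'I_A}) : bool :=
  is_surj (fun k : 'I_#|A'| => f (incl k)) &&
  is_surj (fun k : 'I_#|A'| => phi (incl k)).

Definition surj_restr (f : surj A B) (phi : omor P A C) (A' : {set 'I_A})
    (adm : admissible f phi A') : surj #|A'| B :=
  Surj (proj1 (andP adm)).

Definition omor_restr (f : surj A B) (phi : omor P A C) (A' : {set 'I_A})
    (adm : admissible f phi A') : omor P #|A'| C :=
  OMor (omor_smor := scomp phi (smor_inj P (@enum_val_inj _ (mem A'))))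
    (proj2 (andP adm)).

End Squares.

Record janus (P : unitary_operad) := Janus {
  jobj :> nat -> zmodType;
  jlow : forall n m, surj n m -> {additive jobj n -> jobj m};
  jup : forall n m, omor P n m -> {additive jobj m -> jobj n};
  jlow_id : forall n x, jlow (surj_id n) x = x;
  jlow_comp : forall n m l (g : surj m l) (f : surj n m) x,
    jlow (surj_comp g f) x = jlow g (jlow f x);
  jup_id : forall n x, jup (omor_id P n) x = x;
  jup_comp : forall n m l (G : omor P m l) (F : omor P n m) x,
    jup (ocomp G F) x = jup F (jup G x)
}.

Definition pseudo_mackey (P : unitary_operad) (M : janus P) : Prop :=
  (forall n (f : 'S_n) (x : M n),
     jlow M (surj_perm f) (jup M (omor_perm P f) x) = x) /\
  (forall A B C D (f : surj A B) (g : surj C D)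
          (phi : omor P A C) (psi : omor P B D),
     is_square f g phi psi ->
     forall x : M C,
       jup M psi (jlow M g x) =
       (\sum_(A' : {A' : {set 'I_A} | admissible f phi A'})
          jlow M (surj_restr (svalP A')) (jup M (omor_restr (svalP A')) x))%R).

Definition natmap_ok a b (f : nat -> nat) : bool :=
  [forall x : 'I_a, 0 < f x.+1 <= b].

Lemma natmap_subproof a b f : natmap_ok a b f ->
  forall x : 'I_a, (f x.+1).-1 < b.
Proof. by move=> /forallP h x; have /andP[/prednK ->] := h x. Qed.

Definition natmap a b f (h : natmap_ok a b f) (x : 'I_a) : 'I_b :=
  Ordinal (natmap_subproof h x).

(* the surjection from {1, ..., a} to {1, ..., b} given by f, if there is one *)
Definition natsurj a b (f : nat -> nat) : option (surj a b) :=
  if @idP (natmap_ok a b f) is ReflectT h then insub (natmap h) else None.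

(* the morphism (f, (w 1, ..., w b)) from {1, ..., a} to {1, ..., b}, if f is
   a surjection whose fibre at y has d y elements *)
Definition natomor (P : operad) a b (f d : nat -> nat)
    (w : forall y, P (d y)) : option (omor P a b) :=
  if natsurj a b f is Some s then
    if @idP [forall y, d (nat_of_ord y).+1 == #|fibre s y|] is ReflectT h then
      Some (OMor (omor_smor := SMor s (fun y =>
        ecast r (P r) (eqP (forallP h y)) (w (nat_of_ord y).+1))) (surjP s))
    else None
  else None.

Definition smap (i k x : nat) : nat :=
  if x <= i then x else if x <= i + k then i else x - k.

Definition tau (i x : nat) : nat :=
  if x == i then i.+1 else if x == i.+1 then i else x.

Definition ops1 (P : operad) (y : nat) : P 1 := op_one P.

Definition dim_at (i p y : nat) : nat := if y == i then p else 1.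
Definition ops_at (P : operad) i p (w : P p) (y : nat) : P (dim_at i p y) :=
  if y == i as b return P (if b then p else 1) then w else op_one P.

Section Generators.
Variables (P : unitary_operad) (M : janus P).

(* M_*(f) : M a -> M b and M^*(f, w) : M b -> M a.  Sizes are explicit
   arguments, so that no transport between the groups M n is needed; the value
   0 is only taken when f (with w) is not a morphism from a to b. *)
Definition lowf a b (f : nat -> nat) (x : M a) : M b :=
  if natsurj a b f is Some s then jlow M s x else 0%R.

Arguments lowf a b f x : clear implicits.

Definition upf a b (f d : nat -> nat) (w : forall y, P (d y)) (x : M b) : M a :=
  if natomor a b f w is Some F then jup M F x else 0%R.

Arguments upf a b f [d] w x.

Definition Iop n (alpha : nat -> P 1) : M n -> M n := upf n n id alpha.

Definition Top n k : M n -> M n := lowf n n (tau k).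

Definition Tup n k : M n -> M n := upf n n (tau k) (ops1 P).

Definition Pop n i : M n -> M n.-1 := lowf n n.-1 (smap i 1).

Arguments Pop n i x : clear implicits.

(* H_i^{(a, b) w}; for a = b this is I_a^{1, ..., 1, w, 1, ..., 1} *)
Definition Hop a b i p (w : P p) : M b -> M a :=
  upf a b (smap i (a - b)) (ops_at i w).

(* P_{v_r}^{b+1} ... P_{v_2}^{a-1} P_{v_1}^a for vs = [:: v_1; ...; v_r] and
   b = a - r *)
Fixpoint Pops (vs : seq nat) a b : M a -> M b :=
  if vs is v :: vs' then fun x => @Pops vs' a.-1 b (Pop a v x)
  else lowf a b id.

End Generators.

Arguments lowf [P] M a b f x.
Arguments upf [P] M a b f [d] w x.
Arguments Iop [P] M n alpha x.
Arguments Top [P] M n k x.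
Arguments Tup [P] M n k x.
Arguments Pop [P] M n i x.
Arguments Hop [P] M a b i [p] w x.
Arguments Pops [P] M vs a b x.

(* sigma, as a permutation of {1, ..., n + 2k} for any n > i *)
Definition shuffle (i k x : nat) : nat :=
  if i <= x <= i + k then i + 2 * (x - i)
  else if i + k + 1 <= x <= i + 2 * k + 1 then i + 2 * (x - (i + k + 1)) + 1
  else x.

(* the two-line notation of the permutation s of {1, ..., N} with the columns
   of top entry in R removed, and reindexed *)
Definition remove_columns (N : nat) (s : nat -> nat) (R : seq nat) (x : nat) :
    nat :=
  let bottom := [seq s t | t <- iota 1 N & t \notin R] in
  count (leq^~ (nth 0 bottom x.-1)) bottom.

Definition op_bool (P : unitary_operad) (b : bool) : P b :=
  if b as b' return P (nat_of_bool b') then op_one P else op_zero P.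

Section Fifth.
Variables (P : unitary_operad) (i k beta : nat).
Variables (u : beta.-tuple 'I_k.+1) (eps : beta.-tuple bool).

(* u_(j+1) = i + tnth u j and eps_(j+1) = tnth eps j *)
Definition uidx (j : 'I_beta) : nat := i + tnth u j.

Definition eps_sum : nat := \sum_(j < beta) tnth eps j.

Definition vlist : seq nat :=
  [seq v <- iota i k.+1 | v \notin [seq uidx j | j : 'I_beta]].

Definition removed : seq nat :=
  [seq uidx j + tnth eps j * k.+1 | j : 'I_beta].

(* gamma(alpha; w_1, ..., w_(k+1)) with w_l = 0 if l = u_j - i + 1 for some j
   with eps_j = e, and w_l = 1 otherwise *)
Definition kept (e : bool) (l : 'I_k.+1) : bool :=
  ~~ [exists j, (l.+1 == uidx j - i + 1) && (tnth eps j == e)].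

Definition gamma_kept (alpha : P k.+1) (e : bool) :
    P (\sum_(l < k.+1) kept e l) :=
  op_comp alpha (fun l => op_bool P (kept e l)).

End Fifth.

(* Main.v *)
Require Import Defs.
From mathcomp Require Import all_boot all_order all_fingroup all_algebra.
From mathcomp Require Import zify.
From Stdlib Require Import FunctionalExtensionality.
From Stdlib Require Eqdep_dec.

(** Each of the five relations expresses the pseudo-Mackey formula on one
    explicit pullback square of generators, except the first, which is the
    axiom on double isomorphisms for adjacent transpositions. That they hold
    in a pseudo-Mackey functor is therefore a matter of computing the
    admissible subsets of these squares; that they suffice is a matter of
    building every square out of them.

    Operations are handled together with a labelling of their inputs by the
    elements of a set, and up to simultaneous renumbering ([lop], [lequiv]).
    These labelled operations form a monad ([lbind]), and the associativity,
    unit and equivariance axioms of an operad are exactly its laws. A morphism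
    of S(P) is a family [lab] of labelled operations indexed by its target
    ([smor_ext]), composition is Kleisli composition ([lab_comp]), and a
    square is the condition that relabelling along the horizontal arrow f
    takes the operation of phi at c to that of psi at g c ([squareP]). All
    bookkeeping of arities is confined to these statements.

    By the axiom on isomorphisms, the contribution of an injection into A to
    the sum over admissible subsets depends only on its image ([adm_term_eq]).
    Hence, given g and psi with common target, the formula holds on all
    squares as soon as it holds on one ([mackey_one]), and it can be studied
    as a property [mackey_at] of the pair (g, psi). If it holds for g1 and
    psi, and for g2 and every restriction of the pulled back arrow, then it
    holds for g1 g2 and psi: sort the admissible subsets of the pasted square
    by their image in the middle ([mackey_hcomp]). Pasting in the vertical
    direction is used only when one of the two squares has a single admissible
    subset ([mackey_vcomp]); the general vertical pasting would ask for the
    formula with a longer g and would not let an induction start.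

    Every surjection is a composite of permutations and of maps that merge the
    points 1 and 2, so by horizontal pasting only these g matter
    ([mackey_all]). For a merging map, psi is peeled one fibre at a time
    ([peel]). A fibre that does not lie over the merged point passes through
    the square with a single admissible subset, which is the third relation,
    or the second one for a fibre with one element. When all these fibres have
    been removed, psi is a permutation followed by a generator (s_1, w), which
    blows up the point 1, and the formula is the fifth relation, or the second
    one.

    In the square of the fifth relation, f identifies k + 1 disjoint pairs of
    points and is injective elsewhere. A subset on which f is onto leaves out
    at most one point of each pair, so it amounts to a function with values in
    [option bool] on the set of pairs ([adm_sum_choices]), and (u, eps) lists
    the pairs in which a point is left out together with the point left out
    ([sum_choices]). The condition defining J says that phi is still onto. For
    such a subset, the composites of generators in the relation are the
    restrictions of f and phi ([summandE]): for phi because inserting 0 in an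
    input of alpha deletes the corresponding label, for f by following the
    position of a point through the shuffle and the successive merging maps. *)

Set Implicit Arguments.
Unset Strict Implicit.
Unset Printing Implicit Defensive.

Import GRing.Theory.

(** * Labelled operations *)

(** The blocks of ['I_(\sum_i m i)] are listed in lexicographic order, so that
    positions can be compared through their block and their index in it. *)
Lemma Rank_lt n (m : 'I_n -> nat) i (j : 'I_(m i)) t (q : 'I_(m t)) :
  (tagnat.Rank i j < tagnat.Rank t q) = (i < t) || (i == t) && (j < q).
Proof.
rewrite -[LHS]/(tagnat.rank (Tagged _ j) < tagnat.rank (Tagged _ q))%O.
rewrite tagnat.lt_rank Order.SigmaOrder.ltEsig /=
  !Order.OrdinalOrder.leEord -val_eqE /=.
case: (ltngtP i t) => //= /val_inj it; rewrite -it in q *.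
by rewrite tagged_asE.
Qed.

(** Two nested decompositions of a sum of arities into blocks number the
    inputs in the same way; this is the part of the associativity of [lbind]
    that concerns labels. *)
Lemma sum_before n (m : 'I_n -> nat) (f : 'I_(\sum_i m i) -> nat) t
    (q : 'I_(m t)) :
  \sum_(u : 'I__ | u < tagnat.Rank t q) f u =
  \sum_(t' : 'I_n | t' < t) \sum_j f (tagnat.Rank t' j) +
  \sum_(j : 'I_(m t) | j < q) f (tagnat.Rank t j).
Proof.
rewrite (reindex_onto (tagnat.rank (p_ := m)) (tagnat.sig (p_ := m)));
  last by move=> k _; rewrite tagnat.sigK.
under eq_bigl => k do rewrite tagnat.rankK eqxx andbT tagnat.rankE Rank_lt.
rewrite (bigID (fun p : {i & 'I_(m i)} => tag p < t)); congr addn.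
  rewrite sig_big_dep /=; apply: eq_big => [[i j]|[i j] _] //=.
  by rewrite andbT andbC; case: ltnP.
transitivity (\sum_(t' | t' == t) \sum_(j : 'I_(m t') | j < q)
                f (tagnat.Rank t' j)); last by rewrite big_pred1_eq.
rewrite sig_big_dep /=; apply: eq_big => [[i j]|[i j] _] //=.
rewrite -(inj_eq val_inj) /=; case: ltngtP; rewrite ?andbF ?andbT //=.
Qed.

Lemma tagged_op_inj (P : nat -> Type) n (a b : P n) :
  Tagged P a = Tagged P b -> a = b.
Proof. exact: (Eqdep_dec.inj_pair2_eq_dec nat (fun x y => eq_comparable x y)).
  Qed.

Section LabelledOperations.
Variable P : operad.

Record lop (T : Type) := Lop { la : nat; ll : 'I_la -> T; lo : P la }.
Arguments la {T} l.
Arguments ll {T} l _.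
Arguments lo {T} l.

(** The relation that identifies an operation and its images under the
    symmetric group, provided that the labels are permuted accordingly. *)
Definition lequiv T (x y : lop T) : Prop :=
  exists (e : la x = la y) (s : 'S_(la y)),
    (forall k, ll x (cast_ord (esym e) (s k)) = ll y k) /\
    lo y = op_act (ecast r (P r) e (lo x)) s.

Local Notation "x ~~ y" := (lequiv x y) (at level 70).

(** Arities of composites are only propositionally equal to the expected
    ones, whence labels compared through the underlying naturals. *)
Lemma lop_eq T p (l : 'I_p -> T) (a : P p) q (l' : 'I_q -> T) (b : P q) :
  Tagged P a = Tagged P b ->
  (forall (i : 'I_p) (j : 'I_q), i = j :> nat -> l i = l' j) ->
    Lop l a = Lop l' b.
Proof.
move=> ab ll'; have pq : p = q := congr1 tag ab.
case: _ / pq in l' b ab ll' *.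
have -> : a = b by exact: tagged_op_inj ab.
by congr Lop; apply: functional_extensionality => i; apply: ll'.
Qed.

Lemma lequiv_refl T (x : lop T) : x ~~ x.
Proof.
exists erefl, 1%g; split=> [k|] /=; last by rewrite op_act1.
by rewrite perm1; congr (ll x); apply: val_inj.
Qed.

Lemma lequiv_act T p (l : 'I_p -> T) (a : P p) (s : 'S_p) :
  Lop l a ~~ Lop (fun k => l (s k)) (op_act a s).
Proof.
by exists erefl, s; split=> //= k; congr l; apply: val_inj.
Qed.

(** With both arities identified, equivalence is the action of a permutation:
    this form can be substituted. *)
Lemma lequivP T (x y : lop T) : x ~~ y <->
  exists s : 'S_(la x), y = Lop (fun k => ll x (s k)) (op_act (lo x) s).
Proof.
split=> [|[s ->]]; last by case: x s => p l a s; apply: lequiv_act.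
case: x y => p l a [q l' b] [/= e]; case: _ / e in l' b * => -[s [ls bs]].
exists s; rewrite bs /=; congr Lop; apply: functional_extensionality => k.
by rewrite -ls; congr l; apply: val_inj.
Qed.

Lemma lequiv_sym T (x y : lop T) : x ~~ y -> y ~~ x.
Proof.
move/lequivP => [s ->]; apply/lequivP; exists s^-1%g => /=.
case: x s => p l a s /=; rewrite op_actM mulVg op_act1; congr Lop.
by apply: functional_extensionality => k; rewrite permKV.
Qed.

Lemma lequiv_trans T (x y z : lop T) : x ~~ y -> y ~~ z -> x ~~ z.
Proof.
move=> /lequivP[s ->] /lequivP[t ->]; apply/lequivP; exists (t * s)%g => /=.
by rewrite op_actM; congr Lop; apply: functional_extensionality => k;
   rewrite permM.
Qed.

Definition lmap T U (h : T -> U) (x : lop T) : lop U :=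
  Lop (fun k => h (ll x k)) (lo x).

Lemma lequiv_map T U (h : T -> U) (x y : lop T) :
  x ~~ y -> lmap h x ~~ lmap h y.
Proof.
by move/lequivP => [s ->]; apply/lequivP; exists s.
Qed.

Lemma lequiv_map_inj T U (h : T -> U) (x y : lop T) :
  injective h -> lmap h x ~~ lmap h y -> x ~~ y.
Proof.
move=> hi [e [s [ls os]]]; exists e, s; split=> // k.
exact: hi (ls k).
Qed.

Lemma lequiv_labels_inj T (x y : lop T) : injective (ll x) -> x ~~ y ->
  injective (ll y).
Proof.
move=> xi /lequivP[s ->] i j /= /xi; exact: perm_inj.
Qed.

Lemma lequiv_codom (T : eqType) (x y : lop T) t : x ~~ y ->
  (t \in codom (ll x)) = (t \in codom (ll y)).
Proof.
case: x => p l a /lequivP[/= s ->] /=.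
apply/codomP/codomP => [[k ->]|[k ->]]; last by exists (s k).
by exists (s^-1%g k); rewrite permKV.
Qed.

(** [reorder] changes the listing of the inputs and nothing else. *)
Lemma reorder_lequiv (T : eqType) U p q (y : 'I_p -> T) (x : 'I_q -> T)
    (yx : listings y x) (w : P p) (h : T -> U) :
  Lop (fun k => h (y k)) w ~~
  Lop (fun k => h (x k)) (reorder (@op_act P) yx w).
Proof.
have hy k : y (cast_ord (esym (listings_size yx)) (listing_perm yx k)) = x k.
  rewrite permE; case/andP: (yx) => yU yxE.
  set m := cast_ord _ _.
  have : nth (x k) (codom y) m = x k
    by rewrite nth_index ?(perm_mem yxE) ?codom_f.
  by rewrite codomE (nth_map m) ?size_enum_ord // nth_ord_enum.
by exists (listings_size yx), (listing_perm yx); split=> //= k; rewrite hy.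
Qed.

Definition lcomp T n (a : P n) (H : 'I_n -> lop T) : lop T :=
  Lop (fun k : 'I_(\sum_i la (H i)) =>
         ll (H (tagnat.sig1 k)) (tagnat.sig2 k))
      (op_comp a (fun i => lo (H i))).

(** Kleisli extension: the operation placed in an input depends only on its
    label, which makes composition compatible with renumbering. *)
Definition lbind T U (x : lop T) (F : T -> lop U) : lop U :=
  lcomp (lo x) (fun i => F (ll x i)).

(** Equivariance of the operad in its inner operations. *)
Lemma lcomp_equivr T n (a : P n) (H H' : 'I_n -> lop T) :
  (forall i, H i ~~ H' i) -> lcomp a H ~~ lcomp a H'.
Proof.
move=> HH'.
have {HH'} /fin_all_exists [s E] i : exists s : 'S_(la (H i)),
   H' i = Lop (fun k => ll (H i) (s k)) (op_act (lo (H i)) s).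
  exact/lequivP.
have {E} -> : H' = fun i => Lop (fun k => ll (H i) (s i k))
  (op_act (lo (H i)) (s i)).
  by apply: functional_extensionality.
rewrite /lcomp /= op_comp_actr.
exact: (reorder_lequiv (sum_listingP s) _
  (fun v : {i : 'I_n & 'I_(la (H i))} => ll (H (tag v)) (tagged v))).
Qed.

(** Equivariance of the operad in its outer operation. *)
Lemma lcomp_equivl T n (a : P n) (s : 'S_n) (H : 'I_n -> lop T) :
  lcomp a H ~~ lcomp (op_act a s) (fun i => H (s i)).
Proof.
rewrite {2}/lcomp (op_comp_actl a (fun i => lo (H i)) s).
exact: (reorder_lequiv (block_listingP (fun i => la (H i)) s) _
  (fun v : {i : 'I_n & 'I_(la (H i))} => ll (H (tag v)) (tagged v))).
Qed.

Lemma lbind_equivl T U (x y : lop T) (F : T -> lop U) :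
  x ~~ y -> lbind x F ~~ lbind y F.
Proof.
move/lequivP => [s ->]; exact: (lcomp_equivl _ s (fun i => F (ll x i))).
Qed.

Lemma lbind_equivr T U (x : lop T) (F G : T -> lop U) :
  (forall i, F (ll x i) ~~ G (ll x i)) -> lbind x F ~~ lbind x G.
Proof. exact: lcomp_equivr. Qed.

Definition lone T (t : T) : lop T := Lop (fun _ : 'I_1 => t) (op_one P).

Lemma sig2_one_block n (k : 'I_(\sum_(i < 1) n)) :
  tagnat.sig2 (p_ := fun _ : 'I_1 => n) k = k :> nat.
Proof.
have := @tagnat.rect 1 (fun=> n) k.
by rewrite [X in X + _]big1 ?add0n => [->|i] //; rewrite (ord1 (tagnat.sig1 k)).
Qed.

Lemma sig1_unit_blocks n (k : 'I_(\sum_(i < n) 1)) :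
  tagnat.sig1 (p_ := fun _ : 'I_n => 1) k = k :> nat.
Proof.
have := @tagnat.rect n (fun=> 1) k.
set t := tagnat.sig1 k; rewrite [X in _ + X](_ : _ = 0); last by rewrite ord1.
move=> ->; rewrite addn0 -(big_ord_widen n (fun=> 1)) ?sum1_card ?card_ord //.
exact/ltnW/ltn_ord.
Qed.

Lemma lbind1 T U (t : T) (F : T -> lop U) : lbind (lone t) F = F t.
Proof.
rewrite /lbind /lcomp /=; case: (F t) => n l a /=.
apply: lop_eq; first exact: op_comp1l.
by move=> i j ij; congr l; apply: val_inj; exact: etrans (sig2_one_block i) ij.
Qed.

Lemma lbind_one T U (x : lop T) (h : T -> U) :
  lbind x (fun t => lone (h t)) = lmap h x.
Proof.
rewrite /lbind /lcomp /=; case: x => n l a /=.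
apply: lop_eq; first exact: op_comp1r.
by move=> i j ij; congr (h (l _)); apply: val_inj; exact:
  etrans (sig1_unit_blocks i) ij.
Qed.

Lemma lcompA T n (a : P n) (m : 'I_n -> nat) (b : forall i, P (m i))
    (H : 'I_(\sum_i m i) -> lop T) :
  lcomp (op_comp a b) H =
  lcomp a (fun i => lcomp (b i) (fun j => H (tagnat.Rank i j))).
Proof.
apply: lop_eq; first exact: op_compA.
move=> i j ij.
set m' := (fun i : 'I_n => \sum_j la (H (tagnat.Rank i j))) in j ij *.
set t := tagnat.sig1 j; set q := tagnat.sig2 j.
change (ll (H (tagnat.sig1 i)) (tagnat.sig2 i) =
  ll (H (tagnat.Rank t (tagnat.sig1 q))) (tagnat.sig2 q)).
suff -> : i = tagnat.Rank (tagnat.Rank t (tagnat.sig1 q)) (tagnat.sig2 q).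
  rewrite /tagnat.sig1 /tagnat.sig2.
  by rewrite /tagnat.Rank !tagnat.rankK.
apply: val_inj; apply: etrans ij _;
  rewrite -[RHS]/(nat_of_ord _) tagnat.RankEsum.
have := @tagnat.rect n m' j; rewrite -/t -/q => ->.
have := @tagnat.rect _ (fun j => la (H (tagnat.Rank t j))) q => ->.
rewrite addnA; congr addn.
exact: esym (sum_before (fun u => la (H u)) (tagnat.sig1 q)).
Qed.

End LabelledOperations.

Arguments la {P T} l.
Arguments ll {P T} l _.
Arguments lo {P T} l.

Local Notation "x ~~ y" := (lequiv x y) (at level 70).

(** * Morphisms as families of labelled operations *)

(** Associativity of the operad, for operations chosen by labels. *)
Lemma lbindA (P : operad) T U V (x : lop P T) (F : T -> lop P U)
    (G : U -> lop P V) :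
  lbind (lbind x F) G = lbind x (fun t => lbind (F t) G).
Proof.
rewrite /lbind [LHS]lcompA; congr lcomp.
apply: functional_extensionality => i; congr lcomp.
apply: functional_extensionality => j /=.
by rewrite /tagnat.sig1 /tagnat.sig2 /tagnat.Rank !tagnat.rankK.
Qed.

Section Labels.
Variable P : operad.

Definition lab n m (F : smor P n m) (y : 'I_m) : lop P 'I_n :=
  Lop (fun k : 'I_#|fibre F y| => enum_val k) (smor_op F y).

Lemma codom_enum_val n (S : {set 'I_n}) t :
  (t \in codom (fun k : 'I_#|S| => enum_val k)) = (t \in S).
Proof.
apply/codomP/idP => [[k ->]|tS]; first exact: enum_valP.
by exists (enum_rank_in tS t); rewrite enum_rankK_in.
Qed.

Lemma codom_lab n m (F : smor P n m) y t :
    (t \in codom (ll (lab F y))) = (F t == y).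
Proof. by rewrite codom_enum_val inE. Qed.

Lemma lab_inj n m (F : smor P n m) y : injective (ll (lab F y)).
Proof. exact: enum_val_inj. Qed.

(** Composition in S(P) is Kleisli composition: the permutations sigma_i only
    restore the natural order of the labels. *)
Lemma lab_comp n m l (G : smor P m l) (F : smor P n m) i :
  lab (scomp G F) i ~~ lbind (lab G i) (lab F).
Proof.
apply: lequiv_sym.
exact: (reorder_lequiv (comp_listingP G F i) (op_comp _ _) id).
Qed.

(** Distinct labels leave no permutation to choose from. *)
Lemma lequiv_op T n (l : 'I_n -> T) (a b : P n) :
  injective l -> Lop l a ~~ Lop l b -> a = b.
Proof.
move=> li [/= e [s [ls ->]]].
rewrite (eq_axiomK e) /= (_ : s = 1%g) ?op_act1 //; apply/permP => k.
rewrite perm1; apply: val_inj.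
by have /(congr1 val) := li _ _ (ls k).
Qed.

(** The map underlying a morphism can be read off the labels. *)
Lemma smor_ext n m (F G : smor P n m) :
  (forall y, lab F y ~~ lab G y) -> F = G.
Proof.
move=> FG; have fg : smor_fun F = G.
  apply: functional_extensionality => t; apply/esym/eqP.
  by rewrite -(codom_lab G) -(lequiv_codom _ (FG _)) codom_lab.
case: F G FG fg => f a [g b] FG /= fg; case: _ / fg in b FG *.
congr SMor; apply: functional_extensionality_dep => y.
exact: (lequiv_op (@enum_val_inj _ _) (FG y)).
Qed.

(** A family of labelled operations defines a morphism when its labels are the
    fibres of a map. *)
Lemma smor_exists n m (f : 'I_n -> 'I_m) (x : 'I_m -> lop P 'I_n) :
  (forall y, injective (ll (x y))) ->
  (forall y t, (t \in codom (ll (x y))) = (f t == y)) ->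
  exists2 F : smor P n m, F =1 f & forall y, lab F y ~~ x y.
Proof.
move=> xi xf.
have xl y : listings (ll (x y)) (fun k : 'I_#|fibre f y| => enum_val k).
  apply: listingsI => // [|t]; first exact: enum_val_inj.
  by rewrite xf codom_enum_val inE.
exists (SMor f (fun y => reorder (@op_act P) (xl y) (lo (x y)))) => // y.
apply: lequiv_sym; have := reorder_lequiv (xl y) (lo (x y)) id.
by rewrite /lab /=; move: (xl y); case: (x y).
Qed.

Lemma scompA n m l p (H : smor P l p) (G : smor P m l) (F : smor P n m) :
  scomp H (scomp G F) = scomp (scomp H G) F.
Proof.
apply: smor_ext => y.
apply: lequiv_trans (lab_comp _ _ _) _.
apply: (lequiv_trans
  (y := lbind (lab H y) (fun t => lbind (lab G t) (lab F)))).
  by apply: lbind_equivr => i; apply: lab_comp.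
rewrite -lbindA; apply: lequiv_sym.
apply: lequiv_trans (lab_comp _ _ _) _.
exact: lbind_equivl (lab_comp _ _ _).
Qed.

End Labels.

Section Unitary.
Variable P : unitary_operad.

(** Inserting [op_zero] in an input deletes its label. *)
Definition lzero T : lop P T :=
  Lop (fun k : 'I_0 => False_rect T (Bool.diff_false_true (ltn_ord k)))
    (op_zero P).

Lemma lop_arity0 T (x : lop P T) : la x = 0 -> x = lzero T.
Proof.
case: x => n l a /= n0; subst n; apply: lop_eq; last by case.
by rewrite (op_zero_uniq a).
Qed.

Lemma lbind_zero T U (F : T -> lop P U) : lbind (lzero T) F = lzero U.
Proof. by apply: lop_arity0; rewrite /= big_ord0. Qed.

Lemma lab_smor_inj n m (f : 'I_n -> 'I_m) (fi : injective f) x :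
  lab (smor_inj P fi) (f x) = lone P x.
Proof.
rewrite /lab /=; apply: lop_eq => [|k j _].
  move: (fibre_inj fi (f x)).
  have : 0 < #|fibre f (f x)| by apply/card_gt0P; exists x; rewrite inE.
  by case: #|_| => [|[]].
by have := enum_valP k; rewrite inE => /eqP /fi.
Qed.

Lemma lab_smor_out n m (f : 'I_n -> 'I_m) (fi : injective f) y :
  (forall x, f x != y) -> lab (smor_inj P fi) y = lzero _.
Proof.
move=> fy; apply: lop_arity0 => /=; apply/eqP; rewrite cards_eq0.
by apply/eqP/setP => x; rewrite !inE (negbTE (fy x)).
Qed.

Variant smor_inj_spec n m (f : 'I_n -> 'I_m) (y : 'I_m) : lop P 'I_n -> Prop :=
| SmorInjIn x : y = f x -> smor_inj_spec f y (lone P x)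
| SmorInjOut : (forall x, f x != y) -> smor_inj_spec f y (lzero _).

(** Precomposing with an injection keeps the labels in its image and deletes
    the others. *)
Lemma smor_injP n m (f : 'I_n -> 'I_m) (fi : injective f) y :
  smor_inj_spec f y (lab (smor_inj P fi) y).
Proof.
have [/codomP[x ->]|yf] := boolP (y \in codom f).
  by rewrite lab_smor_inj; constructor.
by rewrite lab_smor_out; try constructor; move=> x; apply: contraNneq yf => <-;
  apply: codom_f.
Qed.

Lemma smor_inj_comp n m l (g : 'I_m -> 'I_l) (gi : injective g)
    (f : 'I_n -> 'I_m) (fi : injective f) (gfi : injective (fun x => g (f x))) :
  scomp (smor_inj P gi) (smor_inj P fi) = smor_inj P gfi.
Proof.
apply: smor_ext => y; apply: lequiv_trans (lab_comp _ _ _) _.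
case: (smor_injP gi y) => [t ->|yg].
  rewrite lbind1; case: (smor_injP fi t) => [x ->|tf].
    by rewrite (lab_smor_inj gfi); apply: lequiv_refl.
  by rewrite lab_smor_out => [|x]; [apply: lequiv_refl|rewrite (inj_eq gi)].
by rewrite lbind_zero lab_smor_out //; apply: lequiv_refl.
Qed.

Lemma smor_inj_eq n m (f g : 'I_n -> 'I_m) (fi : injective f)
    (gi : injective g) :
  f =1 g -> smor_inj P fi = smor_inj P gi.
Proof.
move=> /functional_extensionality fg; subst g; apply: smor_ext => y.
case: (smor_injP fi y) => [t ->|yf]; first by rewrite lab_smor_inj; apply:
  lequiv_refl.
by rewrite lab_smor_out //; apply: lequiv_refl.
Qed.

Lemma lmap_id T (x : lop P T) : lmap id x = x.
Proof. by case: x. Qed.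

Lemma scomp_id n m (F : smor P n m) (f : 'I_n -> 'I_n) (fi : injective f) :
  f =1 id -> scomp F (smor_inj P fi) = F.
Proof.
move=> fid; apply: smor_ext => y; apply: lequiv_trans (lab_comp _ _ _) _.
rewrite -[X in _ ~~ X]lmap_id -lbind_one; apply: lbind_equivr => i.
by rewrite -{1}(fid (ll _ _)) lab_smor_inj; apply: lequiv_refl.
Qed.

End Unitary.

(** * Squares and sums over admissible subsets *)

Lemma is_surjP n m (f : 'I_n -> 'I_m) :
  reflect (forall y, exists x, f x = y) (is_surj f).
Proof.
apply: (iffP forallP) => [H y|H y]; last by have [x <-] := H y; apply: codom_f.
by have /codomP[x ->] := H y; exists x.
Qed.

Lemma surj_compl n m l (g : 'I_m -> 'I_l) (f : 'I_n -> 'I_m) :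
  is_surj (fun x => g (f x)) -> is_surj g.
Proof.
by move=> /is_surjP H; apply/is_surjP => y; have [x <-] := H y; exists (f x).
Qed.

Lemma eq_surj n m (f f' : 'I_n -> 'I_m) : f =1 f' -> is_surj f = is_surj f'.
Proof. by move/functional_extensionality ->. Qed.

Section SquareTheory.
Variables (P : operad) (A B C D : nat).
Variables (f : 'I_A -> 'I_B) (g : 'I_C -> 'I_D) (phi : smor P A C)
    (psi : smor P B D).

(** Both the pullback condition and the compatibility of the operations, since
    a labelled operation of phi at c lists the whole fibre over c. *)
Definition sq : Prop := forall c, lmap f (lab phi c) ~~ lab psi (g c).

Hypothesis sqr : sq.

Lemma sq_comm a : psi (f a) = g (phi a).
Proof.
apply/eqP; rewrite -codom_lab -(lequiv_codom _ (sqr _)).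
have /codomP[k ak] : a \in codom (ll (lab phi (phi a))) by rewrite codom_lab.
by rewrite {1}ak; apply: (codom_f (fun k => f (ll (lab phi (phi a)) k))).
Qed.

Lemma sq_ex b c : psi b = g c -> exists2 a, f a = b & phi a = c.
Proof.
move=> bc; have : b \in codom (ll (lab psi (g c))) by rewrite codom_lab bc.
rewrite -(lequiv_codom _ (sqr c)) => /codomP[k ->];
  exists (ll (lab phi c) k) => //.
by apply/eqP; rewrite -codom_lab codom_f.
Qed.

Lemma sq_inj a a' : f a = f a' -> phi a = phi a' -> a = a'.
Proof.
move=> fa pa; have fi := lequiv_labels_inj (@lab_inj _ _ _ _ _)
  (lequiv_sym (sqr (phi a))).
have /codomP[k ak] : a \in codom (ll (lab phi (phi a))) by rewrite codom_lab.
have /codomP[k' ak'] : a' \in codom (ll (lab phi (phi a)))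
  by rewrite codom_lab pa.
rewrite ak ak'; congr (ll _ _); apply: fi => /=.
exact: etrans (esym (congr1 f ak)) (etrans fa (congr1 f ak')).
Qed.

Lemma sq_surjf : is_surj g -> is_surj f.
Proof.
move=> /is_surjP gs; apply/is_surjP => b; have [c gc] := gs (psi b).
by have [a] := sq_ex (esym gc); exists a.
Qed.

Lemma sq_surjphi : is_surj psi -> is_surj phi.
Proof.
move=> /is_surjP gs; apply/is_surjP => c; have [b bc] := gs (g c).
by have [a] := sq_ex bc; exists a.
Qed.

End SquareTheory.

Lemma squareP (P : unitary_operad) A B C D (f : surj A B) (g : surj C D)
    (phi : omor P A C) (psi : omor P B D) :
  is_square f g phi psi <-> sq f g phi psi.
Proof.
split=> [[pb E] c|E].
  rewrite /lab -E; exact: (reorder_lequiv (pullback_listing pb c) _ id).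
have pb : is_pullback f g phi psi.
  split=> [a|b c /(sq_ex E)[a fa pa]]; first exact: sq_comm E a.
  by exists a; split=> // a' [fa' pa']; apply: (sq_inj E); rewrite ?fa ?pa.
exists pb => c; apply: (lequiv_op (@enum_val_inj _ _)); apply:
  lequiv_trans (E c).
exact: lequiv_sym (reorder_lequiv (pullback_listing pb c) (smor_op phi c) id).
Qed.

Section Janus.
Variables (P : unitary_operad) (M : janus P).
Local Open Scope ring_scope.

(** Total versions of the two functors, with value 0 on the maps that are not
    surjective; admissible and other subsets can then be summed together. *)
Definition low n m (f : 'I_n -> 'I_m) (x : M n) : M m :=
  if @idP (is_surj f) is ReflectT h then jlow M (Surj h) x else 0.

Definition up n m (F : smor P n m) (x : M m) : M n :=
  if @idP (is_surj F) is ReflectT h then jup M (OMor h) x else 0.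

Lemma lowE n m (f : surj n m) x : jlow M f x = low f x.
Proof.
rewrite /low; case: {-}_ / idP => h; last by case: h; apply: surjP.
by congr (jlow M _ x); case: f h => f p h; congr Surj; apply: bool_irrelevance.
Qed.

Lemma upE n m (F : omor P n m) x : jup M F x = up F x.
Proof.
rewrite /up; case: {-}_ / idP => h; last by case: h; apply: omorP.
by congr (jup M _ x); case: F h => f p h; congr OMor; apply: bool_irrelevance.
Qed.

Lemma low_surj n m (f : 'I_n -> 'I_m) (h : is_surj f) x :
    low f x = jlow M (Surj h) x.
Proof. by rewrite lowE. Qed.

Lemma up_surj n m (F : smor P n m) (h : is_surj F) x :
    up F x = jup M (OMor h) x.
Proof. by rewrite upE. Qed.

Lemma low_nsurj n m (f : 'I_n -> 'I_m) x : ~~ is_surj f -> low f x = 0.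
Proof. by rewrite /low; case: {-}_ / idP => // h /negP. Qed.

Lemma up_nsurj n m (F : smor P n m) x : ~~ is_surj F -> up F x = 0.
Proof. by rewrite /up; case: {-}_ / idP => // h /negP. Qed.

Lemma low0 n m (f : 'I_n -> 'I_m) : low f 0 = 0.
Proof. by rewrite /low; case: {-}_ / idP => // h; rewrite raddf0. Qed.

Lemma up0 n m (F : smor P n m) : up F 0 = 0.
Proof. by rewrite /up; case: {-}_ / idP => // h; rewrite raddf0. Qed.

Lemma low_sum n m (f : 'I_n -> 'I_m) I (r : seq I) (Q : pred I) E :
  low f (\sum_(i <- r | Q i) E i) = \sum_(i <- r | Q i) low f (E i).
Proof.
rewrite /low; case: {-}_ / idP => h; first by rewrite raddf_sum.
by rewrite big1.
Qed.

Lemma up_sum n m (F : smor P n m) I (r : seq I) (Q : pred I) E :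
  up F (\sum_(i <- r | Q i) E i) = \sum_(i <- r | Q i) up F (E i).
Proof.
rewrite /up; case: {-}_ / idP => h; first by rewrite raddf_sum.
by rewrite big1.
Qed.

Lemma eq_low n m (f f' : 'I_n -> 'I_m) : f =1 f' -> low f =1 low f'.
Proof. by move/functional_extensionality ->. Qed.

Lemma low_comp n m l (g : 'I_m -> 'I_l) (f : 'I_n -> 'I_m) x : is_surj f ->
  low (fun t => g (f t)) x = low g (low f x).
Proof.
move=> sf; have [sg|sg] := boolP (is_surj g); last first.
  rewrite !low_nsurj //; apply: contra sg; exact: surj_compl.
by rewrite (low_surj (is_surj_comp sg sf)) !low_surj -jlow_comp.
Qed.

Lemma up_comp n m l (G : smor P m l) (F : smor P n m) x : is_surj F ->
  up (scomp G F) x = up F (up G x).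
Proof.
move=> sf; have [sg|sg] := boolP (is_surj G); last first.
  rewrite (up_nsurj _ sg) up0 up_nsurj //; apply: contra sg; exact: surj_compl.
rewrite (up_surj (F := scomp G F) (is_surj_comp sg sf)) !up_surj -jup_comp.
by congr (jup M _ x).
Qed.

Lemma low_id n (f : 'I_n -> 'I_n) x : f =1 id -> low f x = x.
Proof.
move=> fid; rewrite (eq_low fid) (low_surj (is_surj_id n)); exact: jlow_id.
Qed.

Lemma up_id n (f : 'I_n -> 'I_n) (fi : injective f) x : f =1 id ->
    up (smor_inj P fi) x = x.
Proof.
move=> fid; rewrite (smor_inj_eq P fi (@inj_id _) fid).
rewrite (up_surj (F := smor_inj P (@inj_id _)) (is_surj_id n)); exact: jup_id.
Qed.

(** The contribution of a subset presented by an injection [iota] that need not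
    be increasing; it vanishes unless the subset is admissible. *)
Definition adm_term A B C r (f : 'I_A -> 'I_B) (phi : smor P A C)
    (iota : 'I_r -> 'I_A) (i : injective iota) (x : M C) : M B :=
  low (fun k => f (iota k)) (up (scomp phi (smor_inj P i)) x).

Definition adm_sum A B C (f : 'I_A -> 'I_B) (phi : smor P A C) (x : M C) :
    M B :=
  \sum_(A' : {set 'I_A}) adm_term f phi (@enum_val_inj _ (mem A')) x.

Lemma adm_sumE A B C (f : surj A B) (phi : omor P A C) x :
  \sum_(A' : {A' : {set 'I_A} | admissible f phi A'})
     jlow M (surj_restr (svalP A')) (jup M (omor_restr (svalP A')) x) =
  adm_sum f phi x.
Proof.
rewrite /adm_sum [RHS](bigID (admissible f phi)) /=
  [X in _ = _ + X]big1 ?addr0 => [|A' adm]; last first.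
  rewrite /adm_term; case/nandP: adm => H; first by rewrite low_nsurj.
  by rewrite up_nsurj ?low0.
rewrite (reindex_omap (fun u : {A' | admissible f phi A'} => sval u) insub) /=;
  last first.
  by move=> A' adm; rewrite insubT.
apply: eq_big => [[A' adm]|[A' adm] _] /=; first by rewrite adm insubT /= eqxx.
by rewrite lowE upE.
Qed.

Definition mackey_at C D B (g : 'I_C -> 'I_D) (psi : smor P B D) : Prop :=
  forall A (f : 'I_A -> 'I_B) (phi : smor P A C), sq f g phi psi ->
  forall x, up psi (low g x) = adm_sum f phi x.

Definition iso_law : Prop := forall n (s : 'S_n) x,
   low s (up (smor_inj P (@perm_inj _ s)) x) = x.

(** The two axioms in terms of total functors, the second as a property of the
    cospan (g, psi). *)
Lemma pseudo_mackeyP : pseudo_mackey M <->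
  iso_law /\ forall B C D (g : 'I_C -> 'I_D) (psi : smor P B D),
                is_surj g -> is_surj psi -> mackey_at g psi.
Proof.
split=> [[H1 H2]|[H1 H2]]; split=> //.
- by move=> n s x; have := H1 n s x; rewrite lowE upE.
- move=> B C D g psi gs psis A f phi sqr x.
  have fs := sq_surjf sqr gs; have phis := sq_surjphi sqr psis.
  have := H2 _ _ _ _ (Surj fs) (Surj gs) (OMor phis) (OMor psis).
  by rewrite squareP => /(_ sqr x); rewrite adm_sumE lowE upE.
- by move=> n s x; rewrite lowE upE; apply: H1.
- move=> A B C D f g phi psi /squareP sqr x.
  by rewrite adm_sumE lowE upE; apply: H2 => //; [apply: surjP|apply: omorP].
Qed.

End Janus.

(** * Restricting and pasting squares *)

Section SquareConstructions.
Variable P : unitary_operad.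

Lemma lab_comp_inj n m r (F : smor P n m) (t : 'I_r -> 'I_n)
    (ti : injective t) c :
  lmap t (lab (scomp F (smor_inj P ti)) c) ~~
  lbind (lab F c) (fun a => lmap t (lab (smor_inj P ti) a)).
Proof.
exact: (lequiv_map t (lab_comp F (smor_inj P ti) c)).
Qed.

Lemma lab_comp_bij n m r (F : smor P n m) (t : 'I_r -> 'I_n)
    (ti : injective t) c :
  is_surj t -> lmap t (lab (scomp F (smor_inj P ti)) c) ~~ lab F c.
Proof.
move=> /is_surjP ts; apply: lequiv_trans (lab_comp_inj _ _ _) _.
rewrite -[X in _ ~~ X]lmap_id -lbind_one; apply: lbind_equivr => i.
have [a <-] := ts (ll (lab F c) i).
by rewrite lab_smor_inj; apply: lequiv_refl.
Qed.

(** The pullback, its points being enumerated as pairs (b, c). *)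
Lemma sq_exists B C D (g : 'I_C -> 'I_D) (psi : smor P B D) :
  exists A (f : 'I_A -> 'I_B) (phi : smor P A C), sq f g phi psi.
Proof.
pose S := [set p : 'I_B * 'I_C | psi p.1 == g p.2].
have memS c (k : 'I_(la (lab psi (g c)))) : (ll (lab psi (g c)) k, c) \in S.
  by rewrite inE /= -codom_lab codom_f.
pose x c : lop P 'I_#|S| :=
  Lop (fun k => enum_rank_in (memS c k) (ll (lab psi (g c)) k, c))
    (lo (lab psi (g c))).
pose phi (a : 'I_#|S|) := (enum_val a).2.
have xE c k : enum_val (ll (x c) k) = (ll (lab psi (g c)) k, c).
  by rewrite /x /= enum_rankK_in //; apply: (memS c k).
have [c k l E|c a|F Fphi Fx] := @smor_exists P _ _ phi x.
- have := congr1 (fun a => (enum_val a).1) E; rewrite !xE /=.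
  exact: lab_inj.
- apply/codomP/eqP => [[k ->]|<-]; first by rewrite /phi xE.
  have := enum_valP a; rewrite inE -codom_lab => /codomP[k ak].
  exists k; apply: enum_val_inj; rewrite xE /phi.
  by rewrite -ak; case: (enum_val a).
exists #|S|, (fun a => (enum_val a).1), F => c.
apply: lequiv_trans (lequiv_map _ (Fx c)) _.
rewrite (_ : lmap _ _ = lab psi (g c)); first exact: lequiv_refl.
by congr Lop; apply: functional_extensionality => k; rewrite xE.
Qed.

(** A pullback is unique up to a bijection, which also carries the operations
    because [(f, phi)] is injective on labels. *)
Lemma sq_unique A A' B C D (g : 'I_C -> 'I_D) (psi : smor P B D)
    (f : 'I_A -> 'I_B) (phi : smor P A C)
    (f' : 'I_A' -> 'I_B) (phi' : smor P A' C) :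
  sq f g phi psi -> sq f' g phi' psi ->
  exists (t : 'I_A' -> 'I_A) (ti : injective t),
    [/\ is_surj t, f' =1 (fun a => f (t a)) & phi' = scomp phi (smor_inj P ti)].
Proof.
move=> sqr sqr'.
have /fin_all_exists[t tE] a' : exists a, f a = f' a' /\ phi a = phi' a'.
  by have [a fa pa] := sq_ex sqr (sq_comm sqr' a'); exists a.
have ti : injective t.
  move=> a1 a2 E; apply: (sq_inj sqr').
    by rewrite -(tE a1).1 E (tE a2).1.
  by rewrite -(tE a1).2 E (tE a2).2.
have ts : is_surj t.
  apply/is_surjP => a.
  have [a' fa pa] := sq_ex sqr' (sq_comm sqr a); exists a'.
  by apply: (sq_inj sqr); rewrite ?(tE a').1 ?(tE a').2.
exists t, ti; split=> // [a'|]; first by rewrite (tE a').1.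
apply: smor_ext => c; apply: (lequiv_map_inj ti).
apply: lequiv_trans (lequiv_sym (lab_comp_bij phi ti c ts)).
(* f need not be injective, but labels of the fibres of phi can be compared
   along the pair (f, phi), which is *)
pose h a := (f a, phi a).
have hi : injective h by move=> a1 a2 [E1 E2]; apply: (sq_inj sqr).
apply: (lequiv_map_inj hi).
have Ephi : lmap h (lab phi c) = lmap (fun b => (b, c)) (lmap f (lab phi c)).
  congr Lop; apply: functional_extensionality => k; rewrite /h; congr pair.
  by apply/eqP; rewrite -codom_lab codom_f.
have Ephi' : lmap h (lmap t (lab phi' c)) = lmap (fun b => (b, c))
  (lmap f' (lab phi' c)).
  congr Lop; apply: functional_extensionality => k /=; rewrite /h.
  congr pair; first by rewrite (tE _).1.
  by rewrite (tE _).2; apply/eqP; rewrite -codom_lab; apply: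
    (codom_f (ll (lab phi' c))).
rewrite Ephi Ephi'; apply: lequiv_map.
exact: lequiv_trans (sqr' c) (lequiv_sym (sqr c)).
Qed.

Lemma sq_hcomp A A1 B C C1 D (f1 : 'I_A1 -> 'I_B) (g1 : 'I_C1 -> 'I_D)
   (phi1 : smor P A1 C1) (psi : smor P B D) (f2 : 'I_A -> 'I_A1)
   (g2 : 'I_C -> 'I_C1) (phi2 : smor P A C) :
  sq f1 g1 phi1 psi -> sq f2 g2 phi2 phi1 ->
  sq (fun a => f1 (f2 a)) (fun c => g1 (g2 c)) phi2 psi.
Proof.
by move=> s1 s2 c; apply: lequiv_trans (lequiv_map f1 (s2 c)) (s1 _).
Qed.

Lemma sq_vcomp A A1 B B1 C D (f : 'I_A -> 'I_B) (f1 : 'I_A1 -> 'I_B1)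
   (g : 'I_C -> 'I_D) (phi1 : smor P A1 C) (psi1 : smor P B1 D)
   (phi2 : smor P A A1) (psi2 : smor P B B1) :
  sq f1 g phi1 psi1 -> sq f f1 phi2 psi2 ->
  sq f g (scomp phi1 phi2) (scomp psi1 psi2).
Proof.
move=> s1 s2 c; apply: lequiv_trans (lequiv_map f (lab_comp phi1 phi2 c)) _.
apply: (fun H => lequiv_trans H (lequiv_sym (lab_comp psi1 psi2 (g c)))).
apply: (fun H => lequiv_trans H (lbind_equivl _ (s1 c))).
rewrite -[X in X ~~ _]/(lbind (lab phi1 c) (fun a => lmap f (lab phi2 a))).
rewrite -[X in _ ~~ X]/(lbind (lab phi1 c) (fun a => lab psi2 (f1 a))).
by apply: lbind_equivr => i; apply: s2.
Qed.

(** Restricting the middle arrow phi1 of two pasted squares to a subset, and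
    the upper left corner to its preimage, gives a square again: a point is
    deleted exactly when its image is. *)
Lemma sq_restr A A1 C C1 (f2 : 'I_A -> 'I_A1) (g2 : 'I_C -> 'I_C1)
    (phi2 : smor P A C) (phi1 : smor P A1 C1)
    r1 (i1 : 'I_r1 -> 'I_A1) (i1i : injective i1)
    r (t : 'I_r -> 'I_A) (ti : injective t) (f2' : 'I_r -> 'I_r1) :
  sq f2 g2 phi2 phi1 -> (forall a, i1 (f2' a) = f2 (t a)) ->
  (forall a x, f2 a = i1 x -> exists a', a = t a') ->
  sq f2' g2 (scomp phi2 (smor_inj P ti)) (scomp phi1 (smor_inj P i1i)).
Proof.
move=> s2 E pre c.
apply: lequiv_trans (lequiv_map f2' (lab_comp _ _ c)) _.
apply: (fun H => lequiv_trans H (lequiv_sym (lab_comp _ _ (g2 c)))).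
apply: (fun H => lequiv_trans H (lbind_equivl _ (s2 c))).
rewrite -[X in X ~~ _]/(lbind (lab phi2 c)
  (fun a => lmap f2' (lab (smor_inj P ti) a))).
rewrite -[X in _ ~~ X]/(lbind (lab phi2 c)
  (fun a => lab (smor_inj P i1i) (f2 a))).
apply: lbind_equivr => k.
move: (ll _ k) => a; case: (smor_injP P ti a) => [a' ->|at'].
  by rewrite -E lab_smor_inj; apply: lequiv_refl.
rewrite lab_smor_out => [|x]; first by rewrite [lmap _ _]lop_arity0 //; apply:
  lequiv_refl.
by apply/eqP => /esym/pre[a' aa]; move: (at' a'); rewrite aa eqxx.
Qed.

End SquareConstructions.

Section Mackey.
Variables (P : unitary_operad) (M : janus P).
Hypothesis iso : iso_law M.
Local Open Scope ring_scope.

(** Both sides of the axiom on isomorphisms are bijections, so the inverse is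
    two-sided. *)
Lemma up_low_perm n (s : 'S_n) (x : M n) :
  up (smor_inj P (@perm_inj _ s)) (low s x) = x.
Proof.
pose y := up (smor_inj P (@perm_inj _ s^-1%g)) x.
have xy : x = up (smor_inj P (@perm_inj _ s)) y.
  have si : injective (fun k => s^-1%g (s k)) by move=> i j /perm_inj/perm_inj.
  rewrite -up_comp; last exact: is_surj_perm.
  by rewrite (smor_inj_comp _ _ _ si) up_id // => k; rewrite permK.
by rewrite {1}xy iso.
Qed.

(** Two presentations of a subset differ by a permutation s, and the two
    factors s_* and s^* that it contributes cancel. *)
Lemma adm_term_eq A B C r r' (f : 'I_A -> 'I_B) (phi : smor P A C)
    (i : 'I_r -> 'I_A) (ii : injective i) (i' : 'I_r' -> 'I_A)
      (ii' : injective i') x :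
  (forall a, (a \in codom i) = (a \in codom i')) ->
  adm_term f phi ii x = adm_term (M := M) f phi ii' x.
Proof.
move=> E; have rr : r = r'.
  by have := eq_card E; rewrite !card_codom // !card_ord.
subst r'.
have /fin_all_exists[t tE] k : exists l, i' l = i k.
  by have := codom_f i k; rewrite E => /codomP[l ->]; exists l.
have ti : injective t by move=> k l kl; apply: ii; rewrite -!tE kl.
pose s := perm ti; have sE k : i k = i' (s k) by rewrite permE tE.
rewrite /adm_term (eq_low (M := M) (f' := fun k => f (i' (s k)))); last
  by move=> k; rewrite sE.
have i's : injective (fun k => i' (s k)) by move=> k l; rewrite -!sE; apply: ii.
rewrite (smor_inj_eq P ii i's sE) -(smor_inj_comp P ii' (@perm_inj _ s) i's)
  scompA.
rewrite (low_comp (fun k => f (i' k)) _ (is_surj_perm s)).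
by rewrite (up_comp (F := smor_inj P (@perm_inj _ s)) _ _ (is_surj_perm s)) iso.
Qed.

Lemma adm_term_comp A B C r q (f : 'I_A -> 'I_B) (phi : smor P A C)
    (h : 'I_r -> 'I_A) (hi : injective h) (i : 'I_q -> 'I_r) (ii : injective i)
    (hii : injective (fun k => h (i k))) x :
  adm_term (fun k => f (h k)) (scomp phi (smor_inj P hi)) ii x =
  adm_term (M := M) f phi hii x.
Proof. by rewrite /adm_term -scompA (smor_inj_comp P hi ii hii). Qed.

Lemma adm_term_id A B C (f : 'I_A -> 'I_B) (phi : smor P A C) r
    (i : 'I_r -> 'I_A)
    (ii : injective i) x : is_surj i ->
  adm_term f phi ii x = low (M := M) f (up phi x).
Proof.
move=> /is_surjP si; rewrite (adm_term_eq f phi ii (@inj_id 'I_A)) => [|a].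
  by rewrite /adm_term scomp_id.
by have [k <-] := si a; rewrite codom_f; apply/esym/codomP; exists (i k).
Qed.

Lemma adm_sum_restr A B C r (f : 'I_A -> 'I_B) (phi : smor P A C)
    (h : 'I_r -> 'I_A) (hi : injective h) x :
  adm_sum (fun k => f (h k)) (scomp phi (smor_inj P hi)) x =
  \sum_(S : {set 'I_A} | S \subset codom h)
     adm_term (M := M) f phi (@enum_val_inj _ (mem S)) x.
Proof.
rewrite [RHS](reindex_onto (fun S : {set 'I_r} => h @: S) (fun S => h @^-1: S))
  /=.
  apply: eq_big => [S|S _].
    apply/esym/andP; split.
      by apply/subsetP => a /imsetP[k _ ->]; apply: codom_f.
    by apply/eqP/setP => k; rewrite inE mem_imset.
  have hii : injective (fun k : 'I_#|S| => h (enum_val k))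
    by move=> k l /hi/enum_val_inj.
  rewrite (adm_term_comp _ _ _ _ hii); apply: adm_term_eq => a.
  rewrite codom_enum_val; apply/codomP/imsetP => [[k ->]|[k kS ->]].
    by exists (enum_val k) => //; apply: enum_valP.
  by exists (enum_rank_in kS k); rewrite enum_rankK_in.
move=> S /subsetP Sh; apply/setP => a; apply/imsetP/idP => [[k]|aS].
  by rewrite inE => kS ->.
by have /codomP[k ak] := Sh _ aS; exists k => //; rewrite inE -ak.
Qed.

(** With the whole of A as only admissible subset, the formula is a plain
    commutation rule. *)
Lemma adm_sum_single A B C (f : 'I_A -> 'I_B) (phi : smor P A C) x :
  (forall S : {set 'I_A}, [set f a | a in S] = setT ->
    [set phi a | a in S] = setT -> S = setT) ->
  adm_sum f phi x = low (M := M) f (up phi x).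
Proof.
move=> single; rewrite /adm_sum (bigD1 setT) //= adm_term_id; last first.
  by apply/is_surjP => a; exists (enum_rank_in (in_setT a) a);
    rewrite enum_rankK_in.
rewrite big1 ?addr0 // => S /eqP ST; rewrite /adm_term.
have imS m (h : 'I_A -> 'I_m) : is_surj (fun k : 'I_#|S| => h (enum_val k)) ->
    [set h a | a in S] = setT.
  move=> /is_surjP hs; apply/setP => y; have [k <-] := hs y; rewrite inE.
  by apply: imset_f; apply: enum_valP.
have [fs|fs] := boolP (is_surj (fun k : 'I_#|S| => f (enum_val k))); last
  by rewrite low_nsurj.
have [ps|ps] := boolP (is_surj (fun k : 'I_#|S| => phi (enum_val k))).
  by case: ST; apply: single; apply: imS.
by rewrite up_nsurj ?low0.
Qed.

(** Squares over a given cospan are isomorphic and the sum is invariant. *)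
Lemma mackey_one A B C D (g : 'I_C -> 'I_D) (psi : smor P B D)
    (f : 'I_A -> 'I_B) (phi : smor P A C) : sq f g phi psi ->
  (forall x : M C, up psi (low g x) = adm_sum f phi x) -> mackey_at M g psi.
Proof.
move=> sqr H A' f' phi' sqr' x; rewrite H.
have [t [ti [/is_surjP ts ft ->]]] := sq_unique sqr sqr'.
have -> : f' = fun a => f (t a) by apply: functional_extensionality.
rewrite adm_sum_restr; apply/eq_bigl => S; apply/esym/subsetP => a _.
by have [k <-] := ts a; apply: codom_f.
Qed.

Lemma low_perm n (s : 'S_n) (x : M n) :
  low s x = up (smor_inj P (@perm_inj _ s^-1%g)) x.
Proof.
rewrite -[RHS](iso s) -up_comp; last exact: is_surj_perm.
have si : injective (fun k => s^-1%g (s k)) by move=> i j /perm_inj/perm_inj.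
by rewrite (smor_inj_comp _ _ _ si) up_id // => k; rewrite permK.
Qed.

(** s_* is the inverse of s^*, so this is functoriality of M^*. *)
Lemma mackey_perm_low B D (s : 'S_D) (psi : smor P B D) :
  is_surj psi -> mackey_at M s psi.
Proof.
move=> psis; pose phi := scomp (smor_inj P (@perm_inj _ s^-1%g)) psi.
apply: (@mackey_one _ _ _ _ _ _ id phi) => [c|x].
  rewrite lmap_id; apply: lequiv_trans (lab_comp _ _ _) _.
  by rewrite -{1}(permK s c) lab_smor_inj lbind1; apply: lequiv_refl.
rewrite adm_sum_single => [|S]; last by rewrite imset_id.
by rewrite [RHS]low_id // /phi up_comp // low_perm.
Qed.

(** Precomposing psi with a permutation only changes the identification of
    the corner B, that is, composes f with a permutation. *)
Lemma mackey_perm_up B C D (g : 'I_C -> 'I_D) (psi : smor P B D) (s : 'S_B) :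
  mackey_at M g psi -> mackey_at M g (scomp psi (smor_inj P (@perm_inj _ s))).
Proof.
move=> H A f phi sqr x.
rewrite up_comp; last exact: is_surj_perm.
rewrite (H _ (fun a => s (f a)) phi) => [|c].
  rewrite /adm_sum up_sum; apply: eq_bigr => S _; rewrite /adm_term.
  set y := up _ x.
  have [fs|fs] := boolP (is_surj (fun k : 'I_#|S| => f (enum_val k))).
    by rewrite (low_comp _ _ fs) up_low_perm.
  rewrite low_nsurj ?up0 ?low_nsurj //; apply: contra fs => /is_surjP sfs.
  by apply/is_surjP => b; have [a /perm_inj <-] := sfs (s b); exists a.
apply: lequiv_trans (lequiv_map s (sqr c)) _.
exact: lab_comp_bij (is_surj_perm s).
Qed.

(** A subset of A that is admissible for the pasted square has an image in A1
    that is admissible for the first one; the subsets with image S1 are those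
    that are admissible for the square restricted to S1. *)
Lemma mackey_hcomp B C C1 D (g1 : 'I_C1 -> 'I_D) (g2 : 'I_C -> 'I_C1)
    (psi : smor P B D) :
  is_surj g2 -> mackey_at M g1 psi ->
  (forall A (phi : smor P A C1), is_surj phi -> mackey_at M g2 phi) ->
  mackey_at M (fun c => g1 (g2 c)) psi.
Proof.
move=> g2s H1 H2.
have [A1 [f1 [phi1 s1]]] := sq_exists g1 psi.
have [A [f2 [phi2 s2]]] := sq_exists g2 phi1.
apply: (mackey_one (sq_hcomp s1 s2)) => x.
rewrite low_comp // (H1 _ _ _ s1) /adm_sum.
rewrite [RHS](partition_big (fun S : {set 'I_A} => f2 @: S) xpredT) //=.
apply: eq_bigr => S1 _; rewrite {1}/adm_term.
(* S0 indexes the upper left corner of the square restricted to S1 *)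
pose S0 := f2 @^-1: S1; pose t (k : 'I_#|S0|) := enum_val k.
have ti : injective t by exact: enum_val_inj.
have tS k : f2 (t k) \in S1 by have := enum_valP k; rewrite inE.
pose f2' k := enum_rank_in (tS k) (f2 (t k)).
have f2'E k : enum_val (f2' k) = f2 (t k) by rewrite enum_rankK_in.
have sqr : sq f2' g2 (scomp phi2 (smor_inj P ti))
            (scomp phi1 (smor_inj P (@enum_val_inj _ (mem S1)))).
  apply: (sq_restr _ _ s2) => // a y E.
  have aS : a \in S0 by rewrite inE E; apply: enum_valP.
  by exists (enum_rank_in aS a); rewrite /t enum_rankK_in.
have imS (S : {set 'I_A}) : f2 @: S = S1 ->
    forall y, exists k : 'I_#|S|, f2 (enum_val k) = enum_val (y : 'I_#|S1|).
  move=> fS y; have : enum_val y \in f2 @: S by rewrite fS; apply: enum_valP.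
  by case/imsetP=> a aS ->; exists (enum_rank_in aS a); rewrite enum_rankK_in.
have imS' (S : {set 'I_A}) : f2 @: S = S1 ->
    forall k : 'I_#|S|, exists y : 'I_#|S1|, f2 (enum_val k) = enum_val y.
  move=> fS k; have kS : f2 (enum_val k) \in S1.
    by rewrite -fS; apply: imset_f; apply: enum_valP.
  by exists (enum_rank_in kS (f2 (enum_val k))); rewrite enum_rankK_in.
have [fs|fs] := boolP (is_surj (fun k : 'I_#|S1| => f1 (enum_val k)));
  last first.
  rewrite low_nsurj // big1 // => S /eqP fS; rewrite /adm_term low_nsurj //.
  apply: contra fs => /is_surjP H; apply/is_surjP => b; have [k <-] := H b.
  by have [y ->] := imS' S fS k; exists y.
have [ps|ps] := boolP (is_surj (fun k : 'I_#|S1| => phi1 (enum_val k)));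
  last first.
  rewrite [up _ _]up_nsurj // low0 big1 // => S /eqP fS.
  rewrite /adm_term [up _ _]up_nsurj ?low0 //.
  apply: contra ps => /is_surjP H; apply/is_surjP => c1.
  have [c <-] := is_surjP _ g2s c1; have [k <-] := H c.
  by have [y yE] := imS' S fS k; exists y; rewrite -yE (sq_comm s2).
rewrite (H2 _ _ _ _ _ _ sqr) ?low_sum //.
rewrite [RHS](reindex_onto (fun S : {set 'I_#|S0|} => t @: S)
  (fun S => t @^-1: S)) /=;
    last first.
  move=> S /eqP fS; apply/setP => a; apply/imsetP/idP => [[k]|aS].
    by rewrite inE => kS ->.
  have aS0 : a \in S0 by rewrite inE -fS imset_f.
  by exists (enum_rank_in aS0 a); rewrite ?inE /t enum_rankK_in.
rewrite [RHS]big_mkcond /=; apply: eq_bigr => S _.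
have -> : (t @^-1: (t @: S) == S) = true.
  by apply/eqP/setP => k; rewrite inE mem_imset.
rewrite andbT /adm_term; set y := up _ x.
have tii : injective (fun k : 'I_#|S| => t (enum_val k))
  by move=> k l /ti/enum_val_inj.
have [f's|f's] := boolP (is_surj (fun k : 'I_#|S| => f2' (enum_val k))).
  have -> : f2 @: (t @: S) == S1.
    apply/eqP/setP => a1; apply/imsetP/idP => [[_ /imsetP[k _ ->] ->] //|a1S].
    have [k kE] := is_surjP _ f's (enum_rank_in a1S a1).
    exists (t (enum_val k)); first by apply: imset_f; apply: enum_valP.
    by rewrite -f2'E kE enum_rankK_in.
  rewrite -low_comp //.
  rewrite (eq_low (f' := fun k : 'I_#|S| => f1 (f2 (t (enum_val k)))));
    last first.
    by move=> k; rewrite f2'E.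
  have := adm_term_comp (fun a => f1 (f2 a)) phi2 ti
    (@enum_val_inj _ (mem S)) tii x.
  rewrite {1}/adm_term => ->; apply: adm_term_eq => a.
  rewrite codom_enum_val; apply/codomP/imsetP => [[k ->]|[k kS ->]].
    by exists (enum_val k) => //; apply: enum_valP.
  by exists (enum_rank_in kS k); rewrite enum_rankK_in.
rewrite [low _ y]low_nsurj // low0; case: eqP => // fS.
case/negP: f's; apply/is_surjP => z.
have [k kE] := imS _ fS z.
have /imsetP[l lS lE] := enum_valP k.
exists (enum_rank_in lS l); rewrite enum_rankK_in //; apply: enum_val_inj.
by rewrite f2'E -kE lE.
Qed.

(** A subset of A that is admissible for the pasted square has an image in A1
    that is admissible for the first square, hence is everything; so it is
    admissible for the second square. *)
Lemma mackey_vcomp A1 B B1 C D (f1 : 'I_A1 -> 'I_B1) (g : 'I_C -> 'I_D)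
    (phi1 : smor P A1 C) (psi1 : smor P B1 D) (psi2 : smor P B B1) :
  is_surj psi2 -> sq f1 g phi1 psi1 ->
  (forall S : {set 'I_A1}, f1 @: S = setT -> phi1 @: S = setT -> S = setT) ->
  (forall x : M C, up psi1 (low g x) = low f1 (up phi1 x)) ->
  mackey_at M f1 psi2 -> mackey_at M g (scomp psi1 psi2).
Proof.
move=> psi2s s1 single H1 H2.
have [A [f [phi2 s2]]] := sq_exists f1 psi2.
apply: (mackey_one (sq_vcomp s1 s2)) => x.
rewrite up_comp // H1 (H2 _ _ _ s2) /adm_sum; apply: eq_bigr => S _;
  rewrite /adm_term.
have [fs|fs] := boolP (is_surj (fun k : 'I_#|S| => f (enum_val k))); last
  by rewrite !low_nsurj.
rewrite -scompA.
have [ps|ps] := boolP (is_surj (fun k : 'I_#|S| => phi2 (enum_val k))).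
  by rewrite [in RHS]up_comp.
rewrite [in LHS]up_nsurj // low0 [X in low _ X]up_nsurj ?low0 //.
apply: contra ps => ps1; apply/is_surjP => a1.
have S1T : phi2 @: S = setT.
  apply: single; apply/setP => z; rewrite in_setT.
    have [b bz] := is_surjP _ psi2s z.
    have [k kb] := is_surjP _ fs b.
    rewrite -bz -kb (sq_comm s2); do 2!apply: imset_f; exact: enum_valP.
  have [k <-] := is_surjP _ ps1 z.
  do 2!apply: imset_f; exact: enum_valP.
have : a1 \in phi2 @: S by rewrite S1T inE.
by case/imsetP=> a aS ->; exists (enum_rank_in aS a); rewrite enum_rankK_in.
Qed.

End Mackey.

(** * Generators in terms of numbered labels *)

(** The numbering that starts with 1, used by the maps on naturals that
    describe the generators. *)
Definition pos n (x : 'I_n) : nat := x.+1.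

Lemma pos_inj n : injective (@pos n).
Proof. by move=> x y [] /val_inj. Qed.

(** Used to see that equivalent labelled operations with increasing labels
    are equal. *)
Lemma increasing_perm n (s : 'S_n) :
  (forall k l : 'I_n, k < l -> s k < s l) -> s = 1%g.
Proof.
move=> sm; have ge (t : 'S_n) : (forall k l : 'I_n, k < l -> t k < t l) ->
    forall k : 'I_n, k <= t k.
  move=> tm k; have [m] := ubnP (k : nat); elim:
    m k => // m IH [[|k] kn] //= km.
  have k'n : k < n by apply: ltn_trans kn.
  have := IH (Ordinal k'n) km; move=> /= le.
  apply: leq_ltn_trans le _; exact: tm.
apply/permP => k; rewrite perm1; apply: val_inj; apply/anti_leq/andP; split;
  last exact: ge.
have sVm (k' l : 'I_n) : k' < l -> s^-1%g k' < s^-1%g l.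
  move=> kl; rewrite ltnNge leq_eqVlt negb_or; apply/andP; split.
    by apply: contraTneq kl => /val_inj/perm_inj ->; rewrite ltnn.
  by apply/negP => /sm; rewrite !permKV ltnNge ltnW.
by have := ge _ sVm (s k); rewrite permK.
Qed.

Lemma lequiv_increasing (P : operad) p q (l : 'I_p -> nat) (l' : 'I_q -> nat)
    (a : P p) (b : P q) :
  (forall i j : 'I_p, i < j -> l i < l j) ->
  (forall i j : 'I_q, i < j -> l' i < l' j) ->
  Lop l a ~~ Lop l' b -> Tagged P a = Tagged P b.
Proof.
move=> lm lm' [/= e]; case: _ / e in l' b lm' * => -[s [/= ls ->]].
rewrite (_ : s = 1%g) ?op_act1 //; apply: increasing_perm => k j kj.
have := lm' _ _ kj; rewrite -!ls.
have -> (h : p = p) t : cast_ord h t = t by apply: val_inj.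
have -> (h : p = p) t : cast_ord h t = t by apply: val_inj.
apply: contraTT; rewrite -!leqNgt leq_eqVlt =>
  /orP[/eqP/val_inj ->//|/lm/ltnW //].
Qed.

Lemma enum_val_lt n (S : {set 'I_n}) (i j : 'I_#|S|) :
  i < j -> enum_val i < enum_val j.
Proof.
move=> ij; have x0 : 'I_n := enum_val i.
rewrite !(enum_val_nth x0).
have so : sorted (fun a b : 'I_n => a < b) (enum S).
  rewrite /enum_mem; apply: sorted_filter; first by move=> ? ? ?; apply:
    ltn_trans.
  by have := iota_ltn_sorted 0 n; rewrite -val_enum_ord sorted_map enumT.
apply: (sorted_ltn_nth _ x0 so) => //; rewrite ?inE -?cardE ?ltn_ord //.
by move=> ? ? ?; apply: ltn_trans.
Qed.

Ltac cases_lia := rewrite ?/smap ?/tau; repeat (case: ifP => ?); move=> *; lia.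

Section NatArrows.
Variable (P : operad).

Lemma omor_ext n m (F G : omor P n m) : omor_smor F = omor_smor G -> F = G.
Proof.
case: F G => F p [G q] /= FG; case: _ / FG in q *.
by congr OMor; apply: bool_irrelevance.
Qed.

Lemma natsurjE a b (f : nat -> nat) (s : surj a b) :
  (forall x, pos (s x) = f (pos x)) -> natsurj a b f = Some s.
Proof.
move=> sf; rewrite /natsurj; case: {-}_ / idP => [h|[]]; last first.
  by apply/forallP => x; rewrite -[x.+1]/(pos x) -sf /= ltn_ord.
have E : natmap h = s.
  by apply: functional_extensionality => x; apply: val_inj;
    rewrite /= -[x.+1]/(pos x) -sf.
rewrite E; rewrite insubT ?surjP // => ps; congr Some.
by case: s ps {sf E} => s p ps; congr Surj; apply: bool_irrelevance.
Qed.

Lemma natomorE a b (f d : nat -> nat) (w : forall y, P (d y)) (F : omor P a b) :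
  (forall x, pos (F x) = f (pos x)) ->
  (forall y, Tagged P (w (pos y)) = Tagged P (smor_op F y)) ->
  natomor a b f w = Some F.
Proof.
move=> Ff Fw; rewrite /natomor (@natsurjE _ _ _ (Surj (omorP F))) //.
case: {-}_ / idP => [h|[]]; last first.
  by apply/forallP => y; have /= -> := congr1 tag (Fw y).
congr Some; apply: omor_ext; case: F Ff Fw h => [[F om] p] /= Ff Fw h.
congr SMor; apply: functional_extensionality_dep => y.
move: (om y) (Fw y) (eqP _) => {Fw h} /=; rewrite -[(nat_of_ord y).+1]/(pos y).
move: (w _); move: (d _) #|_| => p1 p2 v v' vE e; case: _ / e in v' vE * => /=.
exact: tagged_op_inj vE.
Qed.

(** To define a morphism, and below to verify that a square commutes, it is
    enough to work with labels in [nat]. *)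
Lemma nat_smor_exists a b (f : nat -> nat) (z : nat -> lop P nat) :
  (forall x, 0 < x <= a -> 0 < f x <= b) ->
  (forall c, 0 < c <= b -> injective (ll (z c))) ->
  (forall c, 0 < c <= b -> forall t, (t \in codom (ll (z c))) = (0 < t <= a) &&
    (f t == c)) ->
  exists2 F : smor P a b, forall x, pos (F x) = f (pos x) &
                          forall c, lmap (@pos a) (lab F c) ~~ z (pos c).
Proof.
move=> fab zi zf.
have ltl (c : 'I_b) k : (ll (z (pos c)) k).-1 < a.
  have := codom_f (ll (z (pos c))) k;
    rewrite zf ?ltn_ord // => /andP[/andP[t0 ta] _].
  by rewrite prednK.
have posl (c : 'I_b) k : pos (Ordinal (ltl c k)) = ll (z (pos c)) k.
  have := codom_f (ll (z (pos c))) k;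
    rewrite zf ?ltn_ord // => /andP[/andP[t0 ta] _].
  by rewrite /pos prednK.
pose x (c : 'I_b) : lop P 'I_a :=
  Lop (fun k => Ordinal (ltl c k)) (lo (z (pos c))).
have ltf (t : 'I_a) : (f (pos t)).-1 < b.
  by have /andP[/prednK -> ] := fab (pos t) (ltn_ord t).
have posf (t : 'I_a) : pos (Ordinal (ltf t)) = f (pos t).
  by have /andP[/prednK ] := fab (pos t) (ltn_ord t).
have [c k l E|c t|F Ff Fx] := @smor_exists P a b (fun t => Ordinal (ltf t)) x.
- by apply: (zi (pos c) (ltn_ord c)); rewrite -(posl c k) -(posl c l); exact:
  (congr1 (@pos a) E).
- rewrite -(inj_eq (@pos_inj b)) posf.
  have /= := zf (pos c) (ltn_ord c) (pos t); rewrite (ltn_ord t) /= => <-.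
  apply/codomP/codomP => [[k ->]|[k kt]]; exists k; first by rewrite posl.
  by apply: pos_inj; rewrite posl.
exists F => [t|c]; first by rewrite Ff posf.
apply: lequiv_trans (lequiv_map _ (Fx c)) _.
rewrite (_ : lmap _ _ = z (pos c)); first exact: lequiv_refl.
rewrite /x /lmap /=; have := posl c; move: (ltl c).
case: (z (pos c)) => n l o /= h E.
by congr Lop; apply: functional_extensionality => k; exact: E.
Qed.

Lemma sq_nat A B C D (f : 'I_A -> 'I_B) (g : 'I_C -> 'I_D) (phi : smor P A C)
    (psi : smor P B D) (fN gN : nat -> nat) (zphi zpsi : nat -> lop P nat) :
  (forall x, pos (f x) = fN (pos x)) -> (forall x, pos (g x) = gN (pos x)) ->
  (forall c, lmap (@pos A) (lab phi c) ~~ zphi (pos c)) ->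
  (forall d, lmap (@pos B) (lab psi d) ~~ zpsi (pos d)) ->
  (forall c, 0 < c <= C -> lmap fN (zphi c) = zpsi (gN c)) -> sq f g phi psi.
Proof.
move=> fE gE phiE psiE H c; apply: (lequiv_map_inj (@pos_inj B)).
apply: lequiv_trans _ (lequiv_sym (psiE (g c))).
rewrite gE -H ?ltn_ord //.
rewrite (_ : lmap _ _ = lmap fN (lmap (@pos A) (lab phi c))); first exact:
  lequiv_map.
by congr Lop; apply: functional_extensionality => k; rewrite -fE.
Qed.

(** The operation with labels at c of the generator that blows up the point
    i into the points i, ..., i + p - 1 and carries w there. *)
Definition hlab i p (w : P p) (c : nat) : lop P nat :=
  if c < i then lone P c else
  if c == i then Lop (fun q : 'I_p => i + q) w else lone P (c + p.-1).

(** The same for a family of unary operations on the identity map. *)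
Definition ilab (alpha : nat -> P 1) (c : nat) : lop P nat :=
  Lop (fun _ : 'I_1 => c) (alpha c).

Lemma hlab_inj i p (w : P p) c : injective (ll (hlab i w c)).
Proof.
rewrite /hlab; case: ifP => _ /= ; first by move=> k l;
  rewrite (ord1 k) (ord1 l).
case: ifP => _ k l /=; first by move/addnI/val_inj.
by rewrite (ord1 k) (ord1 l).
Qed.

Lemma codom_hlab i p (w : P p) c t : 0 < p ->
  (t \in codom (ll (hlab i w c))) = (smap i p.-1 t == c).
Proof.
move=> p0; rewrite /hlab /smap.
have one x : (t \in codom (ll (lone P x))) = (t == x).
  by apply/codomP/eqP => [[]//|->]; exists ord0.
case: ltngtP => ci; rewrite ?one; try by apply/eqP/eqP; cases_lia.
subst c; apply/codomP/eqP => [[q ->] /=|].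
  have /= := ltn_ord q; cases_lia.
move=> H; have tp : t - i < p by move: H; cases_lia.
by exists (Ordinal tp) => /=; move: H; cases_lia.
Qed.

Lemma hlab_exists a b i p (w : P p) : 0 < i <= b -> 0 < p -> a = b + p.-1 ->
  exists2 F : smor P a b, is_surj F &
    forall c, lmap (@pos a) (lab F c) ~~ hlab i w (pos c).
Proof.
move=> ib p0 ab.
have [x|c _|c cb t|F FE Fl] := @nat_smor_exists a b (smap i p.-1) (hlab i w).
- cases_lia.
- exact: hlab_inj.
- rewrite codom_hlab //; cases_lia.
exists F => //; apply/is_surjP => c.
have : exists k, ll (hlab i w (pos c)) k \in codom (ll (hlab i w (pos c))).
  rewrite /hlab; case: ifP => _; first by exists ord0; apply: codom_f.
  case: ifP => _; last by exists ord0; apply: codom_f.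
  by exists (Ordinal p0); apply: codom_f.
case=> k; rewrite -(lequiv_codom _ (Fl c)) => /codomP[k' _].
by exists (ll (lab F c) k'); apply/eqP; rewrite -codom_lab codom_f.
Qed.

Lemma hlab_fun a b i p (w : P p) (F : smor P a b) : 0 < p ->
  (forall c, lmap (@pos a) (lab F c) ~~ hlab i w (pos c)) ->
  forall x, pos (F x) = smap i p.-1 (pos x).
Proof.
move=> p0 Fl x; apply/esym/eqP;
  rewrite -(codom_hlab i w) // -(lequiv_codom _ (Fl _)).
have /codomP[k xk] : x \in codom (ll (lab F (F x))) by rewrite codom_lab.
by apply/codomP; exists k; rewrite {1}xk.
Qed.

End NatArrows.

Section NatJanus.
Variables (P : unitary_operad) (M : janus P).

Lemma lowf_low a b (f : nat -> nat) (s : 'I_a -> 'I_b) x : is_surj s ->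
  (forall x, pos (s x) = f (pos x)) -> lowf M a b f x = low s x.
Proof.
by move=> ss sf; rewrite /lowf (@natsurjE _ _ _ (Surj ss)) // lowE.
Qed.

(** Increasing labels are the natural enumeration of the fibres, with respect
    to which the generators are defined. *)
Lemma upf_up a b (f d : nat -> nat) (w : forall y, P (d y)) (F : smor P a b)
    (l : forall y, 'I_(d y) -> nat) x :
  is_surj F -> (forall x, pos (F x) = f (pos x)) ->
  (forall y (i j : 'I_(d y)), i < j -> l y i < l y j) ->
  (forall y, lmap (@pos a) (lab F y) ~~ Lop (l (pos y)) (w (pos y))) ->
  upf M a b f w x = up F x.
Proof.
move=> Fs Ff lm Fl; rewrite /upf (@natomorE _ _ _ _ _ _ (OMor Fs)) ?upE // => y.
apply/esym/(@lequiv_increasing P _ _ (fun k => pos (ll (lab F y) k))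
  (l (pos y))).
- move=> i j ij; exact: enum_val_lt.
- exact: lm.
- exact: Fl.
Qed.

Lemma Hop_up a b i p (w : P p) (F : smor P a b) x : is_surj F -> 0 < p ->
  a - b = p.-1 ->
  (forall c, lmap (@pos a) (lab F c) ~~ hlab i w (pos c)) ->
  Hop M a b i w x = up F x.
Proof.
move=> Fs p0 ab Fl; rewrite /Hop ab.
pose l y (k : 'I_(dim_at i p y)) :=
  (if y < i then y else if y == i then i else y + p.-1) + k.
apply: (upf_up (l := l)) => // [|y u v|y].
- exact: hlab_fun.
- by rewrite /l; lia.
rewrite (_ : Lop _ _ = hlab i w (pos y)) //.
rewrite /l /hlab /ops_at /dim_at; move: (pos y) => c.
move E: (c == i) => e; case: e E => [/eqP -> | /eqP ci].
  by rewrite ltnn.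
case: ltngtP => // _; congr Lop; apply: functional_extensionality => q.
  by rewrite ord1 addn0.
by rewrite ord1 addn0.
Qed.

Lemma Iop_up n alpha (F : smor P n n) x :
  (forall c, lmap (@pos n) (lab F c) ~~ ilab alpha (pos c)) ->
  Iop M n alpha x = up F x.
Proof.
move=> Fl.
have FE c : F c = c.
  have /codomP[k ck] : c \in codom (ll (lab F (F c))) by rewrite codom_lab.
  have : pos c \in codom (ll (ilab alpha (pos (F c)))).
    by rewrite -(lequiv_codom _ (Fl _)); apply/codomP; exists k; rewrite {1}ck.
  by case/codomP=> j /= /esym /pos_inj.
have Fs : is_surj F by apply/is_surjP => c; exists c.
apply: (upf_up (l := fun y _ => y)) => // [c|y i j]; first by rewrite FE.
by rewrite (ord1 i) (ord1 j).
Qed.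

End NatJanus.

(** * The first four relations as squares *)

Lemma merge_exists n m i : 0 < i < n -> m = n.-1 ->
  exists2 g : 'I_n -> 'I_m, is_surj g & forall x, pos (g x) = smap i 1 (pos x).
Proof.
move=> i_n ->.
have bd (x : 'I_n) : (smap i 1 (pos x)).-1 < n.-1.
  by have := ltn_ord x; rewrite /pos; cases_lia.
exists (fun x => Ordinal (bd x)) => [|x]; last by rewrite /pos /=; cases_lia.
apply/is_surjP => y.
have [yi|yi] := ltnP y i.
  have yn : y < n by have := ltn_ord y; lia.
  by exists (Ordinal yn); apply: val_inj => /=; rewrite /pos /=; cases_lia.
have yn : y.+1 < n by have := ltn_ord y; lia.
by exists (Ordinal yn); apply: val_inj => /=; rewrite /pos /=; cases_lia.
Qed.

(** If every point is alone in its fibre of one of the two maps, no point can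
    be left out. *)
Lemma single_admissible A B C (f : 'I_A -> 'I_B) (phi : 'I_A -> 'I_C) :
  (forall a, (forall a', f a' = f a -> a' = a) \/
    (forall a', phi a' = phi a -> a' = a)) ->
  forall S : {set 'I_A}, f @: S = setT -> phi @: S = setT -> S = setT.
Proof.
move=> H S fS pS; apply/setP => a; rewrite inE.
have [fa|pa] := H a.
  have : f a \in f @: S by rewrite fS inE.
  by case/imsetP=> a' aS /esym/fa <-.
have : phi a \in phi @: S by rewrite pS inE.
by case/imsetP=> a' aS /esym/pa <-.
Qed.

Section Squares.
Variable P : operad.

Lemma lmap_one T U (h : T -> U) t : lmap h (lone P t) = lone P (h t).
Proof. by []. Qed.

Lemma merge_hlab_before i j p (w : P p) c : i < j -> 0 < p ->
  lmap (smap i 1) (hlab j.+1 w c) = hlab j w (smap i 1 c).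
Proof.
move=> ij p0; rewrite /hlab; case: ltngtP => cj.
- rewrite lmap_one; case: ltngtP => //; cases_lia.
- rewrite lmap_one; case: ltngtP => //; try cases_lia.
  by move=> _; congr lone; cases_lia.
- subst c; case: ltngtP => //; try cases_lia.
  move=> _; congr Lop; apply: functional_extensionality => q /=; cases_lia.
Qed.

Lemma merge_hlab_after i j p (w : P p) c : j < i -> 0 < p ->
  lmap (smap (p.-1 + i) 1) (hlab j w c) = hlab j w (smap i 1 c).
Proof.
move=> ij p0; rewrite /hlab; case: ltngtP => cj.
- rewrite lmap_one; case: ltngtP => //; try cases_lia.
  by move=> _; congr lone; cases_lia.
- rewrite lmap_one; case: ltngtP => //; try cases_lia.
  by move=> _; congr lone; cases_lia.
- subst c; case: ltngtP => //; try cases_lia.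
  move=> _; congr Lop; apply: functional_extensionality => q /=.
  have /= := ltn_ord q; cases_lia.
Qed.

Lemma merge_ilab i (alpha : nat -> P 1) c :
  lmap (smap i 1) (ilab (fun j => if j <= i then alpha j else alpha j.-1) c) =
  ilab alpha (smap i 1 c).
Proof.
have cE : (if c <= i then alpha c else alpha c.-1) = alpha (smap i 1 c).
  rewrite /smap; case: ifP => // ci; case: ifP => ci'; congr alpha; lia.
by rewrite /ilab /lmap /= cE.
Qed.

End Squares.

Section Relations.
Variables (P : unitary_operad) (M : janus P).

Lemma Pop_low n i (g : 'I_n -> 'I_n.-1) (x : M n) : is_surj g ->
  (forall x, pos (g x) = smap i 1 (pos x)) -> Pop M n i x = low g x.
Proof. by move=> gs gE; rewrite /Pop; apply: lowf_low. Qed.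

Lemma ilab_exists n (alpha : nat -> P 1) :
  exists2 F : smor P n n, F =1 id
    & forall c, lmap (@pos n) (lab F c) ~~ ilab alpha (pos c).
Proof.
have [//|c _|c cn t|F FE Fl] := @nat_smor_exists P n n id (ilab alpha).
- by move=> /= k l _; rewrite (ord1 k) (ord1 l).
- apply/codomP/andP => [[k ->]|[_ /eqP ->]]; first by rewrite /= eqxx;
  split=> //; lia.
  by exists ord0.
by exists F => // x; apply: pos_inj; rewrite FE.
Qed.

Lemma pos_tperm n (a b : 'I_n) : b = a.+1 :> nat ->
  forall x, pos (tperm a b x) = tau (pos a) (pos x).
Proof.
move=> ab x; rewrite /pos; case: tpermP => [->|->|xa xb]; try by cases_lia.
have xa' : x <> a :> nat by move/val_inj.
have xb' : x <> b :> nat by move/val_inj.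
by cases_lia.
Qed.

Lemma Top_low n (a b : 'I_n) : b = a.+1 :> nat ->
  forall x, Top M n (pos a) x = low (tperm a b) x.
Proof.
by move=> ab x; apply: lowf_low; [exact: is_surj_perm|exact: pos_tperm].
Qed.

Lemma Tup_up n (a b : 'I_n) : b = a.+1 :> nat ->
  forall x, Tup M n (pos a) x = up (smor_inj P (@perm_inj _ (tperm a b))) x.
Proof.
move=> ab x; apply: (upf_up (l := fun y _ => tau (pos a) y)).
- exact: is_surj_perm.
- exact: pos_tperm.
- by move=> y i j; rewrite (ord1 i) (ord1 j).
move=> y; set s := tperm a b.
rewrite -{1}(permKV s y) lab_smor_inj /ops1 tpermV -(pos_tperm ab); exact:
  lequiv_refl.
Qed.

Lemma ord_adjacent n i : 1 <= i -> i <= n - 1 ->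
  exists a b : 'I_n, b = a.+1 :> nat /\ pos a = i.
Proof.
move=> i1 i_n.
have an : i.-1 < n by lia.
have bn : i < n by lia.
by exists (Ordinal an), (Ordinal bn); rewrite /pos /= prednK.
Qed.

Hypothesis mackey : pseudo_mackey M.

Lemma tau_inverse n i : 1 <= i -> i <= n - 1 ->
  cancel (Tup M n i) (Top M n i) /\ cancel (Top M n i) (Tup M n i).
Proof.
move=> i1 i_n; have [iso _] := (pseudo_mackeyP M).1 mackey.
have [a [b [ab <-]]] := ord_adjacent i1 i_n.
split=> x; rewrite (Top_low ab) (Tup_up ab); first exact: iso.
exact: up_low_perm.
Qed.

Lemma unary_past_merge n i (alpha : nat -> P 1) : 1 <= i -> i < n -> forall x :
    M n,
  Iop M n.-1 alpha (Pop M n i x) =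
  Pop M n i (Iop M n (fun j => if j <= i then alpha j else alpha j.-1) x).
Proof.
have [iso B] := (pseudo_mackeyP M).1 mackey.
move=> i1 i_n x; set alpha' := fun j => _.
have [||g gs gE] := @merge_exists n n.-1 i; rewrite ?i1 //.
have [F Fid Fl] := ilab_exists n.-1 alpha.
have [F' Fid' Fl'] := ilab_exists n alpha'.
have Fs : is_surj F by apply/is_surjP => c; exists c.
have sqr : sq g g F' F.
  by apply: (sq_nat gE gE Fl' Fl) => c _; apply: merge_ilab.
rewrite !(Pop_low _ gs gE) (Iop_up _ Fl) (Iop_up _ Fl').
rewrite (B _ _ _ _ _ gs Fs _ _ _ sqr) adm_sum_single //.
by apply: single_admissible => a; right=> a'; rewrite !Fid'.
Qed.

Lemma blowup_past_merge_before n i j k (alpha : P k.+1) : 1 <= i -> i < j ->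
    j < n ->
  forall x : M n,
    Hop M (n + k).-1 n.-1 j alpha (Pop M n i x) =
    Pop M (n + k) i (Hop M (n + k) n j.+1 alpha x).
Proof.
have [iso B] := (pseudo_mackeyP M).1 mackey.
move=> i1 ij jn x.
have [||g gs gE] := @merge_exists n n.-1 i; rewrite ?i1 //; first lia.
have [||f fs fE] := @merge_exists (n + k) (n + k).-1 i; rewrite ?i1 //;
  first lia.
have [|||F Fs Fl] := @hlab_exists P (n + k).-1 n.-1 j _ alpha; try lia.
have [|||F' Fs' Fl'] := @hlab_exists P (n + k) n j.+1 _ alpha; try lia.
have sqr : sq f g F' F.
  by apply: (sq_nat fE gE Fl' Fl) => c _; apply: merge_hlab_before.
rewrite !(Pop_low _ gs gE) !(Pop_low _ fs fE).
rewrite (Hop_up _ _ _ _ Fl) ?(Hop_up _ _ _ _ Fl') //=; try lia.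
rewrite (B _ _ _ _ _ gs Fs _ _ _ sqr) adm_sum_single //.
apply: single_admissible => a.
have FE := hlab_fun (isT : 0 < k.+1) Fl'.
have [ai|ai] := leqP (pos a) j; [right|left] => a' E; apply: pos_inj.
  by move: (congr1 (@pos _) E); rewrite !FE; cases_lia.
by move: (congr1 (@pos _) E); rewrite !fE; cases_lia.
Qed.

Lemma blowup_past_merge_after n i j k (alpha : P k.+1) : 1 <= j -> j < i ->
    i < n ->
  forall x : M n,
    Hop M (n + k).-1 n.-1 j alpha (Pop M n i x) =
    Pop M (n + k) (k + i) (Hop M (n + k) n j alpha x).
Proof.
have [iso B] := (pseudo_mackeyP M).1 mackey.
move=> j1 ji i_n x.
have [||g gs gE] := @merge_exists n n.-1 i; rewrite //; first lia.
have [||f fs fE] := @merge_exists (n + k) (n + k).-1 (k + i); rewrite //;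
  first lia.
have [|||F Fs Fl] := @hlab_exists P (n + k).-1 n.-1 j _ alpha; try lia.
have [|||F' Fs' Fl'] := @hlab_exists P (n + k) n j _ alpha; try lia.
have sqr : sq f g F' F.
  by apply: (sq_nat fE gE Fl' Fl) => c _; apply: (@merge_hlab_after P i j k.+1).
rewrite !(Pop_low _ gs gE) !(Pop_low _ fs fE).
rewrite (Hop_up _ _ _ _ Fl) ?(Hop_up _ _ _ _ Fl') //=; try lia.
rewrite (B _ _ _ _ _ gs Fs _ _ _ sqr) adm_sum_single //.
apply: single_admissible => a.
have FE := hlab_fun (isT : 0 < k.+1) Fl'.
have [ai|ai] := leqP (pos a) (j + k); [left|right] => a' E; apply: pos_inj.
  by move: (congr1 (@pos _) E); rewrite !fE; cases_lia.
by move: (congr1 (@pos _) E); rewrite !FE; cases_lia.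
Qed.

End Relations.

(** * Factoring into generators *)

(** Adjacent transpositions generate: tperm a (b + 1) is a conjugate of
    tperm a b. *)
Lemma adjacent_tperm_ind n (K : 'S_n -> Prop) :
  K 1%g -> (forall s t, K s -> K t -> K (s * t)%g) ->
  (forall a b : 'I_n, b = a.+1 :> nat -> K (tperm a b)) -> forall s, K s.
Proof.
move=> K1 KM Ka s.
have Kt m (a b : 'I_n) : b = a + m.+1 :> nat -> K (tperm a b).
  elim: m b => [|m IH] b ab; first by apply: Ka; rewrite ab addn1.
  have cn : a + m.+1 < n by have := ltn_ord b; lia.
  pose c := Ordinal cn.
  have cb : b = c.+1 :> nat by rewrite ab /= addnS.
  have -> : tperm a b = (tperm c b * (tperm a c * tperm c b))%g.
    rewrite -{1}(tpermV c b) -[RHS]/(tperm a c ^ tperm c b)%g tpermJ tpermL.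
    by rewrite tpermD //; apply/eqP => /(congr1 val) /=; lia.
  by apply: (KM); [exact: Ka|apply: (KM); [exact: IH|exact: Ka]].
have [ts -> _] := prod_tpermP s.
elim: ts => [|[a b] ts IH]; first by rewrite big_nil.
rewrite big_cons; apply: KM => //=.
case: (ltngtP a b) => [ab|ab|/val_inj ->]; last by rewrite tperm1.
- by apply: (Kt (b - a.+1)); lia.
- by rewrite tpermC; apply: (Kt (a - b.+1)); lia.
Qed.

Section Peel.
Variable P : unitary_operad.

(** The fibre over c0, in its natural order, is sent bijectively to the points
    that replace c0, so that the operation of psi there is carried by the
    blow-up F alone.  The last clause is what the induction on fibres needs: the
    new points carry identities and the later ones keep their operations. *)
Lemma peel B D a (psi : smor P B D) (c0 : 'I_D) (F : smor P a D) :
  let p := #|fibre psi c0| in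
  0 < p -> a = D + p.-1 ->
  (forall c, lmap (@pos a) (lab F c) ~~ hlab (pos c0) (smor_op psi c0) (pos c))
    ->
  exists psi2 : smor P B a,
    [/\ psi = scomp F psi2, is_surj psi -> is_surj psi2 &
      forall d : 'I_a, c0 <= d ->
        (exists b, lab psi2 d ~~ lone P b) \/
        (exists2 c : 'I_D, c0 < c & lab psi2 d ~~ lab psi c)].
Proof.
move=> p p0 aE Fl.
pose at_ (d : nat) : 'I_D := insubd c0 d.
have atE d : d < D -> at_ d = d :> nat by move=> dD; rewrite /at_ val_insubd dD.
(* x and f are the operations and the map of psi2 *)
pose x (d : 'I_a) : lop P 'I_B :=
  if d < c0 then lab psi (at_ d) else
  if insub (d - c0) is Some q then lone P (enum_val (q : 'I_p))
  else lab psi (at_ (d - p.-1)).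
pose f (b : 'I_B) : nat :=
  if psi b < c0 then (psi b : nat) else
  if psi b == c0 then c0 + index b (enum (fibre psi c0)) else psi b + p.-1.
have idx b : psi b = c0 -> index b (enum (fibre psi c0)) < p.
  by move=> bc; rewrite /p cardE index_mem mem_enum inE bc.
have fa b : f b < a.
  have bD := ltn_ord (psi b); have cD := ltn_ord c0.
  rewrite /f; case: (ltnP (psi b) c0) => bc0; first by lia.
  by case: (psi b =P c0) => [/idx|_]; lia.
have [d|d b|psi2 fE xE] := @smor_exists P B a (fun b => Ordinal (fa b)) x.
- rewrite /x; case: ifP => _; first exact: lab_inj.
  case: insubP => [q _ _|_]; last exact: lab_inj.
  by move=> /= k l _; rewrite (ord1 k) (ord1 l).
- rewrite -val_eqE /= /x /f; have := ltn_ord d => da; have := ltn_ord c0 => c0D.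
  have nc0 : psi b <> c0 -> psi b <> c0 :> nat by move=> ? /val_inj.
  case: (ltnP d c0) => dc0.
    rewrite codom_lab -val_eqE /= atE; last by lia.
    by case: (ltnP (psi b) c0) => [//|bc0]; case: (psi b =P c0) => [->|/nc0];
      lia.
  case: insubP => [q _ qE'|qp].
    have qE : nat_of_ord q = d - c0 := qE'.
    have -> : (b \in codom (ll (lone P (enum_val q)))) = (b == enum_val q).
      by apply/codomP/eqP => [[]//|->]; exists ord0.
    have qc := enum_valP q; rewrite inE in qc.
    case: (ltnP (psi b) c0) => bc0.
      rewrite (_ : (nat_of_ord (psi b) == d) = false); last by lia.
      by apply/eqP => bE; rewrite bE (eqP qc) ltnn in bc0.
    case: (psi b =P c0) => bc.
      apply/eqP/eqP => [->|E].
        rewrite (enum_val_nth b) index_uniq ?enum_uniq -?cardE ?ltn_ord //.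
        exact: etrans (congr1 (addn c0) qE) (subnKC dc0).
      rewrite (enum_val_nth b) (_ : q = index b (enum (fibre psi c0)) :> nat);
        last by lia.
      by rewrite nth_index // mem_enum inE bc.
    have := nc0 bc; move=> bc'; have := ltn_ord q => qp.
    rewrite (_ : (psi b + p.-1 == d) = false); last by lia.
    by apply/eqP => E; case: bc; rewrite E (eqP qc).
  rewrite codom_lab -val_eqE /= atE; last by lia.
  have {}qp : p <= d - c0 by rewrite leqNgt.
  case: (ltnP (psi b) c0) => bc0; first by lia.
  case: (psi b =P c0) => [bc|/nc0]; last by lia.
  have bc2 : psi b = c0 :> nat by rewrite bc.
  by have := idx (b : 'I_B) bc; move: (index _ _) => u; lia.
exists psi2; split; last first.
- move=> d dc0; have := xE d; rewrite /x ltnNge dc0 /=.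
  case: insubP => [q _ /= qE|qp] xd; first by left; exists (enum_val q).
  right; exists (at_ (d - p.-1)) => //; have := ltn_ord d => da.
  by rewrite atE; lia.
- move=> /is_surjP psis; apply/is_surjP => d.
  have [t td] : exists t, t \in codom (ll (x d)).
    have psi_ne c : exists t, t \in codom (ll (lab psi c)).
      by have [t tc] := psis c; exists t; rewrite codom_lab tc.
    rewrite /x; case: ifP => _; first exact: psi_ne.
    case: insubP => [q _ _|_]; last exact: psi_ne.
    by exists (enum_val q); apply/codomP; exists ord0.
  by exists t; apply/eqP; rewrite -codom_lab (lequiv_codom _ (xE d)).
apply: smor_ext => c; apply: lequiv_sym; apply: lequiv_trans (lab_comp _ _ _) _.
pose y (t : nat) : lop P 'I_B := if insub t.-1 is Some d then x d
  else lzero P _.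
have yE (d : 'I_a) : y (pos d) = x d by rewrite /y /= valK.
apply: lequiv_trans (lbind_equivr (G := x) (fun i => xE _)) _.
have -> : lbind (lab F c) x = lbind (lmap (@pos a) (lab F c)) y.
  by congr lcomp; apply: functional_extensionality => k; rewrite -yE.
apply: lequiv_trans (lbind_equivl _ (Fl c)) _.
have cD := ltn_ord c; have c0D := ltn_ord c0.
rewrite /hlab /pos ltnS eqSS val_eqE.
have lonex t (ta : t < a) : y t.+1 = x (Ordinal ta) by rewrite -yE.
case: ltngtP => cc0.
- have ca : c < a by lia.
  rewrite lbind1 (lonex _ ca) /x /= cc0.
  by rewrite (_ : at_ c = c);
    [exact: lequiv_refl|apply: val_inj; rewrite /= atE].
- rewrite (_ : (c == c0) = false); last by rewrite -val_eqE /=; lia.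
  have ca : c + p.-1 < a by lia.
  rewrite lbind1 addSn (lonex _ ca) /x /= ltnNge (_ : c0 <= c + p.-1); last
    by lia.
  case: insubP => [q /=|_]; first by lia.
  by rewrite /= addnK (_ : at_ c = c);
    [exact: lequiv_refl|apply: val_inj; rewrite /= atE].
- have {cc0} -> : c = c0 by apply: val_inj.
  rewrite eqxx.
  rewrite (_ : lbind _ _ = lbind
    (Lop (fun q : 'I_p => enum_val q) (smor_op psi c0)) (fun t => lone P t)).
    by rewrite (lbind_one _ id) lmap_id; apply: lequiv_refl.
  congr lcomp; apply: functional_extensionality => q /=.
  have qp : q < p by [].
  have qa : c0 + q < a by lia.
  rewrite addSn (lonex _ qa) /x /= ltnNge leq_addr /= addKn.
  by rewrite insubT; congr (lone P (enum_val _)); apply: val_inj.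
Qed.

(** All fibres being singletons with the identity operation, psi is a
    permutation; the arities of source and target agree only up to a proof. *)
Lemma unary_perm B a (psi : smor P B a) :
  is_surj psi -> (forall d, exists b, lab psi d ~~ lone P b) ->
  exists (e : a = B) (s : 'S_a),
    psi = ecast m (smor P m a) e (smor_inj P (@perm_inj _ s)).
Proof.
move=> psis triv.
have mem1 b (t : 'I_B) : (t \in codom (ll (lone P b))) = (t == b).
  by apply/codomP/eqP => [[]//|->]; exists ord0.
have labE t : lab psi (psi t) ~~ lone P t.
  have [b lb] := triv (psi t).
  have : t \in codom (ll (lab psi (psi t))) by rewrite codom_lab.
  by rewrite (lequiv_codom _ lb) mem1 => /eqP tb; rewrite -tb in lb.
have psii : injective psi.
  move=> t t' E; apply/eqP.
  by rewrite -(mem1 t' t) -(lequiv_codom _ (labE t')) codom_lab E.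
have e : a = B.
  apply/anti_leq/andP; split; last by have := leq_card _ psii;
    rewrite !card_ord.
  have /fin_all_exists[h hE] := is_surjP _ psis.
  have hi : injective h by move=> x y E; rewrite -(hE x) E hE.
  by have := leq_card _ hi; rewrite !card_ord.
subst B; exists erefl, (perm psii) => /=.
apply: smor_ext => y; have [t <-] := is_surjP _ psis y.
apply: lequiv_trans (labE t) _.
by rewrite -(permE psii t) lab_smor_inj; apply: lequiv_refl.
Qed.

End Peel.

Section Generation.
Variables (P : unitary_operad) (M : janus P).

(** Both functors turn a product of permutations into a composite, so the set
    of permutations that satisfy the axiom is closed under products. *)
Lemma iso_law_generators :
  (forall n i, 1 <= i -> i <= n - 1 -> cancel (Tup M n i) (Top M n i)) ->
  iso_law M.
Proof.
move=> H n; apply: adjacent_tperm_ind => [x|s t Hs Ht x|a b ab x].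
- by rewrite low_id ?up_id // => k; rewrite perm1.
- have sti : injective (fun k => t (s k)) by move=> k l /perm_inj/perm_inj.
  rewrite (eq_low (f' := fun k => t (s k))); last by move=> k; rewrite permM.
  rewrite (smor_inj_eq P _ sti (permM s t)).
  rewrite -(smor_inj_comp P (@perm_inj _ t) (@perm_inj _ s)) low_comp
    ?is_surj_perm //.
  by rewrite (up_comp (F := smor_inj P (@perm_inj _ s)) _ _ (is_surj_perm s))
    Hs Ht.
- rewrite -(Top_low ab) -(Tup_up ab); apply: H => //.
  by have := ltn_ord b; rewrite /pos; lia.
Qed.

Hypothesis iso : iso_law M.

Hypothesis mackey_before : forall n j p (w : P p), 0 < p -> 1 < j -> j < n ->
  forall x : M n,
    Hop M (n + p.-1).-1 n.-1 j w (Pop M n 1 x) =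
    Pop M (n + p.-1) 1 (Hop M (n + p.-1) n j.+1 w x).

Hypothesis mackey_first : forall n p a (w : P p) (g : 'I_n -> 'I_n.-1)
    (F : smor P a n.-1),
  a = (n + p.-1).-1 -> 1 < n -> 0 < p -> is_surj g -> is_surj F ->
  (forall x, pos (g x) = smap 1 1 (pos x)) ->
  (forall c, lmap (@pos _) (lab F c) ~~ hlab 1 w (pos c)) -> mackey_at M g F.

Lemma fibre_gt0 n m (F : smor P n m) c : is_surj F -> 0 < #|fibre F c|.
Proof.
move=> /is_surjP/(_ c)[x xc]; apply/card_gt0P; exists x; rewrite inE; exact/eqP.
Qed.

Lemma mackey_first_perm n p (w : P p) (g : 'I_n -> 'I_n.-1)
    (F : smor P (n + p.-1).-1 n.-1) B (psi : smor P B (n + p.-1).-1) :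
  1 < n -> 0 < p -> is_surj g -> is_surj F ->
  (forall x, pos (g x) = smap 1 1 (pos x)) ->
  (forall c, lmap (@pos _) (lab F c) ~~ hlab 1 w (pos c)) ->
  is_surj psi -> (forall d, exists b, lab psi d ~~ lone P b) ->
  mackey_at M g (scomp F psi).
Proof.
move=> n1 p0 gs Fs gE Fl psis unary.
have [e [s]] := unary_perm psis unary.
case: _ / e in psi psis unary * => /= ->.
exact/(mackey_perm_up iso)/(mackey_first (w := w)).
Qed.

(** Induction on the number of fibres that may fail to be unary: peeling the
    last of them leaves a merging map on the blown up set and an arrow with one
    such fibre less. *)
Lemma mackey_merge_unary j : 0 < j ->
  forall n B (g : 'I_n -> 'I_n.-1) (psi : smor P B n.-1),
  1 < n -> is_surj g -> (forall x, pos (g x) = smap 1 1 (pos x)) ->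
  is_surj psi -> (forall c : 'I_n.-1, j <= c ->
    exists b, lab psi c ~~ lone P b) ->
  mackey_at M g psi.
Proof.
elim: j => // j IH _ n B g psi n1 gs gE psis triv.
have [jn|nj] := ltnP j n.-1; last first.
  case: j IH triv nj => [|j] IH triv nj; first by lia.
  by apply: IH => // c jc; have := ltn_ord c; lia.
pose c0 := Ordinal jn; pose p := #|fibre psi c0|.
have p0 : 0 < p by apply: fibre_gt0.
have [|||F Fs Fl] := @hlab_exists P (n + p.-1).-1 n.-1 j.+1 _ (smor_op psi c0);
  try (rewrite -/p; lia).
have [|psi2 [psiE psi2s triv2]] := @peel P _ _ _ psi c0 F p0 _ Fl.
  by rewrite -/p; lia.
rewrite -/p in F Fs Fl psi2 psiE psi2s triv2 *.
have unary2 (d : 'I_(n + p.-1).-1) : j <= d -> exists b, lab psi2 d ~~ lone P b.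
  case/triv2 => // -[c jc E]; have [b cb] := triv c jc.
  by exists b; apply: lequiv_trans E cb.
have [j0|j0] := posnP j.
  rewrite psiE; apply: (mackey_first_perm n1 p0 gs Fs gE (w := smor_op psi c0)).
  - by move: Fl; rewrite /= /pos /= j0.
  - exact: psi2s.
  - by move=> d; apply: unary2; rewrite j0.
have [||f fs fE] := @merge_exists (n + p.-1) (n + p.-1).-1 1; [lia|by []|].
have [|||F' Fs' Fl'] := @hlab_exists P (n + p.-1) n j.+2 _ (smor_op psi c0);
  try (rewrite -/p; lia).
rewrite psiE; apply: (@mackey_vcomp _ _ iso _ _ _ _ _ f _ F').
- exact: psi2s.
- by apply: (sq_nat fE gE Fl' Fl) => c _; apply: merge_hlab_before.
- apply: single_admissible => a; have F'E := hlab_fun p0 Fl'.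
  have [ai|ai] := leqP (pos a) j.+1; [right|left] => a' E; apply: pos_inj.
    by move: (congr1 (@pos _) E); rewrite !F'E; cases_lia.
  by move: (congr1 (@pos _) E); rewrite !fE; cases_lia.
- move=> x; rewrite -(Pop_low _ gs gE) -(Pop_low _ fs fE).
  rewrite -(Hop_up _ _ _ _ Fl) -?(Hop_up _ _ _ _ Fl') //=; rewrite -/p; try lia.
  by apply: mackey_before => //; lia.
- have n1p : 1 < n + p.-1 by lia.
  exact: (IH j0 (n + p.-1) B f psi2 n1p fs fE (psi2s psis) unary2).
Qed.

Lemma mackey_merge n B (g : 'I_n -> 'I_n.-1) (psi : smor P B n.-1) :
  1 < n -> is_surj g -> (forall x, pos (g x) = smap 1 1 (pos x)) ->
  is_surj psi -> mackey_at M g psi.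
Proof.
move=> n1 gs gE psis; apply: (@mackey_merge_unary n) => //; first by lia.
by move=> c nc; have := ltn_ord c; lia.
Qed.

(** Induction on the size of C: a map that is not injective factors through a
    permutation that brings two points of a fibre to the first two places,
    followed by the merging map. *)
Lemma mackey_all C D (g : 'I_C -> 'I_D) B (psi : smor P B D) :
  is_surj g -> is_surj psi -> mackey_at M g psi.
Proof.
have [m] := ubnP C; elim: m C g => // m IH C g Cm gs psis.
have [gi|] := boolP (injectiveb g).
  have {}gi := injectiveP _ gi.
  have e : C = D.
    apply/anti_leq/andP; split; first by have := leq_card _ gi;
      rewrite !card_ord.
    have /fin_all_exists[h hE] := is_surjP _ gs.
    have hi : injective h by move=> x y E; rewrite -(hE x) E hE.
    by have := leq_card _ hi; rewrite !card_ord.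
  subst D; have -> : g = perm gi by apply: functional_extensionality => x;
    rewrite permE.
  exact: mackey_perm_low.
case/injectivePn => x [y xy gxy].
have C1 : 1 < C.
  have := ltn_ord x; have := ltn_ord y; have : x != y :> nat by []; lia.
case: C => [|[|C]] // in g Cm gs x y xy gxy C1 *.
pose a0 : 'I_C.+2 := ord0; pose a1 : 'I_C.+2 := lift ord0 ord0.
(* a permutation that brings x and y to the first two places *)
have [s [s0 s1]] : exists s : 'S_C.+2, s a0 = x /\ s a1 = y.
  exists (tperm a1 (tperm a0 x y) * tperm a0 x)%g.
  have ya : tperm a0 x y != a0.
    by apply: contra xy => /eqP E; rewrite -[y](tpermK a0 x) E tpermL.
  split; rewrite permM; last by rewrite tpermL tpermK.
  by rewrite (tpermD (z := a0)) ?tpermL // eq_sym.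
have [||h hs hE] := @merge_exists C.+2 C.+1 1; [by []|by []|].
pose g' (z : 'I_C.+1) : 'I_D := g (s (if z == ord0 then a0 else lift ord0 z)).
have gE z : g (s z) = g' (h z).
  have zE := hE z; rewrite /pos in zE.
  rewrite /g'; case: eqVneq => [hz|hz].
    rewrite s0 gxy; have [->|z0] := eqVneq z a0; first by rewrite s0 gxy.
    suff -> : z = a1 by rewrite s1.
    have {}z0 : nat_of_ord z <> 0 by move=> E; case/eqP: z0; apply: val_inj.
    by apply: val_inj; rewrite /= /bump; move: zE; rewrite hz /=; cases_lia.
  have {}hz : nat_of_ord (h z) <> 0 by move=> E; case/eqP: hz; apply: val_inj.
  by congr (g (s _)); apply: val_inj; rewrite /= /bump; move: zE; cases_lia.
have g's : is_surj g'.
  apply/is_surjP => d; have [c <-] := is_surjP _ gs d.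
  by exists (h (s^-1%g c)); rewrite -gE permKV.
have -> : g = fun c => g' (h (s^-1%g c)).
  by apply: functional_extensionality => c; rewrite -gE permKV.
apply: (mackey_hcomp iso (g2 := fun c => h (s^-1%g c))).
- exact: is_surj_comp hs (is_surj_perm _).
- exact: IH.
move=> A phi phis; apply: (mackey_hcomp iso (g2 := s^-1%g)).
- exact: is_surj_perm.
- exact: mackey_merge.
by move=> A' phi' phi's; apply: mackey_perm_low.
Qed.

End Generation.

(** * Combinatorics of the shuffle *)

Definition rank (K : pred nat) t := count K (iota 1 t).

Lemma iotaSr m t : iota m t.+1 = iota m t ++ [:: m + t].
Proof. by rewrite -{1}(addn1 t) iotaD. Qed.

Lemma rankS K t : rank K t.+1 = rank K t + K t.+1.
Proof. by rewrite /rank iotaSr count_cat /= addn0 add1n. Qed.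

(** The position of a kept element among the kept elements counts those up to
    it. *)
Lemma rank_nth K A x : x < rank K A ->
  let t := nth 0 (filter K (iota 1 A)) x
    in [/\ 0 < t <= A, K t & rank K t = x.+1].
Proof.
elim: A => // A IH; rewrite rankS => xA.
have sz : size (filter K (iota 1 A)) = rank K A by rewrite size_filter.
rewrite iotaSr filter_cat nth_cat sz /= add1n.
case: (ltnP x (rank K A)) => xr.
  by have [/andP[t0 tA] Kt rt] := IH xr; split=> //; rewrite t0 /=; lia.
have KA : K A.+1 by case: (K _) xA => //; lia.
have xE : x = rank K A by lia.
by rewrite KA xE subnn /= leqnn rankS KA addn1.
Qed.

Section Shuffle.
Variables (i k : nat) (c : nat -> option bool).
Hypothesis i0 : 0 < i.

(** The blow-up of i and i + 1 in k + 1 points each consists of the pairs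
    (i + q, i + k + 1 + q); [c q] tells which element of the q-th pair, if
    any, is left out. *)
Definition rem_at t : bool :=
  (i <= t <= i + k) && (c (t - i) == Some false) ||
  (i + k < t <= i + 2 * k + 1) && (c (t - (i + k).+1) == Some true).

Definition keep t := ~~ rem_at t.

Definition nkeep e q := \sum_(0 <= q' < q) (c q' != Some e).

Lemma nkeepS e q : nkeep e q.+1 = nkeep e q + (c q != Some e).
Proof. by rewrite /nkeep big_nat_recr. Qed.

Lemma keep0 q : q <= k -> keep (i + q) = (c q != Some false).
Proof.
move=> qk; rewrite /keep /rem_at leq_addr leq_add2l qk addKn /=.
by rewrite ltnNge leq_add2l qk /= orbF.
Qed.

Lemma keep1 q : q <= k -> keep ((i + k).+1 + q) = (c q != Some true).
Proof.
move=> qk; rewrite /keep /rem_at addKn.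
rewrite (_ : _ <= i + k = false) ?andbF /=; last by lia.
by rewrite (_ : _ < _ <= _ = true) //; lia.
Qed.

Lemma keep_out t : t < i \/ i + 2 * k + 1 < t -> keep t.
Proof. by move=> H; rewrite /keep /rem_at; lia. Qed.

Lemma rank_low t : t < i -> rank keep t = t.
Proof.
elim: t => // t IH ti; rewrite rankS IH ?keep_out ?addn1 //; lia.
Qed.

(** The next lemmas compute positions in the two orders of the points that
    remain: the one with the two fibres of phi one after the other, and the
    shuffled one, where the elements of a pair follow each other. *)
Lemma rank_first q : q <= k.+1 -> rank keep (i.-1 + q) = i.-1 + nkeep false q.
Proof.
elim: q => [|q IH] qk; first by rewrite /nkeep big_geq // addn0 rank_low //;
  lia.
rewrite addnS rankS IH ?(ltnW qk) // nkeepS addnA; congr addn.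
by rewrite -addSn prednK // keep0.
Qed.

Lemma rank_second q : q <= k.+1 ->
  rank keep (i + k + q) = i.-1 + nkeep false k.+1 + nkeep true q.
Proof.
elim: q => [|q IH] qk.
  by rewrite {2}/nkeep big_geq // !addn0 -rank_first //; congr rank; lia.
rewrite addnS rankS IH ?(ltnW qk) // (nkeepS true) addnA; congr addn.
by rewrite -addSn keep1.
Qed.

Lemma rank_high t :
  rank keep (i + 2 * k + 1 + t) = i.-1 + nkeep false k.+1 + nkeep true k.+1 + t.
Proof.
elim: t => [|t IH]; first by rewrite -rank_second // !addn0; congr rank; lia.
by rewrite addnS rankS IH keep_out ?addn1 ?addnS //; lia.
Qed.

Definition unshuffle y :=
  if i <= y <= i + 2 * k + 1 then
    if odd (y - i) then (i + k).+1 + (y - i)./2 else i + (y - i)./2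
  else y.

Lemma shuffleK : cancel (shuffle i k) unshuffle.
Proof.
move=> x; rewrite /shuffle; case: ifP => [xi|xi].
  rewrite /unshuffle addKn mul2n odd_double doubleK ifT; lia.
case: ifP => [xk|xk].
  rewrite /unshuffle -addnA addKn addn1 mul2n /= odd_double /=
    uphalf_double ifT; lia.
by rewrite /unshuffle ifF //; lia.
Qed.

Lemma unshuffleK : cancel unshuffle (shuffle i k).
Proof.
move=> y; rewrite /unshuffle; case: ifP => [yi|yi]; last first.
  by rewrite /shuffle !ifF //; lia.
have := odd_double_half (y - i); case: odd => /= E; rewrite /shuffle.
  by rewrite ifF ?ifT; lia.
by rewrite ifT; lia.
Qed.

Lemma shuffle_range A x : i + 2 * k + 1 <= A ->
    (0 < shuffle i k x <= A) = (0 < x <= A).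
Proof. by move=> iA; rewrite /shuffle; repeat (case: ifP => ?); lia. Qed.

(** [keep] in the shuffled order. *)
Definition keep' y := keep (unshuffle y).

Lemma keep'_first q : q <= k -> keep' (i + 2 * q) = (c q != Some false).
Proof.
move=> qk; rewrite /keep' -keep0 //; congr keep.
by rewrite /unshuffle ifT ?addKn ?mul2n ?odd_double ?doubleK //; lia.
Qed.

Lemma keep'_second q : q <= k -> keep' (i + 2 * q + 1) = (c q != Some true).
Proof.
move=> qk; rewrite /keep' -keep1 //; congr keep.
rewrite /unshuffle ifT; last by lia.
by rewrite -addnA addKn addn1 mul2n /= odd_double /= uphalf_double.
Qed.

Lemma keep'_out y : y < i \/ i + 2 * k + 1 < y -> keep' y.
Proof. by move=> H; rewrite /keep' /unshuffle ifF ?keep_out //; lia. Qed.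

Lemma rank'_low y : y < i -> rank keep' y = y.
Proof.
elim: y => // t IH ti; rewrite rankS IH ?keep'_out ?addn1 //; lia.
Qed.

Lemma rank'_pair q : q <= k.+1 ->
  rank keep' (i.-1 + 2 * q) = i.-1 + nkeep false q + nkeep true q.
Proof.
elim: q => [|q IH] qk.
  by rewrite /nkeep !big_geq // !addn0 rank'_low //; lia.
rewrite (_ : i.-1 + 2 * q.+1 = (i.-1 + 2 * q).+2); last by lia.
rewrite !rankS IH ?(ltnW qk) // !nkeepS.
rewrite (_ : (i.-1 + 2 * q).+2 = i + 2 * q + 1); last by lia.
rewrite (_ : (i.-1 + 2 * q).+1 = i + 2 * q); last by lia.
rewrite keep'_first // keep'_second //.
by move: (c q != _) (c q != _) => [] []; lia.
Qed.

Lemma rank'_high t :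
  rank keep' (i + 2 * k + 1 + t) =
    i.-1 + nkeep false k.+1 + nkeep true k.+1 + t.
Proof.
elim: t => [|t IH]; first by rewrite -rank'_pair // !addn0; congr rank; lia.
by rewrite addnS rankS IH keep'_out ?addn1 ?addnS //; lia.
Qed.

Lemma rank_mono (K : pred nat) y z : y <= z -> rank K y <= rank K z.
Proof.
by move=> /subnK <-; rewrite addnC /rank iotaD count_cat leq_addr.
Qed.

Lemma rank_lt (K : pred nat) y z : y < z -> K z -> rank K y < rank K z.
Proof. by case: z => // z yz Kz; rewrite rankS Kz addn1 ltnS rank_mono. Qed.

(** The map f, read in the shuffled order. *)
Definition collapse y :=
  if y < i then y else
  if y <= i + 2 * k + 1 then i + (y - i)./2 else y - k.+1.

(** The list v_1 < ... < v_r, cut after j pairs for the sake of induction. *)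
Definition vmerge j := [seq v <- iota i j | c (v - i) == None].

(** After the pairs up to the j-th one have been merged, the points that lie
    in them are where they belong, and the others are shifted by the number of
    points lost so far.  Merging at i + j is right for the next pair because
    the earlier ones have become single points, and it has to be skipped when
    one of the two points has been left out. *)
Lemma fold_merge j y : j <= k.+1 -> 0 < y -> keep' y ->
  foldl (fun z v => smap v 1 z) (rank keep' y) (vmerge j) =
  if y < i + 2 * j then collapse y
  else i.-1 + j + (rank keep' y - rank keep' (i.-1 + 2 * j)).
Proof.
move=> jk y0 Ky; elim: j jk => [|j IH] jk.
  rewrite muln0 !addn0 /= /collapse; case: (ltnP y i) => yi; first
    by rewrite rank'_low.
  have iy : i.-1 <= y by lia.
  have := rank_mono keep' iy; rewrite [rank _ i.-1]rank'_low; lia.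
rewrite /vmerge iotaSr filter_cat foldl_cat -/(vmerge j) IH ?(ltnW jk) //.
rewrite /= addKn.
have jk' : j <= k by [].
have K0 := keep'_first jk'; have K1 := keep'_second jk'.
have R0 := rank'_pair (ltnW jk); have R1 := rank'_pair jk.
rewrite !nkeepS in R1.
case: (ltnP y (i + 2 * j)) => yj.
  have -> : y < i + 2 * j.+1 by lia.
  have : collapse y < i + j by rewrite /collapse; repeat (case: ifP => ?); lia.
  by case: (c j == None) => //= ?; cases_lia.
have [yj1|yj1] := ltnP y (i + 2 * j + 2); last first.
  have -> : (y < i + 2 * j.+1) = false by lia.
  have : rank keep' (i.-1 + 2 * j.+1) < rank keep' y by apply: rank_lt => //;
    lia.
  move: R0 R1; set r := rank _ y; set r1 := rank _ _; set r0 := rank _ _.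
  by case: (c j) => [[]|] /= ? ? ?; rewrite /smap; repeat (case: ifP => ?); lia.
have -> : y < i + 2 * j.+1 by lia.
(* y is one of the two elements of the pair that is being merged *)
have ry : rank keep' (i + 2 * j) = rank keep' (i.-1 + 2 * j) +
  (c j != Some false).
  by rewrite (_ : i + 2 * j = (i.-1 + 2 * j).+1) ?rankS -?K0;
    [congr (_ + keep' _)|]; lia.
have ry1 : rank keep' (i + 2 * j + 1) = rank keep' (i + 2 * j) +
  (c j != Some true).
  by rewrite addn1 rankS -K1 addn1.
move: ry ry1; set r0 := rank keep' (i.-1 + 2 * j).
have cy : collapse y = i + j by rewrite /collapse; repeat (case: ifP => ?); lia.
have [yE|yE] : y = i + 2 * j \/ y = i + 2 * j + 1 by lia.
  rewrite cy -yE; move: Ky; rewrite yE K0 => Ky.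
  by case: (c j) Ky => [[]|] //= _; rewrite /smap; repeat (case: ifP => ?); lia.
rewrite cy -yE; move: Ky; rewrite yE K1 => Ky.
by case: (c j) Ky => [[]|] //= _; rewrite /smap; repeat (case: ifP => ?); lia.
Qed.

Lemma fold_merge_all y : 0 < y -> keep' y ->
  foldl (fun z v => smap v 1 z) (rank keep' y) (vmerge k.+1) = collapse y.
Proof.
move=> y0 Ky; rewrite fold_merge //; case: ifP => // yk.
have [t tE] : exists t, y = i + 2 * k + 1 + t by exists (y - (i + 2 * k + 1));
  lia.
rewrite rank'_pair // tE rank'_high /collapse !ifF; lia.
Qed.

Lemma size_vmerge j : nkeep false j + nkeep true j = j + size (vmerge j).
Proof.
elim: j => [|j IH]; first by rewrite /nkeep !big_geq.
rewrite !nkeepS /vmerge iotaSr filter_cat size_cat -/(vmerge j) /= addKn.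
by case: (c j) => [[]|] /=; lia.
Qed.

Lemma perm_shuffle A : i + 2 * k + 1 <= A ->
  perm_eq (iota 1 A) (map (shuffle i k) (iota 1 A)).
Proof.
move=> iA; apply: uniq_perm; first exact: iota_uniq.
  by rewrite map_inj_uniq ?iota_uniq //; apply: can_inj shuffleK.
move=> y; rewrite mem_iota add1n ltnS; apply/idP/mapP => [yA|[x]].
  exists (unshuffle y); last by rewrite unshuffleK.
  by rewrite mem_iota add1n ltnS -(shuffle_range _ iA) unshuffleK.
by rewrite mem_iota add1n ltnS -(shuffle_range _ iA) => xA ->.
Qed.

Lemma rank_shuffle A y : i + 2 * k + 1 <= A -> y <= A ->
  count (fun t => shuffle i k t <= y) (filter keep (iota 1 A)) = rank keep' y.
Proof.
move=> iA yA; rewrite count_filter.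
rewrite (eq_count (a2 := preim (shuffle i k) (predI (leq^~ y) keep')));
  last first.
  by move=> t /=; rewrite /keep' shuffleK.
rewrite -count_map -(seq.permP (perm_shuffle iA)) -(subnKC yA) iotaD count_cat.
rewrite [X in _ + X](_ : _ = 0) ?addn0; last first.
  apply/eqP; rewrite -leqn0 leqNgt -has_count -all_predC; apply/allP => t.
  by rewrite mem_iota /= => /andP[yt _]; rewrite leqNgt (_ : y < t).
apply: eq_in_count => t; rewrite mem_iota add1n ltnS => /andP[_ ty] /=.
by rewrite ty.
Qed.

(** Reindexing the two-line notation after removal of columns sends a position
    in the first order to the position of the same point in the shuffled one. *)
Lemma remove_columns_rank A R x : i + 2 * k + 1 <= A ->
  (forall t, (t \in R) = rem_at t) -> x < rank keep A ->
  remove_columns A (shuffle i k) R x.+1 =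
  rank keep' (shuffle i k (nth 0 (filter keep (iota 1 A)) x)).
Proof.
move=> iA RE xA; rewrite /remove_columns.
rewrite (eq_filter (a2 := keep)); last by move=> t; rewrite /keep -RE.
rewrite (nth_map 0) ?size_filter // count_map.
have [tA _ _] := rank_nth xA; apply: rank_shuffle => //.
by move: tA; rewrite -(shuffle_range _ iA) => /andP[].
Qed.

End Shuffle.

(** * The summands of the fifth relation *)

Section DoubleFibre.
Variable P : operad.

(** [hlab] for the blow-up of both i and i + 1. *)
Definition dlab i p0 (w0 : P p0) p1 (w1 : P p1) (c : nat) : lop P nat :=
  if c < i then lone P c else
  if c == i then Lop (fun q : 'I_p0 => i + q) w0 else
  if c == i.+1 then Lop (fun q : 'I_p1 => i + p0 + q) w1
  else lone P (c + p0.-1 + p1.-1).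

Lemma pos_comp n m l (G : smor P m l) (F : smor P n m)
    (zG zF : nat -> lop P nat) :
  (forall c, lmap (@pos m) (lab G c) ~~ zG (pos c)) ->
  (forall c, lmap (@pos n) (lab F c) ~~ zF (pos c)) ->
  forall c, lmap (@pos n) (lab (scomp G F) c) ~~ lbind (zG (pos c)) zF.
Proof.
move=> GE FE c; apply: lequiv_trans (lequiv_map _ (lab_comp G F c)) _.
apply: (fun H => lequiv_trans H (lbind_equivl _ (GE c))).
rewrite -[X in X ~~ _]/(lbind (lab G c) (fun d => lmap (@pos n) (lab F d))).
rewrite -[X in _ ~~ X]/(lbind (lab G c) (fun d => zF (pos d))).
by apply: lbind_equivr => k; apply: FE.
Qed.

Lemma hlab_hlab i p0 (w0 : P p0) p1 (w1 : P p1) c : 0 < p0 -> 0 < p1 ->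
  lbind (hlab i.+1 w1 c) (hlab i w0) = dlab i w0 w1 c.
Proof.
move=> p00 p10; rewrite {1}/hlab /dlab.
case: (ltngtP c i.+1) => ci.
- rewrite lbind1 /hlab; case: ltngtP => //; lia.
- rewrite lbind1 /hlab; case: (ltngtP c i) => ci'; try lia.
  by rewrite !ifF; [congr lone; lia|lia|lia].
- subst c; rewrite ltnNge leqnSn /= (_ : (i.+1 == i) = false) ?eqxx; last
  by lia.
  rewrite -[RHS]/(lmap (fun t => t) (Lop (fun q : 'I_p1 => i + p0 + q) w1)).
  pose h t := t + p0.-1.
  have -> : lmap (fun t => t) (Lop (fun q : 'I_p1 => i + p0 + q) w1) =
            lmap h (Lop (fun q : 'I_p1 => i.+1 + q) w1).
    by congr Lop; apply: functional_extensionality => q /=; rewrite /h; lia.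
  rewrite -lbind_one; congr lcomp; apply: functional_extensionality => q /=.
  by rewrite /hlab !ifF //; lia.
Qed.

(** f folds the two blown up blocks onto each other, which makes the square of
    the fifth relation commute. *)
Lemma merge_dlab i k (w : P k.+1) c : 0 < i ->
  lmap (fun x => if x <= i + k then x else x - k.+1) (dlab i w w c) =
  hlab i w (smap i 1 c).
Proof.
move=> i0; rewrite /dlab /hlab; have := ltnP.
have s1 : c < i -> smap i 1 c = c by cases_lia.
have s2 : smap i 1 i = i by cases_lia.
have s3 : smap i 1 i.+1 = i by cases_lia.
case: (ltngtP c i) => ci _.
- rewrite s1 // ci lmap_one ifT //; lia.
- case: eqVneq => [->|ci'].
    rewrite s3 ltnn eqxx; congr Lop; apply: functional_extensionality => q /=.
    by rewrite ifF; lia.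
  have -> : smap i 1 c = c.-1 by cases_lia.
  by rewrite lmap_one !ifF; [congr lone; lia|lia|lia|lia].
- subst c; rewrite s2 ltnn eqxx; congr Lop; apply:
  functional_extensionality => q /=.
  by rewrite ifT //; have /= := ltn_ord q; lia.
Qed.

End DoubleFibre.

Section Gamma.
Variable P : unitary_operad.

Definition gkeep k (alpha : P k.+1) (K : 'I_k.+1 -> bool) : P (\sum_l K l) :=
  op_comp alpha (fun l => op_bool P (K l)).

(** Inserting 1 and 0 in the inputs of alpha: the labels of the inputs with
    a 1 are renumbered consecutively. *)
Lemma lcomp_keep k (alpha : P k.+1) (c : nat -> option bool) e b
    (r : nat -> nat)
    (H : 'I_k.+1 -> lop P nat) :
  (forall q : 'I_k.+1, H q = if c q != Some e then lone P (r q)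
    else lzero P nat) ->
  (forall q : 'I_k.+1, c q != Some e -> r q = b + nkeep c e q) ->
  lcomp alpha H = Lop (fun q => b + q) (gkeep alpha (fun q => c q != Some e)).
Proof.
move=> HE rE.
have -> : H = fun q => Lop (fun _ : 'I_(c q != Some e) => r q)
  (op_bool P (c q != Some e)).
  apply: functional_extensionality => q; rewrite HE.
  case: (c q != Some e) => /=; first by [].
  by rewrite [RHS]lop_arity0.
apply: lop_eq => //= q q' qq'.
pose m (q : 'I_k.+1) : nat := c q != Some e.
have qE := @tagnat.rect k.+1 m q; have := ltn_ord (@tagnat.sig2 _ m q).
rewrite -qq' [in RHS]qE {qq' q'}; move: (nat_of_ord (tagnat.sig2 q)) => s.
rewrite -/m; set t := tagnat.sig1 q; rewrite /m.
case ct: (c t != Some e) => // s1.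
have -> : s = 0 by case: s s1 {qE}.
rewrite rE // addn0 /nkeep; congr addn.
rewrite big_mkord (big_ord_widen k.+1 (fun q => nat_of_bool (c q != Some e)))
  //.
exact: ltnW.
Qed.

End Gamma.

Lemma enum_removal (K : pred nat) A N : N = rank K A ->
  exists (h : 'I_N -> 'I_A) (hi : injective h),
    [/\ forall x, pos (h x) = nth 0 (filter K (iota 1 A)) x,
        forall x, rank K (pos (h x)) = pos x,
        forall x, K (pos (h x)) &
        forall a, K (pos a) -> exists x, h x = a].
Proof.
move=> NE; pose L := filter K (iota 1 A).
have xr (x : 'I_N) : x < rank K A by rewrite -NE.
have hA (x : 'I_N) : (nth 0 L x).-1 < A.
  by have [/andP[/prednK ->]] := rank_nth (xr x).
pose h x := Ordinal (hA x).
have hE x : pos (h x) = nth 0 L x.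
  by have [/andP[t0 _] _ _] := rank_nth (xr x); rewrite /pos /= prednK.
have hr x : rank K (pos (h x)) = pos x.
  by rewrite hE; have [_ _ ->] := rank_nth (xr x).
have hi : injective h by move=> x y E; apply: pos_inj; rewrite -!hr E.
exists h, hi; split=> // [x|a Ka]; first by rewrite hE; have [] :=
  rank_nth (xr x).
have aL : pos a \in L by rewrite mem_filter Ka mem_iota add1n ltnS /= ltn_ord.
have iN : index (pos a) L < N.
  by rewrite NE /rank -size_filter index_mem.
by exists (Ordinal iN); apply: pos_inj; rewrite hE /= nth_index.
Qed.

Section Summand.
Variables (P : unitary_operad) (M : janus P).
Hypothesis iso : iso_law M.
Local Open Scope ring_scope.

Lemma Pops_low vs a b : all (fun v => 0 < v <= b)%N vs -> a = (b + size vs)%N ->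
  exists h : 'I_a -> 'I_b, [/\ is_surj h,
    forall y, pos (h y) = foldl (fun z v => smap v 1 z) (pos y) vs &
    forall x, Pops M vs a b x = low h x].
Proof.
elim: vs a => [|v vs IH] a /=.
  move=> _; rewrite addn0 => ->; exists id; have ids := is_surj_id b.
  by split=> // x; apply: lowf_low.
case/andP=> /andP[v0 vb] vsb ab.
have [||g gs gE] := @merge_exists a a.-1 v; [lia|by []|].
have [|h [hs hE hP]] := IH a.-1 vsb; first by rewrite ab addnS.
exists (fun y => h (g y)); split=> [|y|x].
- exact: is_surj_comp.
- by rewrite hE gE.
- by rewrite hP (Pop_low _ gs gE) (low_comp h _ gs).
Qed.

Lemma lowf_sum a b (h : nat -> nat) I (r : seq I) (Q : pred I) E :
  lowf M a b h (\sum_(j <- r | Q j) E j) = \sum_(j <- r | Q j) lowf M a b h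
    (E j).
Proof. by rewrite /lowf; case: natsurj => [s|];
  [apply: raddf_sum|rewrite big1]. Qed.

Lemma Pops_sum vs a b I (r : seq I) (Q : pred I) E :
  Pops M vs a b (\sum_(j <- r | Q j) E j) = \sum_(j <- r | Q j) Pops M vs a b
    (E j).
Proof.
elim: vs a E => [|v vs IH] a E /=; first exact: lowf_sum.
by rewrite /Pop lowf_sum IH.
Qed.

Variables (n i k : nat) (alpha : P k.+1).
Hypothesis i_n : (0 < i < n)%N.

Variables (f : 'I_(n + 2 * k) -> 'I_(n + k).-1) (phi : smor P (n + 2 * k) n).
Hypothesis fE : forall a, pos (f a) = if (pos a <= i + k)%N then pos a
    else (pos a - k.+1)%N.
Hypothesis phil : forall c, lmap (@pos _) (lab phi c) ~~ dlab i alpha alpha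
    (pos c).

Definition kept_set (c : nat -> option bool) : {set 'I_(n + 2 * k)} :=
  [set a | keep i k c (pos a)].

Lemma collapse_shuffle a : collapse i k (shuffle i k (pos a)) = pos (f a).
Proof.
rewrite fE /shuffle; case: ifP => h1; [|case: ifP => h2];
  rewrite /collapse; repeat (case: ifP => ?); lia.
Qed.

Section OneTerm.
Variables (c : nat -> option bool).
Variables (p0 p1 : nat) (w0 : P p0) (w1 : P p1) (m N : nat).
Variables (sf : nat -> nat).
Hypothesis w0E : Tagged P w0 = Tagged P
    (gkeep alpha (fun q => c q != Some false)).
Hypothesis w1E : Tagged P w1 = Tagged P
    (gkeep alpha (fun q => c q != Some true)).
Hypothesis p00 : (0 < p0)%N.
Hypothesis p10 : (0 < p1)%N.
Hypothesis mE : m = (n + p1.-1)%N.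
Hypothesis NE : N = (m + p0.-1)%N.

Lemma p0E : p0 = nkeep c false k.+1.
Proof. by have /= -> := congr1 tag w0E; rewrite /nkeep big_mkord. Qed.

Lemma p1E : p1 = nkeep c true k.+1.
Proof. by have /= -> := congr1 tag w1E; rewrite /nkeep big_mkord. Qed.

Lemma rank_all : N = rank (keep i k c) (n + 2 * k).
Proof.
have [d dE] : exists d, (n + 2 * k = i + 2 * k + 1 + d)%N.
  by exists (n - i.+1)%N; lia.
by rewrite dE rank_high -?p0E -?p1E; lia.
Qed.

(** The restriction of phi to the points that remain is again a composite of
    two blow-ups, whose operations are obtained by deleting inputs of alpha. *)
Lemma restricted_phi (h : 'I_N -> 'I_(n + 2 * k)) (hi : injective h)
    (G1 : smor P m n) (G0 : smor P N m) :
  (forall x, rank (keep i k c) (pos (h x)) = pos x) ->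
  (forall x, keep i k c (pos (h x))) ->
  (forall a, keep i k c (pos a) -> exists x, h x = a) ->
  (forall d, lmap (@pos _) (lab G1 d) ~~ hlab i.+1 w1 (pos d)) ->
  (forall d, lmap (@pos _) (lab G0 d) ~~ hlab i w0 (pos d)) ->
  scomp G1 G0 = scomp phi (smor_inj P hi).
Proof.
move=> hr hk hex G1l G0l; apply: smor_ext => d; apply:
  (lequiv_map_inj (@pos_inj N)).
(* the labels of the enumeration of the points that remain *)
pose lh t := if keep i k c t then lone P (rank (keep i k c) t) else lzero P nat.
have hl a : lmap (@pos N) (lab (smor_inj P hi) a) ~~ lh (pos a).
  rewrite /lh; case: (smor_injP P hi a) => [x ->|ah].
    by rewrite hk hr; apply: lequiv_refl.
  case: ifP => [/hex[x xa]|_]; first by case/eqP: (ah x).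
  by rewrite [lmap _ _]lop_arity0 //; apply: lequiv_refl.
apply: lequiv_trans (pos_comp G1l G0l d) _.
apply: lequiv_trans _ (lequiv_sym (pos_comp phil hl d)).
rewrite hlab_hlab //.
suff -> : lbind (dlab i alpha alpha (pos d)) lh = dlab i w0 w1 (pos d).
  exact: lequiv_refl.
have dn : (pos d <= n)%N by apply: ltn_ord.
move: (pos d) dn (isT : (0 < pos d)%N) => t tn t0.
have i0 : (0 < i)%N by lia.
rewrite /dlab; case: (ltngtP t i) => ti.
- rewrite lbind1 /lh keep_out ?rank_low //; lia.
- have [_|ti'] := eqVneq t i.+1.
    rewrite /lbind (@lcomp_keep P k alpha c true (i + p0)%N
      (fun q => rank (keep i k c) (i + k.+1 + q))).
    + by apply: lop_eq => [|u v /= ->] //; rewrite w1E.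
    + by move=> q /=; rewrite /lh addnS keep1 // leq_ord.
    + move=> q cq; rewrite -addnA addSnnS addnA rank_second ?ltn_ord //.
      by rewrite (nkeepS c true) cq p0E; lia.
  rewrite lbind1 /lh (_ : (t + _ + _ = i + 2 * k + 1 + (t - i.+1))%N); last
    by lia.
  rewrite rank_high // -p0E -p1E keep_out //; last by lia.
  by congr lone; lia.
- subst t; rewrite /lbind (@lcomp_keep P k alpha c false (i)%N
      (fun q => rank (keep i k c) (i + q))).
  + by apply: lop_eq => [|u v /= ->] //; rewrite w0E.
  + by move=> q /=; rewrite /lh keep0 // leq_ord.
  + move=> q cq; rewrite (_ : (i + q = i.-1 + q.+1)%N); last by lia.
    by rewrite rank_first ?ltn_ord // nkeepS cq; lia.
Qed.

(** The generators in a summand of the fifth relation compose to the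
    restrictions of f and phi.  The operations and the permutation are
    specified by their properties so that the first summand, where nothing is
    left out and alpha appears instead of its composite with identities, is
    also an instance. *)
Lemma summandE x :
  (forall y, (y < N)%N -> sf y.+1 =
     rank (keep' i k c) (shuffle i k
       (nth 0%N (filter (keep i k c) (iota 1 (n + 2 * k))) y))) ->
  Pops M (vmerge i c k.+1) N (n + k).-1
    (lowf M N N sf (Hop M N m i w0 (Hop M m n i.+1 w1 x))) =
  adm_term f phi (@enum_val_inj _ (mem (kept_set c))) x.
Proof.
move=> sfE; have i0 : (0 < i)%N by lia.
have [h [hi [hE hr hk hex]]] := enum_removal rank_all.
have [|||G1 G1s G1l] := @hlab_exists P m n i.+1 _ w1; try lia.
have [|||G0 G0s G0l] := @hlab_exists P N m i _ w0; try lia.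
rewrite (Hop_up _ _ _ _ G1l) ?(Hop_up _ _ _ _ G0l) //; try lia.
rewrite -up_comp // (restricted_phi hi hr hk hex G1l G0l).
have vs_bound : all (fun v => 0 < v <= (n + k).-1)%N (vmerge i c k.+1).
  by apply/allP => v; rewrite mem_filter mem_iota => /andP[_]; lia.
have vs_size : N = ((n + k).-1 + size (vmerge i c k.+1))%N.
  have := size_vmerge c i0 k.+1; rewrite -p0E -p1E; lia.
have [g [gs gE ->]] := Pops_low vs_bound vs_size.
pose s y := shuffle i k (pos (h y)).
have s_range y : (0 < s y <= n + 2 * k)%N.
  by rewrite shuffle_range ?ltn_ord //; lia.
have s_kept y : keep' i k c (s y) by rewrite /keep' shuffleK.
have sf_s (y : 'I_N) : sf (pos y) = rank (keep' i k c) (s y).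
  by rewrite sfE ?ltn_ord // /s hE.
have rank'N : rank (keep' i k c) (n + 2 * k) = N.
  rewrite rank_all; have [d ->] : exists d, (n + 2 * k = i + 2 * k + 1 + d)%N.
    by exists (n - i.+1)%N; lia.
  by rewrite rank_high // rank'_high.
have sf_range (y : 'I_N) : (0 < sf (pos y) <= N)%N.
  rewrite sf_s; have /andP[s0 sA] := s_range y.
  have := rank_lt s0 (s_kept y); have := rank_mono (keep' i k c) sA.
  by rewrite rank'N; lia.
have sf_lt (y : 'I_N) : ((sf (pos y)).-1 < N)%N by have := sf_range y; lia.
pose t y := Ordinal (sf_lt y).
have tE y : pos (t y) = sf (pos y) by rewrite /pos /=; have := sf_range y;
  rewrite /pos; lia.
have ti : injective t.
  move=> y z E; have := congr1 (@pos N) E; rewrite !tE !sf_s => rE.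
  apply: hi; apply: pos_inj; apply: (can_inj (shuffleK k i0)).
  case: (ltngtP (s y) (s z)) => // lt.
    by have := rank_lt lt (s_kept z); rewrite rE ltnn.
  by have := rank_lt lt (s_kept y); rewrite rE ltnn.
have ts : is_surj t.
  by rewrite -(eq_surj (permE ti)); apply: is_surj_perm.
rewrite (lowf_low _ ts tE) -low_comp //.
rewrite (eq_low (f' := fun y => f (h y))); last first.
  move=> y; apply: pos_inj; rewrite gE tE sf_s fold_merge_all //.
    exact: collapse_shuffle.
  by have /andP[] := s_range y.
rewrite -[LHS]/(adm_term f phi hi x); apply: adm_term_eq => // a.
rewrite codom_enum_val inE; apply/codomP/idP => [[y ->] //|/hex[y <-]].
by exists y.
Qed.

End OneTerm.
End Summand.

(** * Admissible subsets as choices in the pairs *)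

Section Choices.
Variable k : nat.
Implicit Types (c : {ffun 'I_k.+1 -> option bool}).

(** A function with values in [option bool] encodes a set of pairs together
    with one element of each. *)
Definition choice b (u : b.-tuple 'I_k.+1) (eps : b.-tuple bool) :
    {ffun 'I_k.+1 -> option bool} :=
  [ffun q => if [pick j | tnth u j == q] is Some j then Some (tnth eps j)
    else None].

Section OneChoice.
Variables (b : nat) (u : b.-tuple 'I_k.+1) (eps : b.-tuple bool).
Hypothesis us : sorted ltn [seq val l | l <- u].

Lemma tnth_sorted_inj : injective (tnth u).
Proof.
apply/tuple_uniqP; rewrite -(map_inj_uniq val_inj).
by apply: sorted_uniq us; [exact: ltn_trans|exact: ltnn].
Qed.

Lemma choice_tnth j : choice u eps (tnth u j) = Some (tnth eps j).
Proof.
rewrite ffunE; case: pickP => [j' /eqP/tnth_sorted_inj -> //|/(_ j)].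
by rewrite eqxx.
Qed.

Lemma choice_some q e :
  reflect (exists2 j, tnth u j = q & tnth eps j = e) (choice u eps q == Some e).
Proof.
apply: (iffP eqP) => [|[j <- <-]]; last exact: choice_tnth.
by rewrite ffunE; case: pickP => // j /eqP uj [<-]; exists j.
Qed.

Lemma choice_none q : (choice u eps q == None) = (q \notin u).
Proof.
rewrite ffunE; case: pickP => [j /eqP <-|uq]; first by rewrite mem_tnth.
by apply/esym/negP => /tnthP[j qj]; move: (uq j); rewrite qj eqxx.
Qed.

Lemma sum_choice (F : option bool -> nat) : F None = 0 ->
  \sum_q F (choice u eps q) = \sum_(j < b) F (Some (tnth eps j)).
Proof.
move=> F0; rewrite (bigID (mem (tnth u @: setT))) /= addnC big1 ?add0n =>
  [|q qu].
  rewrite big_imset /=; last by move=> j j' _ _; apply: tnth_sorted_inj.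
  by apply: eq_big => [j|j _]; rewrite ?inE // choice_tnth.
have /eqP -> // : choice u eps q == None.
rewrite choice_none; apply: contra qu => /tnthP[j ->]; exact: imset_f.
Qed.

End OneChoice.

Definition supp c := [set q | c q != None].

Definition supp_tuple b c : b.-tuple 'I_k.+1 :=
    [tuple nth ord0 (enum (supp c)) j | j < b].
Definition eps_tuple b c : b.-tuple bool :=
    [tuple c (nth ord0 (enum (supp c)) j) == Some true | j < b].

Lemma supp_tupleE b c : #|supp c| = b ->
    supp_tuple b c = enum (supp c) :> seq _.
Proof.
move=> sb; apply: (@eq_from_nth _ ord0); first by rewrite size_tuple -cardE.
move=> j; rewrite size_tuple => jb.
by rewrite -[j]/(nat_of_ord (Ordinal jb)) -tnth_nth tnth_mktuple.
Qed.

Lemma enum_sorted (A : {set 'I_k.+1}) : sorted ltn [seq val l | l <- enum A].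
Proof.
rewrite /enum_mem sorted_map; apply: sorted_filter.
  by move=> ? ? ?; apply: ltn_trans.
by have := iota_ltn_sorted 0 k.+1; rewrite -val_enum_ord sorted_map enumT.
Qed.

Lemma choiceK b c : #|supp c| = b ->
    choice (supp_tuple b c) (eps_tuple b c) = c.
Proof.
move=> sb; have us : sorted ltn [seq val l | l <- supp_tuple b c].
  by rewrite supp_tupleE ?enum_sorted.
apply/ffunP => q; have [qs|qs] := boolP (q \in supp_tuple b c).
  have /tnthP[j qj] := qs; move: qs.
  rewrite memtE (supp_tupleE sb) mem_enum inE qj choice_tnth // !tnth_mktuple.
  by case: (c _) => [[]|].
have /eqP -> : choice (supp_tuple b c) (eps_tuple b c) q == None
  by rewrite choice_none.
by apply/esym/eqP; move: qs; rewrite memtE (supp_tupleE sb) mem_enum inE negbK.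
Qed.

Lemma supp_choice b (u : b.-tuple 'I_k.+1) (eps : b.-tuple bool) :
  sorted ltn [seq val l | l <- u] -> enum (supp (choice u eps)) = u.
Proof.
move=> us; apply: (inj_map val_inj); apply:
  (irr_sorted_eq ltn_trans ltnn) => //.
  exact: enum_sorted.
move=> t; apply/mapP/mapP => [[q]|[q]].
  by rewrite mem_enum inE choice_none negbK; exists q.
by exists q => //; rewrite mem_enum inE choice_none negbK.
Qed.

Lemma supp_tuple_choice b (u : b.-tuple 'I_k.+1) (eps : b.-tuple bool) :
  sorted ltn [seq val l | l <- u] ->
  #|supp (choice u eps)| = b /\
  (supp_tuple b (choice u eps), eps_tuple b (choice u eps)) = (u, eps).
Proof.
move=> us; have E := supp_choice eps us.
split; first by rewrite cardE E size_tuple.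
congr pair; apply: eq_from_tnth => j; rewrite tnth_mktuple E -tnth_nth //.
by rewrite choice_tnth //; case: (tnth eps j).
Qed.

(** A choice is determined by its support, which u lists in increasing order,
    and by its values there, which eps lists. *)
Lemma sum_choices (V : zmodType) (T : {ffun 'I_k.+1 -> option bool} -> V) :
  (\sum_c T c = T [ffun=> None] +
   \sum_(1 <= b < k.+2)
     \sum_(u : b.-tuple 'I_k.+1 | sorted ltn [seq val l | l <- u])
       \sum_(eps : b.-tuple bool) T (choice u eps))%R.
Proof.
rewrite (bigD1 [ffun=> None]) //=; congr (_ + _)%R.
transitivity (\sum_(1 <= b < k.+2) \sum_(c | #|supp c| == b) T c)%R; last first.
  apply: eq_big_nat => b _; rewrite pair_big_dep /=.
  rewrite (reindex_onto (fun ue : b.-tuple 'I_k.+1 * b.-tuple bool =>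
    choice ue.1 ue.2)
                        (fun c => (supp_tuple b c, eps_tuple b c))) /=;
                          last first.
    by move=> c /eqP; apply: choiceK.
  apply: eq_bigl => -[u eps] /=; rewrite andbT;
    apply/andP/idP => [[sb /eqP[uE _]]|us].
    by rewrite -uE supp_tupleE ?enum_sorted //; apply/eqP.
  by have [-> ->] := supp_tuple_choice eps us; rewrite !eqxx.
transitivity (\sum_(1 <= b < k.+2) \sum_c
  (if #|supp c| == b then T c else 0))%R; last first.
  by apply: eq_bigr => b _; rewrite [RHS]big_mkcond.
rewrite exchange_big /= [LHS]big_mkcond; apply: eq_bigr => c _.
case: eqP => [->|cn] /=.
  rewrite big_nat big1 // => b b1; case: eqP => // sb.
  by move: b1; rewrite -sb (_ : supp _ = set0) ?cards0 //; apply/setP => q;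
    rewrite !inE ffunE.
have sc : #|supp c| \in index_iota 1 k.+2.
  rewrite mem_index_iota ltnS; apply/andP; split.
    rewrite card_gt0; apply: contra_notN cn => /eqP/setP cs; apply/ffunP => q.
    by have := cs q; rewrite !inE ffunE => /negbFE/eqP.
  by have := max_card (mem (supp c)); rewrite card_ord.
rewrite (bigD1_seq _ sc) ?iota_uniq //= eqxx big1 ?addr0 // => b;
  by rewrite eq_sym => /negbTE ->.
Qed.

End Choices.

(** The arithmetic of positions is done on naturals. *)
Definition on_nat k (c : {ffun 'I_k.+1 -> option bool}) (q : nat) :
    option bool :=
  if insub q is Some q' then c q' else None.

Lemma on_natE k (c : {ffun 'I_k.+1 -> option bool}) (q : 'I_k.+1) :
    on_nat c q = c q.
Proof. by rewrite /on_nat valK. Qed.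

Section Translation.
Variables (i k b : nat) (u : b.-tuple 'I_k.+1) (eps : b.-tuple bool).
Hypothesis us : sorted ltn [seq val l | l <- u].
Let c := on_nat (choice u eps).

Lemma on_nat_some q e :
  reflect (exists2 j, tnth u j = q :> nat & tnth eps j = e) (c q == Some e).
Proof.
rewrite /c /on_nat; case: insubP => [q' _ qE|qk] /=.
  have {}qE : nat_of_ord q' = q := qE.
  apply: (iffP (choice_some eps us q' e)) => -[j uj ej]; exists j => //; first
    by rewrite uj.
  by apply: val_inj; rewrite /= uj qE.
by apply: ReflectF => -[j uj _]; move: qk; rewrite -uj ltn_ord.
Qed.

Lemma removed_rem_at t : (t \in removed i u eps) = rem_at i k c t.
Proof.
apply/imageP/orP => [[j _ ->]|[|]].
- rewrite /uidx; have uk := ltn_ord (tnth u j); case ej: (tnth eps j).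
    right; rewrite mul1n; apply/andP; split; first by lia.
    by apply/on_nat_some; exists j => //; lia.
  left; rewrite mul0n addn0; apply/andP; split; first by lia.
  by apply/on_nat_some; exists j => //; lia.
- by case/andP=> tk /on_nat_some[j uj ej]; exists j => //; rewrite ej /uidx uj;
  lia.
- by case/andP=> tk /on_nat_some[j uj ej]; exists j => //; rewrite ej /uidx uj;
  lia.
Qed.

Lemma vlist_vmerge : vlist i u = vmerge i c k.+1.
Proof.
apply: eq_in_filter => v; rewrite mem_iota => vk.
have vi : v - i < k.+1 by lia.
have -> : (c (v - i) == None) = (Ordinal vi \notin u).
  by rewrite -(choice_none u eps) -on_natE.
congr (~~ _); apply/imageP/tnthP => -[j]; last first.
  by move=> E; exists j => //; rewrite /uidx -E /=; lia.
by move=> _ vE; exists j; apply: val_inj; rewrite /= vE /uidx addKn.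
Qed.

Lemma kept_choice e : kept i u eps e = fun q => c q != Some e.
Proof.
apply: functional_extensionality => q; congr (~~ _).
apply/existsP/on_nat_some => -[j].
  by case/andP=> /eqP uj /eqP ej; exists j => //; move: uj; rewrite /uidx; lia.
by move=> uj ej; exists j; rewrite ej eqxx /uidx uj andbT; apply/eqP; lia.
Qed.

Lemma nkeep_eps e : nkeep c e k.+1 + \sum_j (tnth eps j == e) = k.+1.
Proof.
have := sum_choice eps us (F := fun o => (o == Some e : nat)) (erefl _).
rewrite /= => <-; rewrite /nkeep big_mkord -big_split /=.
rewrite (eq_bigr (fun=> 1)) ?sum1_card ?card_ord // => q _.
by rewrite /c on_natE; case: (_ == _).
Qed.

(** Together with [nkeep_false], this shows that the condition on eps that
    defines J states that both fibres of phi keep a point. *)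
Lemma nkeep_true : nkeep c true k.+1 + eps_sum eps = k.+1.
Proof.
rewrite -[RHS](nkeep_eps true); congr addn; apply: eq_bigr => j _.
by case: (tnth eps j).
Qed.

Lemma nkeep_false : nkeep c false k.+1 + b = k.+1 + eps_sum eps.
Proof.
rewrite -[X in _ = X + _](nkeep_eps false) -addnA; congr addn.
rewrite /eps_sum -big_split /= (eq_bigr (fun=> 1)) ?sum1_card ?card_ord // =>
  j _.
by case: (tnth eps j).
Qed.

End Translation.

Section Fifth.
Variables (P : unitary_operad) (M : janus P).
Hypothesis iso : iso_law M.
Variables (n i k : nat) (alpha : P k.+1).
Hypothesis i1 : 1 <= i.
Hypothesis i_n : i < n.
Local Open Scope ring_scope.

Lemma pos_ex A t : (0 < t <= A)%N -> exists a : 'I_A, pos a = t.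
Proof.
case: t => // t tA; by exists (Ordinal (tA : (t < A)%N)).
Qed.

(** A subset on which f is onto contains all points outside the pairs and at
    least one point of each pair. *)
Lemma adm_sum_choices (f : 'I_(n + 2 * k) -> 'I_(n + k).-1)
    (phi : smor P (n + 2 * k) n) x :
  (forall a, pos (f a) = if (pos a <= i + k)%N then pos a
    else (pos a - k.+1)%N) ->
  adm_sum f phi x =
  \sum_(c : {ffun 'I_k.+1 -> option bool})
     adm_term (M := M) f phi (@enum_val_inj _
       (mem (kept_set n i k (on_nat c)))) x.
Proof.
move=> fE.
have /fin_all_exists[left leftE] (q : 'I_k.+1) : exists a :
  'I_(n + 2 * k), pos a = (i + q)%N.
  by apply: pos_ex; have := ltn_ord q; lia.
have /fin_all_exists[right rightE] (q : 'I_k.+1) :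
    exists a : 'I_(n + 2 * k), pos a = ((i + k).+1 + q)%N.
  by apply: pos_ex; have := ltn_ord q; lia.
have leftf q : pos (f (left q)) = (i + q)%N by rewrite fE leftE; case:
  ifP => //; have := ltn_ord q; lia.
have rightf q : f (right q) = f (left q).
  by apply: pos_inj; rewrite leftf fE rightE ifF; lia.
have imf (S : {set 'I_(n + 2 * k)}) a : f @: S = setT -> exists2 a', a' \in S
  & f a' = f a.
  move=> ST; have : f a \in f @: S by rewrite ST in_setT.
  by case/imsetP=> a' aS ->; exists a'.
pose choices (S : {set 'I_(n + 2 * k)}) : {ffun 'I_k.+1 -> option bool} :=
  [ffun q => if left q \notin S then Some false
    else if right q \notin S then Some true else None].
have split_pos a : [\/ (pos a < i)%N \/ (i + 2 * k + 1 < pos a)%N,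
    exists q : 'I_k.+1, a = left q | exists q : 'I_k.+1, a = right q].
  have [a1|a1] := boolP ((pos a < i) || (i + 2 * k + 1 < pos a))%N.
    by constructor 1; apply/orP.
  have [a2|a2] := leqP (pos a) (i + k).
    have qk : (pos a - i < k.+1)%N by lia.
    by constructor 2; exists (Ordinal qk); apply: pos_inj; rewrite leftE /=;
      lia.
  have qk : (pos a - (i + k).+1 < k.+1)%N by lia.
  by constructor 3; exists (Ordinal qk); apply: pos_inj; rewrite rightE /=; lia.
rewrite /adm_sum (bigID (fun S : {set _} => f @: S == setT)) /=.
rewrite [X in _ + X]big1 ?addr0 => [|S SnT]; last first.
  rewrite /adm_term low_nsurj //; apply: contra SnT => /is_surjP fS.
  apply/eqP/setP => y; have [a <-] := fS y; rewrite inE; apply: imset_f; exact: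
    enum_valP.
rewrite (reindex_onto (fun c => kept_set n i k (on_nat c)) choices) /=;
  last first.
  move=> S /eqP ST; apply/setP => a; rewrite inE.
  have [out|[q ->]|[q ->]] := split_pos a.
  - rewrite keep_out //; have [a' aS] := imf S a ST.
    move/(congr1 (@pos _)) => E; suff <- : a' = a by rewrite aS.
    by apply: pos_inj; move: E; rewrite !fE; repeat (case: ifP => ?); lia.
  - by rewrite leftE keep0 ?leq_ord // on_natE ffunE; case:
    (left q \in S) => //=; case: ifP.
  - rewrite rightE keep1 ?leq_ord // on_natE ffunE.
    have [fS|fS] := boolP (left q \in S) => /=; first by case: (right q \in S).
    apply/esym; have [a' aS E] := imf S (right q) ST.
    have [out|[q' qE]|[q' qE]] := split_pos a'.
    + have := congr1 (@pos _) E; rewrite rightf leftf fE; have := ltn_ord q.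
      by case: ifP => ? ? ?; exfalso; lia.
    + move: E fS; rewrite qE rightf => /(congr1 (@pos _));
      rewrite !leftf => /addnI/val_inj <-.
      by rewrite -qE aS.
    + move: E; rewrite qE !rightf => /(congr1 (@pos _));
      rewrite !leftf => /addnI/val_inj <-.
      by rewrite -qE aS.
apply: eq_bigl => c; apply/andP; split.
  apply/eqP/setP => y; rewrite in_setT; apply/imsetP.
  have ky a : keep i k (on_nat c) (pos a) -> f a = y ->
      exists2 a, a \in kept_set n i k (on_nat c) & y = f a.
    by move=> Ka <-; exists a => //; rewrite inE.
  have yn : (0 < pos y <= (n + k).-1)%N := ltn_ord y.
  have [yi|yi] := boolP (i <= pos y <= i + k)%N.
    have qk : (pos y - i < k.+1)%N by lia.
    pose q := Ordinal qk; have fq : f (left q) = y.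
      by apply: pos_inj; rewrite leftf /=; lia.
    have [cq|cq] := eqVneq (c q) (Some false).
      by apply: (ky (right q));
        rewrite ?rightf // rightE keep1 ?leq_ord // on_natE cq.
    by apply: (ky (left q)); rewrite // leftE keep0 ?leq_ord // on_natE.
  have [yi'|yi'] := ltnP (pos y) i.
    have [|a aE] := @pos_ex (n + 2 * k) (pos y); first by lia.
    apply: (ky a); first by apply: keep_out => //; lia.
    by apply: pos_inj; rewrite fE aE; case: ifP => ?; lia.
  have [|a aE] := @pos_ex (n + 2 * k) (pos y + k.+1)%N; first by lia.
  apply: (ky a); first by apply: keep_out => //; lia.
  by apply: pos_inj; rewrite fE aE; case: ifP => ?; lia.
apply/eqP/ffunP => q; rewrite ffunE !inE leftE rightE keep0 ?keep1 ?leq_ord //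
  on_natE.
by case: (c q) => [[]|].
Qed.

Definition fifth_rhs (x : M n) : M (n + k).-1 :=
  Pops M (iota i k.+1) (n + 2 * k) (n + k).-1
    (lowf M (n + 2 * k) (n + 2 * k) (shuffle i k)
       (Hop M (n + 2 * k) (n + k) i alpha
          (Hop M (n + k) n i.+1 alpha x)))
  + \sum_(1 <= beta < k.+2)
      \sum_(u : beta.-tuple 'I_k.+1 | sorted ltn [seq val l | l <- u])
        Pops M (vlist i u) (n + 2 * k - beta) (n + k).-1
          (\sum_(eps : beta.-tuple bool |
                   (beta - k <= eps_sum eps <= k)%N)
             lowf M (n + 2 * k - beta) (n + 2 * k - beta)
               (remove_columns (n + 2 * k) (shuffle i k)
                  (removed i u eps))
               (Hop M (n + 2 * k - beta) (n + k - eps_sum eps) i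
                  (gamma_kept i u eps alpha false)
                  (Hop M (n + k - eps_sum eps) n i.+1
                     (gamma_kept i u eps alpha true) x))).

(** Subsets that leave out a whole fibre of phi are the choices that violate
    the condition defining J; they contribute nothing. *)
Lemma fifth_rhsE (f : 'I_(n + 2 * k) -> 'I_(n + k).-1)
    (phi : smor P (n + 2 * k) n) x :
  (forall a, pos (f a) = if (pos a <= i + k)%N then pos a
    else (pos a - k.+1)%N) ->
  (forall c, lmap (@pos _) (lab phi c) ~~ dlab i alpha alpha (pos c)) ->
  (forall a, pos (phi a) = smap i.+1 k (smap i k (pos a))) ->
  fifth_rhs x = adm_sum f phi x.
Proof.
move=> fE phil phiE; rewrite (adm_sum_choices phi x fE) sum_choices;
  congr (_ + _).
  set c := on_nat _.
  have cN q : c q = None by rewrite /c /on_nat; case: insub => // q';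
    rewrite ffunE.
  have keepT t : keep i k c t by rewrite /keep /rem_at !cN !andbF.
  have wE e : Tagged P alpha = Tagged P (gkeep alpha (fun q => c q != Some e)).
    have E : (fun=> true) = (fun q : 'I_k.+1 => c q != Some e).
      by apply: functional_extensionality => q; rewrite cN.
    apply: etrans (congr1 (fun K => Tagged P (gkeep alpha K)) E).
    exact: esym (op_comp1r alpha).
  rewrite -(summandE iso _ fE phil (wE false) (wE true) (m := (n + k)%N)
    (N := (n + 2 * k)%N)
             (sf := shuffle i k)) //.
  - rewrite /vmerge (eq_filter (a2 := xpredT)) ?filter_predT // => v;
    by rewrite cN.
  - by rewrite i1.
  - by lia.
  - move=> y yn; have rT (K : pred nat) t : K =1 xpredT -> rank K t = t.
      by move=> KT; rewrite /rank (eq_count KT) count_predT size_iota.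
    rewrite rT => [|t]; last by rewrite /keep' keepT.
    by rewrite (eq_filter (a2 := xpredT)) // filter_predT nth_iota.
apply: eq_big_nat => b /andP[b1 bk]; apply: eq_bigr => u us.
rewrite Pops_sum [RHS](bigID (fun eps => (b - k <= eps_sum eps <= k)%N)) /=.
rewrite [X in _ + X]big1 ?addr0 => [|eps J]; last first.
  set c := on_nat _.
  have T : (nkeep c true k.+1 + eps_sum eps = k.+1)%N by exact: nkeep_true.
  have F : (nkeep c false k.+1 + b = k.+1 + eps_sum eps)%N by exact:
    nkeep_false.
  have no e q : nkeep c e k.+1 = 0%N -> (q < k.+1)%N -> c q = Some e.
    move=> /eqP; rewrite sum_nat_seq_eq0 => /allP H qk.
    by have := H q; rewrite mem_index_iota qk => /(_ isT); case:
      (c q =P Some e).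
  have /orP J' : ((k < eps_sum eps) || (eps_sum eps < b - k))%N.
    by move: J; rewrite negb_and -!ltnNge orbC.
  rewrite /adm_term [up _ _]up_nsurj ?low0 //; apply/negP => /is_surjP psurj.
  (* a point over which everything is left out would be missed by phi *)
  have absurd t : (0 < t <= n)%N ->
      (forall p, smap i.+1 k (smap i k p) = t -> rem_at i k c p) -> False.
    move=> /pos_ex[d dE] H; have [a ad] := psurj d.
    have ak : keep i k c (pos (enum_val a)) by have := enum_valP a; rewrite inE.
    by case/negP: ak; apply: H; rewrite -phiE -dE -ad.
  case: J' => J'.
    apply: (absurd i.+1) => // p; move E: (smap i k p) => z pE.
    have pk : (i + k < p <= i + 2 * k + 1)%N by move: E pE; cases_lia.
    by rewrite /rem_at pk (no true (p - (i + k).+1)%N) ?eqxx ?orbT //; lia.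
  apply: (absurd i) => [|p]; first by lia.
  move E: (smap i k p) => z pE.
  have pk : (i <= p <= i + k)%N by move: E pE; cases_lia.
  by rewrite /rem_at pk (no false (p - i)%N) ?eqxx //; lia.
apply: eq_bigr => eps /andP[J0 J1].
rewrite (vlist_vmerge _ eps us).
have T := nkeep_true eps us; have F := nkeep_false eps us.
have wE e : Tagged P (gamma_kept i u eps alpha e) =
    Tagged P (gkeep alpha (fun q => on_nat (choice u eps) q != Some e)).
  exact: (congr1 (fun K => Tagged P (gkeep alpha K)) (kept_choice i eps us e)).
have pE e : (\sum_(l < k.+1) kept i u eps e l)%N = nkeep
  (on_nat (choice u eps)) e k.+1.
  by have /= -> := congr1 tag (wE e); rewrite /nkeep big_mkord.
rewrite -(summandE iso _ fE phil (wE false) (wE true)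
            (m := (n + k - eps_sum eps)%N) (N := (n + 2 * k - b)%N)
            (sf := remove_columns (n + 2 * k) (shuffle i k) (removed i u eps)))
              //.
- by rewrite i1.
- by rewrite pE; lia.
- by rewrite pE; lia.
- by rewrite pE; lia.
- by rewrite pE; lia.
- move=> y yN; apply: remove_columns_rank => //; first by lia.
    exact: removed_rem_at.
  have [d dE] : exists d, (n + 2 * k = i + 2 * k + 1 + d)%N
    by exists (n - i.+1)%N; lia.
  by rewrite dE rank_high //; lia.
Qed.

End Fifth.

(** * The equivalence *)

Definition single_op (P : operad) j (w : P 1) (y : nat) : P 1 :=
  if y == j then w else op_one P.

(** Blowing up a point into one point is the case of arity 1, where H is a
    special case of I. *)
Lemma hlab_unary (P : operad) j (w : P 1) c :
    hlab j w c = ilab (single_op j w) c.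
Proof.
rewrite /hlab /ilab /single_op; case: ltngtP => [//|_|->].
  by rewrite addn0.
by congr Lop; apply: functional_extensionality => q; rewrite ord1 addn0.
Qed.

Lemma fifth_square (P : operad) n i k (alpha : P k.+1) (g : 'I_n -> 'I_n.-1)
    (F : smor P (n + k).-1 n.-1) : 0 < i < n ->
  (forall x, pos (g x) = smap i 1 (pos x)) ->
  (forall c, lmap (@pos _) (lab F c) ~~ hlab i alpha (pos c)) ->
  exists (f : 'I_(n + 2 * k) -> 'I_(n + k).-1) (phi : smor P (n + 2 * k) n),
    [/\ sq f g phi F,
        forall a, pos (f a) = if pos a <= i + k then pos a else pos a - k.+1,
        forall c, lmap (@pos _) (lab phi c) ~~ dlab i alpha alpha (pos c) &
        forall a, pos (phi a) = smap i.+1 k (smap i k (pos a))].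
Proof.
move=> i_n gE Fl.
have [|||F1 F1s F1l] := @hlab_exists P (n + k) n i.+1 _ alpha; try lia.
have [|||F0 F0s F0l] := @hlab_exists P (n + 2 * k) (n + k) i _ alpha; try lia.
have fb (a : 'I_(n + 2 * k)) :
    (if pos a <= i + k then pos a else pos a - k.+1).-1 < (n + k).-1.
  by have := ltn_ord a; rewrite /pos; case: ifP; lia.
pose f a := Ordinal (fb a); pose phi := scomp F1 F0.
have fE a : pos (f a) = if pos a <= i + k then pos a else pos a - k.+1.
  by rewrite /f {1}/pos /=; case: ifP; rewrite /pos; lia.
have phil c : lmap (@pos _) (lab phi c) ~~ dlab i alpha alpha (pos c).
  by rewrite -hlab_hlab //; apply: pos_comp.
exists f, phi; split=> // [|a].
  by apply: (sq_nat fE gE phil Fl) => c _; apply: merge_dlab; lia.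
by rewrite (hlab_fun _ F1l) // (hlab_fun _ F0l).
Qed.

Section Equivalence.
Variables (P : unitary_operad) (M : janus P).

Lemma blowup_at_merge n i k (alpha : P k.+1) : pseudo_mackey M -> 1 <= i ->
    i < n ->
  forall x : M n,
    Hop M (n + k).-1 n.-1 i alpha (Pop M n i x) = fifth_rhs i alpha x.
Proof.
move=> /pseudo_mackeyP[iso B] i1 i_n x.
have [||g gs gE] := @merge_exists n n.-1 i; [by rewrite i1|by []|].
have [|||F Fs Fl] := @hlab_exists P (n + k).-1 n.-1 i _ alpha; try lia.
have [|f [phi [sqr fE phil phiE]]] := fifth_square _ gE Fl; first by rewrite i1.
rewrite (Pop_low _ gs gE) (Hop_up _ _ _ _ Fl) //=; last by lia.
by rewrite (B _ _ _ _ _ gs Fs _ _ _ sqr) (fifth_rhsE iso i1 i_n x fE phil phiE).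
Qed.

Hypothesis R1 : forall n i, 1 <= i -> i <= n - 1 ->
  cancel (Tup M n i) (Top M n i) /\ cancel (Top M n i) (Tup M n i).
Hypothesis R2 : forall n i (alpha : nat -> P 1), 1 <= i -> i < n -> forall x :
    M n,
  Iop M n.-1 alpha (Pop M n i x) =
  Pop M n i (Iop M n (fun j => if j <= i then alpha j else alpha j.-1) x).
Hypothesis R3 : forall n i j k (alpha : P k.+1),
  1 <= i -> i < j -> j < n -> 1 <= k -> forall x : M n,
  Hop M (n + k).-1 n.-1 j alpha (Pop M n i x) =
  Pop M (n + k) i (Hop M (n + k) n j.+1 alpha x).
Hypothesis R5 : forall n i k (alpha : P k.+1), 1 <= i -> i < n -> 1 <= k ->
  forall x : M n,
  Hop M (n + k).-1 n.-1 i alpha (Pop M n i x) = fifth_rhs i alpha x.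

Lemma relations_iso : iso_law M.
Proof. by apply: iso_law_generators => n i i1 i_n; have [] := R1 i1 i_n. Qed.

Lemma Hop_Iop n j (w : P 1) (x : M n) : 0 < j <= n ->
  Hop M n n j w x = Iop M n (single_op j w) x.
Proof.
move=> jn; have [|||F Fs Fl] := @hlab_exists P n n j _ w; try lia.
rewrite (Hop_up _ _ _ _ Fl) ?subnn //; apply/esym/Iop_up => c.
by rewrite -hlab_unary.
Qed.

Lemma Iop_eq n alpha beta (x : M n) : alpha =1 beta ->
    Iop M n alpha x = Iop M n beta x.
Proof. by move/functional_extensionality ->. Qed.

(** The third relation, together with its analogue for unary operations, which
    is a case of the second relation. *)
Lemma relations_before n j p (w : P p) : 0 < p -> 1 < j -> j < n -> forall x :
    M n,
  Hop M (n + p.-1).-1 n.-1 j w (Pop M n 1 x) =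
  Pop M (n + p.-1) 1 (Hop M (n + p.-1) n j.+1 w x).
Proof.
case: p w => // [[|k]] w _ j1 jn x; last by apply: R3.
(* in arity 1 the types mention n + 0, to be replaced everywhere at once *)
move: (addn0 n); rewrite /=; move: (n + 0) => m ->.
rewrite !Hop_Iop; try lia.
rewrite R2 //; last by lia.
congr (Pop M n 1); apply: Iop_eq => y; rewrite /single_op.
by case: ltnP => y1; congr (if _ then _ else _); lia.
Qed.

(** The fifth relation, together with its analogue for unary operations, which
    is a case of the second relation: the unary operation is duplicated. *)
Lemma relations_first n p a (w : P p) (g : 'I_n -> 'I_n.-1)
    (F : smor P a n.-1) :
  a = (n + p.-1).-1 -> 1 < n -> 0 < p -> is_surj g -> is_surj F ->
  (forall x, pos (g x) = smap 1 1 (pos x)) ->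
  (forall c, lmap (@pos _) (lab F c) ~~ hlab 1 w (pos c)) -> mackey_at M g F.
Proof.
move=> aE n1 p0 gs Fs gE Fl; have iso := relations_iso.
case: p w p0 aE Fl => // [[|k]] w _ aE Fl.
  rewrite /= addn0 in aE; subst a.
  have {}Fl c : lmap (@pos _) (lab F c) ~~ ilab (single_op 1 w) (pos c).
    by rewrite -hlab_unary.
  have [F' F'id F'l] := ilab_exists n
    (fun j => if j <= 1 then single_op 1 w j else single_op 1 w j.-1).
  have sqr : sq g g F' F.
    by apply: (sq_nat gE gE F'l Fl) => c _; apply: merge_ilab.
  apply: (mackey_one iso sqr) => x.
  rewrite adm_sum_single //; last by apply: single_admissible => b; right=> b';
    rewrite !F'id.
  by rewrite -(Iop_up _ Fl) -(Iop_up _ F'l) -!(Pop_low _ gs gE) R2.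
subst a; have i_n : 0 < 1 < n by rewrite n1.
have [f [phi [sqr fE phil phiE]]] := fifth_square i_n gE Fl.
apply: (mackey_one iso sqr) => x.
rewrite -(fifth_rhsE iso _ _ x fE phil phiE) // -R5 //.
rewrite (Pop_low _ gs gE) (Hop_up _ _ _ _ Fl) //=; lia.
Qed.

Lemma relations_mackey : pseudo_mackey M.
Proof.
apply/pseudo_mackeyP; split; first exact: relations_iso.
move=> B C D g psi gs psis.
exact: (mackey_all relations_iso relations_before relations_first).
Qed.

End Equivalence.

(* k has no upper bound: with only k < n in the third and fourth relations and
   k <= n in the fifth, the converse fails, as M^*(psi) M_*(g) is then
   unconstrained when, e.g., g : 2 -> 1 and psi : 4 -> 1 carries an operation of
   arity 4 that is not a composite. *)
Theorem proposition7p5 (P : unitary_operad) (M : janus P) :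
  pseudo_mackey M <->
  [/\ forall n i, 1 <= i -> i <= n - 1 ->
        cancel (Tup M n i) (Top M n i) /\ cancel (Top M n i) (Tup M n i),
      forall n i (alpha : nat -> P 1), 1 <= i -> i < n -> forall x : M n,
        Iop M n.-1 alpha (Pop M n i x) =
        Pop M n i (Iop M n (fun j => if j <= i then alpha j else alpha j.-1) x),
      forall n i j k (alpha : P k.+1), 1 <= i -> i < j -> j < n -> 1 <= k ->
        forall x : M n,
        Hop M (n + k).-1 n.-1 j alpha (Pop M n i x) =
        Pop M (n + k) i (Hop M (n + k) n j.+1 alpha x),
      forall n i j k (alpha : P k.+1), 1 <= j -> j < i -> i < n -> 1 <= k ->
        forall x : M n,
        Hop M (n + k).-1 n.-1 j alpha (Pop M n i x) =
        Pop M (n + k) (k + i) (Hop M (n + k) n j alpha x)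
    & forall n i k (alpha : P k.+1), 1 <= i -> i < n -> 1 <= k ->
        forall x : M n,
        Hop M (n + k).-1 n.-1 i alpha (Pop M n i x) =
        (Pops M (iota i k.+1) (n + 2 * k) (n + k).-1
           (lowf M (n + 2 * k) (n + 2 * k) (shuffle i k)
              (Hop M (n + 2 * k) (n + k) i alpha
                 (Hop M (n + k) n i.+1 alpha x)))
         + \sum_(1 <= beta < k.+2)
             \sum_(u : beta.-tuple 'I_k.+1 | sorted ltn [seq val l | l <- u])
               Pops M (vlist i u) (n + 2 * k - beta) (n + k).-1
                 (\sum_(eps : beta.-tuple bool |
                          (beta - k <= eps_sum eps <= k)%N)
                    lowf M (n + 2 * k - beta) (n + 2 * k - beta)
                      (remove_columns (n + 2 * k) (shuffle i k)
                         (removed i u eps))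
                      (Hop M (n + 2 * k - beta) (n + k - eps_sum eps) i
                         (gamma_kept i u eps alpha false)
                         (Hop M (n + k - eps_sum eps) n i.+1
                            (gamma_kept i u eps alpha true) x))))%R].

Proof.
split=> [mackey|[R1 R2 R3 _ R5]]; last exact: relations_mackey R1 R2 R3 R5.
split.
- exact: tau_inverse.
- exact: unary_past_merge.
- by move=> n i j k alpha i1 ij jn _; apply: blowup_past_merge_before.
- by move=> n i j k alpha j1 ji i_n _; apply: blowup_past_merge_after.
- by move=> n i k alpha i1 i_n _; apply: blowup_at_merge.
Qed.
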